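(* Consider the reflected Euler--Maruyama discretization of the finite-dimensional stochastic Ghil--Sellers model described in the context, i.e. the chain on $I_T^N$ $$X_{k+1}^{\varepsilon,N}=\mathcal R_N\bigl(\Phi_{k,N}^\varepsilon(X_k^{\varepsilon,N})+\sqrt h\,\Sigma_N\xi_k\bigr),\qquad\Phi_{k,N}^\varepsilon(u)=u+hF_N^\varepsilon(t_k,u),\qquad k\in\mathbb Z,$$ under the regularity and boundedness conditions stated there. Assume that $\Sigma_N\Sigma_N^{\mathsf T}\ge\lambda_NI_N$ for some $\lambda_N>0$, that the greenhouse parameters satisfy $$m^\varepsilon(t)=m(t)+\varepsilon\dot m(t)+r_m^\varepsilon(t),\qquad\sup_{t\in\mathbb R}|\dot m(t)|<\infty,\qquad\sup_{t\in\mathbb R}\frac{|r_m^\varepsilon(t)|}{|\varepsilon|}\xrightarrow[\varepsilon\to0]{}0,$$ and that there is $m_*<1$ with $0\le m^\varepsilon(t)\le m_*$ for every $t\in\mathbb R$ and every sufficiently small $\varepsilon\geq 0$. Let $\boldsymbol\mu^{\varepsilon,N}=(\mu_k^{\varepsilon,N})_{k\in\mathbb Z}$ be the unique equivariant family of probability densities, $\mu_{k+1}^{\varepsilon,N}=L_{k,N}^\varepsilon\mu_k^{\varepsilon,N}$. Then $$\boldsymbol\eta^N=\lim_{\varepsilon\to0}\frac{\boldsymbol\mu^{\varepsilon,N}-\boldsymbol\mu^{0,N}}{\varepsilon}$$ exists in $\ell^\infty(\mathbb Z;L^1(I_T^N,m_N))$. Let $L_{k,N}=L_{k,N}^0$,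 $\mu_k^N=\mu_k^{0,N}$, let $$(\dot L_{k,N}\varphi)(y)=\int_{I_T^N}\varphi(u)\,D_1k_{I_T,N,h}\bigl(\Phi_{k,N}^0(u),y\bigr)\bigl[hG_N(t_k,u)\bigr]\,dm_N(u),$$ and set $g_{k,N}:=\dot L_{k,N}\mu_k^N$. Then $$\eta_{k,N}=g_{k-1,N}+\sum_{j=1}^\infty L_{k-1,N}L_{k-2,N}\cdots L_{k-j,N}\,g_{k-j-1,N},$$ and the series converges absolutely in $L^1(I_T^N,m_N)$, uniformly in $k$.
   Context: Grid: $-1=x_{1/2}<x_{3/2}<\dots<x_{N+1/2}=1$, $C_i=[x_{i-1/2},x_{i+1/2}]$, $x_i\in C_i$ with $x_{i+1}>x_i$; $\omega(x)=\cos(\pi x/2)$, $w_i=\int_{C_i}\omega\,dx$; $c:[-1,1]\to(0,\infty)$ is given (heat capacity) and $c_i=c(x_i)>0$. Discrete diffusion: for $1\le i\le N-1$, $J_{i+1/2}(u)=\omega(x_{i+1/2})k_{i+1/2}(u)\frac{u_{i+1}-u_i}{x_{i+1}-x_i}$ with given functions $k_{i+1/2}:\mathbb R^N\to(0,\infty)$, $J_{1/2}=J_{N+1/2}=0$, and $(\mathcal D_N(u))_i=\left(\frac2\pi\right)^2\frac{J_{i+1/2}(u)-J_{i-1/2}(u)}{c_iw_i}$. Radiation: $Q_i(t)\ge0$ (solar irradiance at $x_i$), $\alpha_i(s)$ (albedo at $x_i$), constants $\sigma,c_3>0$, $\mathcal E(s)=s|s|^3$. The drift $F_N^\varepsilon:\mathbb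 R\times\mathbb R^N\to\mathbb R^N$ is $$(F_N^\varepsilon(t,u))_i=(\mathcal D_N(u))_i+\frac{Q_i(t)}{c_i}(1-\alpha_i(u_i))-\frac{\sigma}{c_i}\mathcal E(u_i)\bigl(1-m^\varepsilon(t)\tanh(c_3u_i^6)\bigr).$$ The SDE being discretized is $dU_t^\varepsilon=F_N^\varepsilon(t,U_t^\varepsilon)dt+\Sigma_NdW_t$ with constant $\Sigma_N\in\mathbb R^{N\times N}$. Regularity and boundedness conditions: each $Q_i$ is bounded uniformly in time, $0\le\alpha_i\le1$, and the functions entering $\mathcal D_N$ (the $k_{i+1/2}$) and the $\alpha_i$ are locally Lipschitz. Derivative of the drift at $\varepsilon=0$: $(G_N(t,u))_i=\frac{\sigma}{c_i}\dot m(t)\,\mathcal E(u_i)\tanh(c_3u_i^6)$. Compact dynamics: $h>0$ is a fixed time step, $t_k=t_0+kh$, $(\xi_k)$ are independent standard Gaussian vectors in $\mathbb R^N$; $I_T=[T_-,T_+]$, $T_-<T_+$, is a fixed closed bounded interval, $m_N$ is normalized Lebesgue measure on $I_T^N$, and $\mathcal R_N:\mathbb R^N\to I_T^N$ acts componentwise by $s\mapsto T_-+\ell-\bigl|((s-T_-)\bmod2\ell)-\ell\bigr|$, $\ell=T_+-T_-$. $q_{N,h}$ is the Gaussian density of $\sqrt h\,\Sigma_N\xi_k$; $k_{I_T,N,h}(z,\cdot)$, $z\in\mathbb R^N$, is the density with respect to $m_N$ of $(\mathcal R_N)_*(q_{N,h}(\cdot-z)\,dx)$; the annealed transfer operator on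 $L^1(I_T^N,m_N)$ is $(L_{k,N}^\varepsilon\varphi)(y)=\int_{I_T^N}\varphi(u)\,k_{I_T,N,h}(\Phi_{k,N}^\varepsilon(u),y)\,dm_N(u)$. $D_1$ denotes the Fréchet derivative in the first variable of $z\mapsto k_{I_T,N,h}(z,\cdot)$ as an $L^1(I_T^N,m_N)$-valued map, and $D_1k(z,\cdot)[v]$ its value in direction $v$. *)

(* Defs.v *)
From HB Require Import structures.
From mathcomp Require Import all_boot all_order all_algebra.
From mathcomp Require Import all_classical all_reals all_analysis.

Set Implicit Arguments.
Unset Strict Implicit.
Unset Printing Implicit Defensive.

Import Order.TTheory GRing.Theory Num.Theory.
Import numFieldNormedType.Exports.

Local Open Scope classical_set_scope.
Local Open Scope ring_scope.

Definition colvec_display : measure_display.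
Proof. exact: default_measure_display. Qed.

Section colvec_measurable.
Context (R : realType) (n : nat).

Definition coordc (i : 'I_n) (v : 'cV[R]_n) : R := v i 0.

Let colvec_set0 : g_sigma_preimage coordc set0.
Proof. exact: sigma_algebra0. Qed.

Let colvec_setC A : g_sigma_preimage coordc A -> g_sigma_preimage coordc (~` A).
Proof. exact: sigma_algebraC. Qed.

Let colvec_bigcup (F : (set 'cV[R]_n)^nat) :
  (forall i, g_sigma_preimage coordc (F i)) ->
  g_sigma_preimage coordc (\bigcup_i F i).
Proof. exact: sigma_algebra_bigcup. Qed.

HB.instance Definition _ := @isMeasurable.Build colvec_display
  'cV[R]_n (g_sigma_preimage coordc) colvec_set0 colvec_setC colvec_bigcup.

Lemma measurable_coordc (i : 'I_n) : measurable_fun [set: 'cV[R]_n] (coordc i).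
Proof.
move=> _ Y mY; rewrite setTI; apply: sub_sigma_algebra => /=.
rewrite -bigcup_seq/=; exists i => /=; first by rewrite mem_index_enum.
by exists Y => //; rewrite setTI.
Qed.

Lemma measurable_fun_coordcP d (T : measurableType d) (f : T -> 'cV[R]_n) :
  (forall i, measurable_fun [set: T] (coordc i \o f)) ->
  measurable_fun [set: T] f.
Proof.
move=> mf.
have sub : g_sigma_preimage (fun i => coordc i \o f) `<=` measurable.
  apply: smallest_sub; first exact: sigma_algebra_measurable.
  rewrite -bigcup_seq => A [i _ [B mB <-]]; exact: mf.
move=> _ A mA; apply: sub; rewrite g_sigma_preimage_comp.
by exists A.
Qed.

End colvec_measurable.

Section product_measure_pow.
Context (R : realType).

Definition consc n (p : 'cV[R]_n * measurableTypeR R) : 'cV[R]_n.+1 :=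
  \col_i (if unlift ord0 i is Some j then p.1 j 0 else p.2).

Lemma measurable_consc n :
  measurable_fun [set: 'cV[R]_n * measurableTypeR R] (@consc n).
Proof.
apply: measurable_fun_coordcP => i.
case: (unliftP ord0 i) => [j|] ->.
- rewrite [X in measurable_fun _ X](_ : _ = coordc j \o fst); last first.
    by apply/funext => p /=; rewrite /coordc mxE liftK.
  by apply: measurableT_comp => //; exact: measurable_coordc.
- rewrite [X in measurable_fun _ X](_ : _ = snd)//.
  by apply/funext => p /=; rewrite /coordc mxE unlift_none.
Qed.

Variable mu : {sigma_finite_measure set (measurableTypeR R) -> \bar R}.

Section powm_step.
Context n (m : {measure set 'cV[R]_n -> \bar R}).

Definition powm_step : set 'cV[R]_n.+1 -> \bar R :=
  pushforward (m \x mu)%E (@consc n).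

Let powm_step0 : powm_step set0 = 0%E.
Proof. by rewrite /powm_step /pushforward preimage_set0 measure0. Qed.

Let powm_step_ge0 A : (0 <= powm_step A)%E.
Proof. by rewrite /powm_step /pushforward; apply: measure_ge0. Qed.

Let powm_step_sigma_additive : semi_sigma_additive powm_step.
Proof.
move=> F mF tF mUF; rewrite /powm_step /pushforward preimage_bigcup.
have mpre A : measurable A -> measurable (@consc n @^-1` A).
  by move=> mA; rewrite -[X in measurable X]setTI; exact: measurable_consc.
apply: measure_semi_sigma_additive => [i||].
- by apply: mpre; exact: mF.
- apply/classical_sets.trivIsetP => i j _ _ ij; rewrite -preimage_setI.
  move/classical_sets.trivIsetP : tF => /(_ _ _ I I ij) ->.
  by rewrite preimage_set0.
- by rewrite -preimage_bigcup; exact: mpre.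
Qed.

HB.instance Definition _ := isMeasure.Build _ _ _ powm_step
  powm_step0 powm_step_ge0 powm_step_sigma_additive.

End powm_step.

Fixpoint powm n : {measure set 'cV[R]_n -> \bar R} :=
  if n is n'.+1 then powm_step (powm n') else dirac (0 : 'cV[R]_0).

End product_measure_pow.

Definition lebc (R : realType) n : {measure set 'cV[R]_n -> \bar R} :=
  powm (@lebesgue_measure R) n.

Definition std_gauss (R : realType) n : {measure set 'cV[R]_n -> \bar R} :=
  powm (normal_prob (0 : R) 1) n.

Definition is_density d (T : measurableType d) (R : realType)
    (mu : {measure set T -> \bar R}) (nu : set T -> \bar R) (f : T -> R) :=
  [/\ measurable_fun [set: T] f, (forall x, 0 <= f x) &
      forall A, measurable A -> (\int[mu]_(x in A) (f x)%:E)%E = nu A].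

Definition tanh (R : realType) (x : R) : R :=
  (expR x - expR (- x)) / (expR x + expR (- x)).

Definition modr (R : realType) (a b : R) : R := a - b * (Num.floor (a / b))%:~R.

(* Cells, nodes and components are numbered from 0, i.e.
   [edge j] is x_{j+1/2} (0 <= j <= N), [node i] is x_{i+1} (0 <= i < N),
   [cond j] is k_{j+1/2} (1 <= j <= N-1), and cell i is
   [edge i, edge i.+1]; values at other indices are irrelevant. *)
Record gs_model (R : realType) (N : nat) := GSModel {
  edge : nat -> R;
  node : nat -> R;
  heatcap : R -> R;
  cond : nat -> 'cV[R]_N -> R;
  solar : 'I_N -> R -> R;
  albedo : 'I_N -> R -> R;
  sigma : R;
  c3 : R;
  dt : R;
  t0 : R;
  noise : 'M[R]_N;
  Tmin : R;
  Tmax : R }.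

Record gs_conditions (R : realType) (N : nat) (M : gs_model R N) : Prop := {
  edge_first : edge M 0 = -1;
  edge_last : edge M N = 1;
  edge_incr : forall j, (j < N)%N -> edge M j < edge M j.+1;
  node_cell : forall i, (i < N)%N -> edge M i <= node M i <= edge M i.+1;
  node_incr : forall i, (i.+1 < N)%N -> node M i < node M i.+1;
  heatcap_gt0 : forall x, -1 <= x <= 1 -> 0 < heatcap M x;
  cond_gt0 : forall j u, (0 < j < N)%N -> 0 < cond M j u;
  cond_lip : forall j, (0 < j < N)%N ->
    [locally [lipschitz cond M j u | u in [set: 'cV[R]_N]]];
  solar_ge0 : forall i t, 0 <= solar M i t;
  solar_bounded : forall i, exists B, forall t, solar M i t <= B;
  albedo_01 : forall i s, 0 <= albedo M i s <= 1;
  albedo_lip : forall i, [locally [lipschitz albedo M i s | s in [set: R]]];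
  sigma_gt0 : 0 < sigma M;
  c3_gt0 : 0 < c3 M;
  dt_gt0 : 0 < dt M;
  Tmin_lt_Tmax : Tmin M < Tmax M }.

Section model.
Context (R : realType) (N : nat) (M : gs_model R N).
Local Notation V := 'cV[R]_N.
Implicit Types (u y z v : V) (t s : R) (k : int).

Definition omega (x : R) : R := cos (pi * x / 2).

Definition cell_weight (i : nat) : R :=
  \int[lebesgue_measure]_(x in `[edge M i, edge M i.+1]) omega x.

Definition cell_temp u (i : nat) : R := if insub i is Some i' then u i' 0 else 0.

(* J_{j+1/2} *)
Definition flux (j : nat) u : R :=
  if (0 < j < N)%N then
    omega (edge M j) * cond M j u *
    ((cell_temp u j - cell_temp u j.-1) / (node M j - node M j.-1))
  else 0.

Definition diffusion u (i : 'I_N) : R :=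
  (2 / pi) ^+ 2 *
  ((flux i.+1 u - flux i u) / (heatcap M (node M i) * cell_weight i)).

Definition emission s : R := s * `|s| ^+ 3.

(* g is the greenhouse parameter, i.e. m^epsilon *)
Definition drift (g : R -> R) t u : V := \col_i
  (diffusion u i
   + solar M i t / heatcap M (node M i) * (1 - albedo M i (u i 0))
   - sigma M / heatcap M (node M i) * emission (u i 0)
     * (1 - g t * tanh (c3 M * u i 0 ^+ 6))).

(* d/d epsilon of [drift] at epsilon = 0; gdot is the derivative of the
   greenhouse parameter *)
Definition drift_dot (gdot : R -> R) t u : V := \col_i
  (sigma M / heatcap M (node M i) * gdot t * emission (u i 0)
   * tanh (c3 M * u i 0 ^+ 6)).

Definition time k : R := t0 M + k%:~R * dt M.

Definition euler (g : R -> R) k u : V := u + dt M *: drift g (time k) u.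

Definition reflect1 s : R :=
  let l := Tmax M - Tmin M in
  Tmin M + l - `| modr (s - Tmin M) (2 * l) - l |.

Definition reflect u : V := \col_i reflect1 (u i 0).

Definition box : set V := [set u | forall i, Tmin M <= u i 0 <= Tmax M].

Lemma measurable_box : measurable box.
Proof.
rewrite (_ : box =
  \bigcap_(i in [set: 'I_N]) (coordc i @^-1` `[Tmin M, Tmax M])); last first.
  apply/seteqP; split=> u /= hu i; first by move=> _; exact: hu.
  by have := hu i I; rewrite /= in_itv/=.
apply: fin_bigcap_measurable => // i _.
rewrite -[X in measurable X]setTI.
by apply: measurable_coordc => //; exact: measurable_itv.
Qed.

(* normalized Lebesgue measure on [box], as a measure on R^N; the absolute value
   only serves to make the normalizing constant a nonnegative number without a
   proof that Tmin < Tmax *)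
Definition mbox : {measure set V -> \bar R} :=
  mscale (`|Tmax M - Tmin M| ^- N)%:nng (mrestr (@lebc R N) measurable_box).

Definition is_noise_density (q : V -> R) :=
  is_density (@lebc R N)
    (pushforward (@std_gauss R N)
       (fun xi : V => Num.sqrt (dt M) *: (noise M *m xi)))
    q.

(* k(z,.) is the density with respect to [mbox] of the image under [reflect]
   of q(. - z) dx.  Joint measurability selects versions for which the
   pointwise integral formulas below make sense. *)
Definition is_transition_density (q : V -> R) (kk : V -> V -> R) :=
  measurable_fun [set: V * V] (fun p => kk p.1 p.2) /\
  forall z, is_density mbox
    (pushforward (fun A => \int[@lebc R N]_(x in A) (q (x - z))%:E)%E reflect)
    (kk z).

Definition L1norm (f : V -> R) : \bar R := ('N[mbox]_1[EFin \o f])%E.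

Definition linf_norm (f : int -> V -> R) : \bar R :=
  ereal_sup (range (fun k => L1norm (f k))).

(* D z v is the value in direction v of the Frechet derivative at z of
   z |-> kk z, as a map into L^1(mbox) *)
Definition is_frechet1 (kk : V -> V -> R) (D : V -> V -> V -> R) :=
  [/\ measurable_fun [set: V * V * V] (fun p => D p.1.1 p.1.2 p.2),
      (forall z v, D z v \in Lfun mbox 1),
      (forall z (a : R) v w,
         D z (a *: v + w) = a \*o D z v \+ D z w %[ae mbox]),
      (forall z, exists C : R, forall v, (L1norm (D z v) <= (C * `|v|)%:E)%E) &
      (forall z,
         ((`|v|^-1)%:E * L1norm (fun y => kk (z + v)%R y - kk z y - D z v y)%R)%E
           @[v --> (0 : V)^'] --> 0%E)].

Definition transfer (kk : V -> V -> R) (g : R -> R) k (phi : V -> R) : V -> R :=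
  fun y => \int[mbox]_(u in box) (phi u * kk (euler g k u) y).

Definition transfer_dot (D : V -> V -> V -> R) (g gdot : R -> R) k
    (phi : V -> R) : V -> R :=
  fun y => \int[mbox]_(u in box)
    (phi u * D (euler g k u) (dt M *: drift_dot gdot (time k) u) y).

Definition prob_density (f : V -> R) :=
  [/\ f \in Lfun mbox 1, {ae mbox, forall u, 0 <= f u} &
      \int[mbox]_(u in box) f u = 1].

Definition equivariant (L : int -> (V -> R) -> V -> R) (mu : int -> V -> R) :=
  forall k, prob_density (mu k) /\ mu (k + 1) = L k (mu k) %[ae mbox].

(* L_{k-1} L_{k-2} ... L_{k-j} phi *)
Fixpoint transfer_prod (L : int -> (V -> R) -> V -> R) k (j : nat)
    (phi : V -> R) : V -> R :=
  if j is j'.+1 then L (k - 1) (transfer_prod L (k - 1) j' phi) else phi.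

End model.

Definition loewner_le (R : realType) n (A B : 'M[R]_n) :=
  forall v : 'cV[R]_n, (v^T *m A *m v) 0 0 <= (v^T *m B *m v) 0 0.

(* Main.v *)
Require Import Defs.
From HB Require Import structures.
From mathcomp Require Import all_boot all_order all_algebra.
From mathcomp Require Import all_classical all_reals all_analysis.
From mathcomp Require Import measurable_realfun ring lra zify.

Set Implicit Arguments.
Unset Strict Implicit.
Unset Printing Implicit Defensive.

Import Order.TTheory GRing.Theory Num.Theory.
Import numFieldNormedType.Exports.

Local Open Scope classical_set_scope.
Local Open Scope ring_scope.

(** One step of the chain moves u to the reflection of z + S xi, where z is the
    image of u under the Euler map, S is the square root of h times Sigma, and
    xi is a standard Gaussian vector.  The theorem is an abstract perturbation
    argument, applied to the kernels kk z y evaluated at that z.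

    Perturbation.  Let Markov kernels K e k be bounded below by one function of
    integral b > 0.  By Doeblin's argument their operators contract by 1 - b the
    functions of integral 0 ([push_contract]).  Going back in time, a bounded
    solution of f (k + 1) = L_k (f k) + h k with integral 0, indexed by all
    integers k, has norm at most the supremum of the norms of h divided by b
    ([forced_bound]).  With h = 0 this is the uniqueness of the equivariant
    family; its existence is the convergence of L_{k-1} ... L_{k-n} psi as n
    grows ([equivariant_family_exists]).  The derivative g of the kernels applied
    to mu 0 has integral 0, because the mass of K e k does not depend on e.
    Hence the series for eta converges geometrically, and its sum satisfies
    eta (k + 1) = L_k (eta k) + g k.  The error (mu e - mu 0) / e - eta solves
    the recursion of the operators at e = 0 with a forcing that tends to 0
    uniformly in k ([response_rate]), so it tends to 0 as well.

    Verification.  The law of the reflection of z + S xi is the image, under the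
    map T = reflect o S that does not depend on z, of the translate by S^-1 z of
    the Gaussian law, and this translate has the explicit Cameron-Martin density
    cm (S^-1 z) ([transition_densityP]).  Passing to image densities is linear,
    preserves order and does not increase the L1 norm ([image_density_nrm]).
    The transition density thus inherits from cm its Taylor estimate in L1, with
    a quadratic remainder uniform in z ([cm_taylor]), and a positive lower bound
    for z in a ball ([gminorant_le_cm]).  The image densities exist because S is
    invertible, so that T pulls null sets back to null sets ([fold_noise_null]).
    Versions of the density and of its derivative that are measurable in all
    variables are obtained as L1 limits with geometric rate, along dyadic points
    and dyadic steps ([joint_limit]).  The drift is bounded on the box and affine
    in the greenhouse parameter, so the kernels are differentiable in e uniformly
    in u and k ([response_kernel_rate]), and every Frechet derivative agrees with
    the constructed one up to null sets ([frechet_unique]). *)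

(** * Integrable real functions and their L1 norm *)

Section L1.
Context d (T : measurableType d) (R : realType).
Variable mu : {measure set T -> \bar R}.
Implicit Types f g h : T -> R.

Definition L1 f := mu.-integrable setT (EFin \o f).

(** It is 0, and not infinite, when the integral of `|f| diverges; hence the
    integrability assumptions in the lemmas below. *)
Definition nrm f : R := \int[mu]_x `|f x|.

Lemma L1_meas f : L1 f -> measurable_fun setT f.
Proof. by move=> /measurable_int /measurable_EFinP. Qed.

Lemma RintE f : L1 f -> (\int[mu]_x f x)%:E = (\int[mu]_x (f x)%:E)%E.
Proof. by move=> lf; rewrite /Rintegral fineK//; exact: integrable_fin_num. Qed.

Lemma L1P f : measurable_fun setT f -> (\int[mu]_x `|f x|%:E < +oo)%E -> L1 f.
Proof.
by move=> mf fi; apply/integrableP; split; [exact/measurable_EFinP|].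
Qed.

Lemma L1D f g : L1 f -> L1 g -> L1 (fun x => f x + g x).
Proof. by move=> lf lg; exact: (integrableD measurableT lf lg). Qed.

Lemma L1B f g : L1 f -> L1 g -> L1 (fun x => f x - g x).
Proof. by move=> lf lg; exact: (integrableB measurableT lf lg). Qed.

Lemma L1Z c f : L1 f -> L1 (fun x => c * f x).
Proof. by move=> lf; exact: (integrableZl measurableT c lf). Qed.

Lemma L10 : L1 (fun=> 0).
Proof. exact: integrable0. Qed.

Lemma L1_abs f : L1 f -> L1 (fun x => `|f x|).
Proof. by move=> lf; exact: (integrable_abse lf). Qed.

Lemma L1_sum (I : Type) (s : seq I) (F : I -> T -> R) :
  (forall i, L1 (F i)) -> L1 (fun x => \sum_(i <- s) F i x).
Proof.
move=> lF; elim: s => [|i s ih].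
  by under eq_fun do rewrite big_nil; exact: L10.
by under eq_fun do rewrite big_cons; exact: L1D.
Qed.

Lemma nrmE f : L1 f -> (nrm f)%:E = (\int[mu]_x `|f x|%:E)%E.
Proof. by move=> /L1_abs /RintE. Qed.

Lemma nrm_ge0 f : 0 <= nrm f.
Proof. by apply: Rintegral_ge0. Qed.

Lemma Rint_eq0 f : (forall x, f x = 0) -> \int[mu]_x f x = 0.
Proof.
by move=> f0; rewrite /Rintegral (eq_integral (cst 0%E)) ?integral0// => x _; rewrite f0.
Qed.

Lemma RintB f g : L1 f -> L1 g ->
  \int[mu]_x (f x - g x) = \int[mu]_x f x - \int[mu]_x g x.
Proof. by move=> lf lg; rewrite RintegralB. Qed.

Lemma RintZ c f : L1 f -> \int[mu]_x (c * f x) = c * \int[mu]_x f x.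
Proof. by move=> lf; rewrite RintegralZl. Qed.

Lemma RintD f g : L1 f -> L1 g ->
  \int[mu]_x (f x + g x) = \int[mu]_x f x + \int[mu]_x g x.
Proof. by move=> lf lg; rewrite RintegralD. Qed.

Lemma le_L1 f g : measurable_fun setT f -> L1 g ->
  (forall x, `|f x| <= g x) -> L1 f.
Proof.
move=> mf lg fg; apply: le_integrable lg => //.
  exact/measurable_EFinP.
by move=> x _ /=; rewrite lee_fin (le_trans (fg x))// ler_norm.
Qed.

Lemma le_Rint_ae f g : L1 f -> L1 g -> (\forall x \ae mu, f x <= g x) ->
  \int[mu]_x f x <= \int[mu]_x g x.
Proof.
move=> lf lg fg; rewrite -subr_ge0 -RintegralB// -lee_fin RintE; last exact: L1B.
rewrite (@ae_eq_integral _ _ _ _ _ (fun x => `|g x - f x|%:E)) //.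
- exact: integral_ge0.
- by apply/measurable_EFinP/L1_meas; exact: L1B.
- by apply/measurable_EFinP/L1_meas/L1_abs; exact: L1B.
- by apply: filterS fg => x fg _; rewrite ger0_norm// subr_ge0.
Qed.

Lemma le_nrm_ae f g : L1 f -> L1 g -> (\forall x \ae mu, `|f x| <= g x) ->
  nrm f <= \int[mu]_x g x.
Proof. by move=> lf lg fg; apply: le_Rint_ae => //; exact: L1_abs. Qed.

Lemma le_nrm f g : L1 f -> L1 g -> (forall x, `|f x| <= g x) ->
  nrm f <= \int[mu]_x g x.
Proof. by move=> lf lg fg; apply: le_nrm_ae => //; exact: aeW. Qed.

Lemma nrmD f g : L1 f -> L1 g -> nrm (fun x => f x + g x) <= nrm f + nrm g.
Proof.
move=> lf lg; rewrite /nrm -RintegralD//; try exact: L1_abs.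
apply: le_nrm; first exact: L1D.
  by apply: L1D; exact: L1_abs.
by move=> x; exact: ler_normD.
Qed.

Lemma nrmB f g : L1 f -> L1 g -> nrm (fun x => f x - g x) <= nrm f + nrm g.
Proof.
move=> lf lg; rewrite /nrm -RintegralD//; try exact: L1_abs.
apply: le_nrm; first exact: L1B.
  by apply: L1D; exact: L1_abs.
by move=> x; exact: ler_normB.
Qed.

Lemma nrm_dist g f h : L1 f -> L1 g -> L1 h ->
  nrm (fun x => f x - h x) <=
  nrm (fun x => f x - g x) + nrm (fun x => g x - h x).
Proof.
move=> lf lg lh.
rewrite [X in X <= _](_ : _ = nrm (fun x => (f x - g x) + (g x - h x))).
  by apply: nrmD; exact: L1B.
by congr nrm; apply/funext => x; rewrite addrA subrK.
Qed.

Lemma nrmC f g : nrm (fun x => f x - g x) = nrm (fun x => g x - f x).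
Proof. by congr Rintegral; apply/funext => x; rewrite distrC. Qed.

Lemma nrmZ c f : L1 f -> nrm (fun x => c * f x) = `|c| * nrm f.
Proof.
move=> lf; rewrite /nrm; under eq_Rintegral do rewrite normrM.
by rewrite RintegralZl//; exact: L1_abs.
Qed.

Lemma Rint_ae f g : L1 f -> L1 g -> (\forall x \ae mu, f x = g x) ->
  \int[mu]_x f x = \int[mu]_x g x.
Proof.
move=> lf lg fg; apply/eqP; rewrite eq_le !le_Rint_ae//.
- by apply: filterS fg => x ->.
- by apply: filterS fg => x ->.
Qed.

Lemma nrm_ae f g : L1 f -> L1 g -> (\forall x \ae mu, f x = g x) -> nrm f = nrm g.
Proof.
move=> lf lg fg; apply: Rint_ae; try exact: L1_abs.
by apply: filterS fg => x ->.
Qed.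

Lemma nrm_eq0 f : L1 f -> nrm f <= 0 -> \forall x \ae mu, f x = 0.
Proof.
move=> lf f0; have := ae_eq_integral_abs mu measurableT (measurable_int _ lf).
case=> + _ => /(_ _).
have -> : (\int[mu]_x `|(EFin \o f) x| = 0)%E.
  rewrite -[LHS](nrmE lf); congr EFin; apply/eqP; rewrite eq_le f0 /=.
  exact: nrm_ge0.
by move=> /(_ erefl); apply: filterS => x /(_ I) [].
Qed.

Lemma nrm_sub_eq0 f g : L1 f -> L1 g -> nrm (fun x => f x - g x) <= 0 ->
  \forall x \ae mu, f x = g x.
Proof.
move=> lf lg /nrm_eq0 => /(_ (L1B lf lg)).
by apply: filterS => x /subr0_eq.
Qed.

Lemma nrm0 : nrm (fun=> 0) = 0.
Proof. by rewrite /nrm normr0 /Rintegral integral0. Qed.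

Lemma Rint_le_nrm f : L1 f -> `|\int[mu]_x f x| <= nrm f.
Proof. by move=> lf; exact: le_normr_Rintegral. Qed.

Lemma ge0_nrm f : (forall x, 0 <= f x) -> nrm f = \int[mu]_x f x.
Proof. by move=> f0; apply: eq_Rintegral => x _; rewrite ger0_norm. Qed.

Lemma ge0_nrm_ae f : L1 f -> (\forall x \ae mu, 0 <= f x) ->
  nrm f = \int[mu]_x f x.
Proof.
move=> lf f0; apply: Rint_ae => //; first exact: L1_abs.
by apply: filterS f0 => x f0; rewrite ger0_norm.
Qed.

Lemma Lfun_L1 f : f \in Lfun mu 1 <-> L1 f.
Proof. exact: Lfun1_integrable. Qed.

Lemma Lnorm_nrm f : L1 f -> ('N[mu]_1[EFin \o f] = (nrm f)%:E)%E.
Proof. by move=> lf; rewrite Lnorm1 nrmE. Qed.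

End L1.

(** * Completeness of L1 *)

Section sumfun.
Context d (T : measurableType d) (R : realType).
Implicit Types f : nat -> T -> R.

(** The sum of a series as the difference of the sums of its positive and
    negative parts.  It is computed pointwise from the terms, and so depends
    measurably on any parameter on which the terms depend measurably; a limit
    chosen in L1 for each value of the parameter would not. *)
Definition sumfun f (x : T) : R :=
  fine (\sum_(n <oo) (Num.max (f n x) 0)%:E)%E -
  fine (\sum_(n <oo) (Num.max (- f n x) 0)%:E)%E.

Lemma measurable_sumfun f : (forall n, measurable_fun setT (f n)) ->
  measurable_fun setT (sumfun f).
Proof.
move=> mf; apply: measurable_funB; apply: measurableT_comp => //.
- apply: ge0_emeasurable_sum => [n x _ _|n _]; first by rewrite lee_fin le_max lexx orbT.
  by apply/measurable_EFinP; apply: measurable_maxr.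
- apply: ge0_emeasurable_sum => [n x _ _|n _]; first by rewrite lee_fin le_max lexx orbT.
  by apply/measurable_EFinP; apply: measurable_maxr => //; apply: measurable_funN.
Qed.

Lemma le_sumfun_tail f x n : (\sum_(k <oo) `|f k x|%:E < +oo)%E ->
  (`|sumfun f x - \sum_(k < n) f k x|%:E <= \sum_(k <oo) `|f (k + n)%N x|%:E)%E.
Proof.
move=> foo.
pose p k := (Num.max (f k x) 0)%:E; pose q k := (Num.max (- f k x) 0)%:E.
have p0 k : (0 <= p k)%E by rewrite lee_fin le_max lexx orbT.
have q0 k : (0 <= q k)%E by rewrite lee_fin le_max lexx orbT.
have pq k : (`|f k x|%:E = p k + q k)%E.
  rewrite /p /q -EFinD; congr EFin.
  have /orP[h|h] := le_total 0 (f k x).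
    by rewrite ger0_norm// max_l// max_r ?oppr_le0// addr0.
  by rewrite ler0_norm// max_r// max_l ?oppr_ge0// add0r.
have pqB k : f k x = fine (p k) - fine (q k).
  rewrite /p /q/=; have /orP[h|h] := le_total 0 (f k x).
    by rewrite max_l// max_r ?oppr_le0// subr0.
  by rewrite max_r// max_l ?oppr_ge0// sub0r opprK.
have tl (u : nat -> \bar R) m : (forall k, (0 <= u k)%E) ->
    (\sum_(k <oo) u k < +oo)%E ->
    (0 <= \sum_(m <= k <oo) u k)%E /\ (\sum_(m <= k <oo) u k \is a fin_num)%E.
  move=> u0 uoo; have t0 : (0 <= \sum_(m <= k <oo) u k)%E by apply: nneseries_ge0.
  split => //; rewrite ge0_fin_numE//; apply: le_lt_trans uoo.
  rewrite (nneseries_split 0 m) ?add0n//; apply: leeDr.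
  by apply: sume_ge0.
have foo' : (\sum_(k <oo) (p k + q k) < +oo)%E.
  by under eq_eseriesr do rewrite -pq.
have poo : (\sum_(k <oo) p k < +oo)%E.
  by apply: le_lt_trans foo'; apply: lee_nneseries => // k _; rewrite leeDl.
have qoo : (\sum_(k <oo) q k < +oo)%E.
  by apply: le_lt_trans foo'; apply: lee_nneseries => // k _; rewrite leeDr.
have [p0n pfn] := tl p n p0 poo; have [q0n qfn] := tl q n q0 qoo.
have -> : (\sum_(k <oo) `|f (k + n)%N x|%:E =
    \sum_(n <= k <oo) p k + \sum_(n <= k <oo) q k)%E.
  rewrite (nneseries_addn _ (f := fun k => `|f k x|%:E))//.
  rewrite -nneseriesD//; apply: eq_eseriesr => k _; exact: pq.
have -> : sumfun f x - \sum_(k < n) f k x =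
    fine (\sum_(n <= k <oo) p k)%E - fine (\sum_(n <= k <oo) q k)%E.
  rewrite /sumfun (nneseries_split 0 n (fun k _ => p0 k)).
  rewrite (nneseries_split 0 n (fun k _ => q0 k)) !add0n.
  rewrite !big_mkord; under [X in _ - X = _]eq_bigr do rewrite pqB.
  rewrite sumrB.
  have sf (u : nat -> \bar R) : (forall k, u k \is a fin_num) ->
     (\sum_(k < n) u k = (\sum_(k < n) fine (u k))%:E)%E.
    by move=> uf; rewrite -sumEFin; apply: eq_bigr => k _; rewrite fineK.
  by rewrite !sf// !fineD//=; lra.
rewrite -[X in (_ <= X + _)%E]fineK// -[X in (_ <= _ + X)%E]fineK//.
rewrite -EFinD lee_fin (le_trans (ler_normB _ _))//.
by rewrite !ger0_norm ?fine_ge0.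
Qed.

End sumfun.

Section L1_complete.
Context d (T : measurableType d) (R : realType).
Variable mu : {measure set T -> \bar R}.

(** By Tonelli the series of the absolute values has a finite integral, so it
    converges almost everywhere, and there its tails bound the remainders.  The
    tail bounds c carry the rate of convergence over to the sum. *)
Lemma L1_complete (f : nat -> T -> R) (c : nat -> R) :
  (forall n, L1 mu (f n)) ->
  (forall n m, \sum_(n <= k < m) nrm mu (f k) <= c n) ->
  L1 mu (sumfun f) /\
  forall n, nrm mu (fun x => sumfun f x - \sum_(k < n) f k x) <= c n.
Proof.
move=> lf fc.
have mf n : measurable_fun setT (f n) by apply: L1_meas (lf n).
have mS := measurable_sumfun mf.
have key n : (\int[mu]_x \sum_(k <oo) `|f (k + n)%N x|%:E <= (c n)%:E)%E.
  rewrite integral_nneseries//; last first.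
    by move=> k; apply/measurable_EFinP; exact: measurableT_comp.
  under eq_eseriesr do rewrite -(nrmE (lf _)).
  apply: lime_le; first by apply: is_cvg_nneseries => k _ _; rewrite lee_fin nrm_ge0.
  apply: nearW => m; rewrite sumEFin lee_fin (le_trans _ (fc n (m + n)%N))//.
  by rewrite -{2}[n]add0n big_addn addnK.
have mT n : measurable_fun setT (fun x => \sum_(k <oo) `|f (k + n)%N x|%:E)%E.
  apply: ge0_emeasurable_sum => // k _.
  by apply/measurable_EFinP; exact: measurableT_comp.
have ae : \forall x \ae mu, (\sum_(k <oo) `|f k x|%:E < +oo)%E.
  have : mu.-integrable setT (fun x => \sum_(k <oo) `|f (k + 0)%N x|%:E)%E.
    apply/integrableP; split; first exact: mT.
    under eq_integral do rewrite gee0_abs ?nneseries_ge0//.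
    by rewrite (le_lt_trans (key 0%N))// ltry.
  move=> /(integrable_ae measurableT); apply: filterS => x /(_ I).
  rewrite ge0_fin_numE ?nneseries_ge0//.
  by under eq_eseriesr do rewrite addn0.
have bd n : (\int[mu]_x `|sumfun f x - \sum_(k < n) f k x|%:E <= (c n)%:E)%E.
  apply: le_trans (key n); apply: ae_ge0_le_integral => //.
  - apply/measurable_EFinP; apply: measurableT_comp => //.
    by apply: measurable_funB => //; apply: measurable_sum => k; exact: mf.
  - by move=> x _; apply: nneseries_ge0.
  - by apply: filterS ae => x ae _; exact: le_sumfun_tail.
have lS : L1 mu (sumfun f).
  apply: L1P => //; apply: le_lt_trans (ltry (c 0%N)).
  apply: le_trans (bd 0%N); apply: ge0_le_integral => //.
  - by apply/measurable_EFinP; exact: measurableT_comp.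
  - apply/measurable_EFinP; apply: measurableT_comp => //.
    by apply: measurable_funB => //; apply: measurable_sum => k; exact: mf.
  - by move=> x _; rewrite big_ord0 subr0.
split => // n; rewrite -lee_fin nrmE; first exact: bd.
apply: L1B => //.
by have := @L1_sum _ _ _ mu _ (index_enum 'I_n) (fun k => f k) (fun k => lf k).
Qed.

End L1_complete.

(** * Integrating out one of two variables *)

Section marginal.
Context d1 d2 (T1 : measurableType d1) (T2 : measurableType d2) (R : realType).
Variable m1 : {sigma_finite_measure set T1 -> \bar R}.
Variable m2 : {sigma_finite_measure set T2 -> \bar R}.
Implicit Types (F G K : T1 -> T2 -> R) (phi : T1 -> R).

Definition jmeas F := measurable_fun [set: T1 * T2] (fun p => F p.1 p.2).

Definition L1prod F := (m1 \x m2)%E.-integrable setT (fun p => (F p.1 p.2)%:E).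

Definition marginal F (y : T2) : R := \int[m1]_u F u y.

Lemma jmeas2 F y : jmeas F -> measurable_fun setT (F ^~ y).
Proof.
by move=> mF; exact: (measurableT_comp mF (pair2_measurable y)).
Qed.

Lemma L1prodP F : jmeas F -> (\int[m1]_u \int[m2]_y `|F u y|%:E < +oo)%E -> L1prod F.
Proof.
by move=> mF Foo; apply/integrable12ltyP => //; exact/measurable_EFinP.
Qed.

Lemma L1prod_ae F : L1prod F -> \forall y \ae m2, L1 m1 (F ^~ y).
Proof. by move=> lF; have := ae_integrable2 lF. Qed.

Lemma marginal_L1 F : L1prod F ->
  L1 m2 (marginal F) /\
  ((nrm m2 (marginal F))%:E <= \int[m1]_u \int[m2]_y `|F u y|%:E)%E.
Proof.
move=> lF; have mF : measurable_fun setT (fun p => (F p.1 p.2)%:E).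
  exact: measurable_int lF.
have mGG := measurable_fubini_G lF.
have mG : measurable_fun setT (marginal F).
  by apply: measurableT_comp => //; exact: mGG.
have le1 y : (`|marginal F y|%:E <= `|fubini_G m1 (fun p => (F p.1 p.2)%:E) y|)%E.
  rewrite /marginal /Rintegral /fubini_G/=.
  have fa (x : \bar R) : (`|fine x|%:E <= `|x|)%E.
    by case: x => [r| |] //=; rewrite normr0 leey.
  exact: fa.
have bd : (\int[m2]_y `|marginal F y|%:E <= \int[m1]_u \int[m2]_y `|F u y|%:E)%E.
  rewrite (fubini_tonelli (fun p => `|F p.1 p.2|%:E))//; last first.
    by apply/measurable_EFinP; apply: measurableT_comp => //; exact/measurable_EFinP.
  apply: (@le_trans _ _ (\int[m2]_y `|fubini_G m1 (fun p => (F p.1 p.2)%:E) y|)%E).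
    apply: ge0_le_integral => //.
    - by apply/measurable_EFinP; exact: measurableT_comp.
    - by apply: measurableT_comp => //; exact: mGG.
  apply: ge0_le_integral => //.
  - by apply: measurableT_comp => //; exact: mGG.
  - have := @measurable_fun_fubini_tonelli_G _ _ _ _ _ m1 (fun p => `|F p.1 p.2|%:E).
    apply=> //; apply/measurable_EFinP; apply: measurableT_comp => //.
    exact/measurable_EFinP.
  - move=> y _; apply: le_abse_integral => //.
    by apply/measurable_EFinP/jmeas2; exact/measurable_EFinP.
have lg : L1 m2 (marginal F).
  apply: L1P => //; apply: (le_lt_trans bd).
  by apply/(integrable12ltyP m1 m2 (f := fun p => (F p.1 p.2)%:E)).
by split=> //; rewrite nrmE.
Qed.

(** The equality may fail on the null set of the y for which F (.) y or G (.) y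
    is not integrable. *)
Lemma marginal_comb (c : R) F G : L1prod F -> L1prod G ->
  \forall y \ae m2, marginal (fun u y => F u y + c * G u y) y = marginal F y + c * marginal G y.
Proof.
move=> /L1prod_ae lF /L1prod_ae lG; apply: filterS2 lF lG => y lF lG.
rewrite /marginal RintegralD//; last exact: (L1Z c lG).
by rewrite RintegralZl.
Qed.

Lemma Rint_marginal F : L1prod F ->
  \int[m2]_y marginal F y = \int[m1]_u \int[m2]_y F u y.
Proof.
move=> lF; have [lg _] := marginal_L1 lF.
have mGG := measurable_fubini_G lF.
have lH := integrable_fubini_F lF.
have gE : \forall y \ae m2, (marginal F y)%:E = fubini_G m1 (fun p => (F p.1 p.2)%:E) y.
  by apply: filterS (L1prod_ae lF) => y lFy; rewrite /marginal RintE.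
have hE : \forall u \ae m1, (\int[m2]_y F u y)%:E = fubini_F m2 (fun p => (F p.1 p.2)%:E) u.
  by apply: filterS (ae_integrable1 lF) => y lFy; rewrite RintE.
rewrite /Rintegral; congr fine.
transitivity (\int[m2]_y (fubini_G m1 (fun p => (F p.1 p.2)%:E) y))%E.
  apply: ae_eq_integral => //; first exact: measurable_int lg.
  by apply: filterS gE => y ->.
transitivity (\int[m1]_u (fubini_F m2 (fun p => (F p.1 p.2)%:E) u))%E.
  by rewrite integral21_prod_meas1// integral12_prod_meas1.
apply: ae_eq_integral => //; first exact: measurable_int lH.
  apply/measurable_EFinP; apply: measurableT_comp => //.
  exact: measurable_int lH.
by apply: filterS hE => y ->.
Qed.

Lemma kernel_L1prod K phi C : L1 m1 phi -> jmeas K -> (forall u, L1 m2 (K u)) ->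
  (forall u, nrm m2 (K u) <= C) ->
  L1prod (fun u y => phi u * K u y) /\
  (\int[m1]_u \int[m2]_y `|phi u * K u y|%:E <= (C * nrm m1 phi)%:E)%E.
Proof.
move=> lp mK lK KC.
have mpK : jmeas (fun u y => phi u * K u y).
  apply: measurable_funM => //; apply: measurableT_comp => //; exact: L1_meas lp.
have bd : (\int[m1]_u \int[m2]_y `|phi u * K u y|%:E <= (C * nrm m1 phi)%:E)%E.
  have C0 : 0 <= C by apply: le_trans (KC point); exact: nrm_ge0.
  rewrite EFinM nrmE// -ge0_integralZl ?lee_fin//; last first.
    by apply/measurable_EFinP; exact: L1_meas (L1_abs lp).
  apply: ge0_le_integral => //.
  - by move=> u _; apply: integral_ge0.
  - have := @measurable_fun_fubini_tonelli_F _ _ _ _ _ m2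
      (fun p => `|phi p.1 * K p.1 p.2|%:E).
    by apply=> //; apply/measurable_EFinP; exact: measurableT_comp.
  - by apply: measurable_funeM; apply/measurable_EFinP; exact: L1_meas (L1_abs lp).
  - move=> u _; rewrite -nrmE; last exact: L1Z.
    by rewrite nrmZ// -EFinM lee_fin mulrC ler_wpM2r.
split=> //; apply: L1prodP => //; exact: le_lt_trans bd (ltry _).
Qed.

Lemma kernel_marginal_nrm K phi C : L1 m1 phi -> jmeas K -> (forall u, L1 m2 (K u)) ->
  (forall u, nrm m2 (K u) <= C) ->
  L1 m2 (marginal (fun u y => phi u * K u y)) /\
  nrm m2 (marginal (fun u y => phi u * K u y)) <= C * nrm m1 phi.
Proof.
move=> lp mK lK KC; have [l2 bd] := kernel_L1prod lp mK lK KC.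
have [lg bg] := marginal_L1 l2; split => //.
by rewrite -lee_fin (le_trans bg).
Qed.

End marginal.

(** * Geometric bounds *)

Section geometric.
Context (R : realType).
Implicit Types (a b q x B : R).

Lemma geometric_cvg0 A q : 0 <= q < 1 -> A * q ^+ n @[n --> \oo] --> (0 : R).
Proof.
by move=> /andP[q0 q1]; apply: (@cvg_geometric R A q); rewrite ger0_norm.
Qed.

Lemma geo_small q A x : 0 <= q < 1 -> (forall n : nat, x <= A * q ^+ n) -> x <= 0.
Proof.
move=> q01 xA.
have cv := geometric_cvg0 A q01.
have <- : limn (fun n => A * q ^+ n) = 0 by apply/cvg_lim.
apply: limr_ge; first by apply/cvg_ex; exists 0.
exact: nearW.
Qed.

Lemma geo_tail q C n m : 0 <= q < 1 -> 0 <= C ->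
  \sum_(n <= k < m) C * q ^+ k <= C / (1 - q) * q ^+ n.
Proof.
move=> /andP[q0 q1] C0.
have q2 : 0 < 1 - q by rewrite subr_gt0.
have [mn|nm] := leqP m n.
  by rewrite big_geq// mulr_ge0 ?exprn_ge0// divr_ge0// ltW.
rewrite -(subnKC (ltnW nm)); set p := (m - n)%N.
suff -> : \sum_(n <= k < n + p) C * q ^+ k = C / (1 - q) * (q ^+ n - q ^+ (n + p)).
  by rewrite ler_wpM2l ?divr_ge0 ?(ltW q2)// lerBlDr lerDl exprn_ge0.
elim: p => [|p ih]; first by rewrite addn0 subrr mulr0 big_geq.
rewrite addnS big_nat_recr ?leq_addr//= ih exprS.
by field; rewrite gt_eqF.
Qed.

(** Going back n steps, the influence of the bound B on x k has decayed by the
    factor (1 - b) ^ n, and n is arbitrary because the sequence has no first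
    term. *)
Lemma contract_bound b B rr (x : int -> R) : 0 < b <= 1 ->
  (forall k, x k <= B) -> (forall k, x (k + 1) <= (1 - b) * x k + rr) ->
  forall k, x k <= rr / b.
Proof.
move=> /andP[b0 b1] xB xr k; rewrite -subr_le0.
apply: (@geo_small (1 - b) (B - rr / b)); first by rewrite subr_ge0 b1 ltrBlDr ltrDl.
move=> n; elim: n k => [|n ih] k; first by rewrite expr0 mulr1 lerB.
rewrite -(subrK 1 k); apply: le_trans (lerB (xr _) (lexx _)) _.
(* the factor 1 - b, replaced by 1 when b = 1 to keep it positive *)
have := ih (k - 1); rewrite -(ler_pM2l (x := 1 - b + (b == 1)%:R)).
  have [->|bn] := eqVneq b 1; last first.
    rewrite addr0 exprS mulrCA; apply: le_trans.
    by rewrite le_eqVlt; apply/orP; left; apply/eqP; field; rewrite gt_eqF.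
  by rewrite !subrr exprS !mul0r mulr0 divr1; lra.
have [->|bn] := eqVneq b 1; first by rewrite subrr add0r.
by rewrite addr0 subr_gt0 lt_neqAle bn.
Qed.

Lemma half01 : 0 <= (2^-1 : R) < 1.
Proof. by apply/andP; split; lra. Qed.

End geometric.

Lemma norm_dnbhs0 (R : realType) (W : normedModType R) :
  `|w| @[w --> (0 : W)^'] --> (0 : R).
Proof.
have := @norm_continuous _ W (0 : W); rewrite /continuous_at normr0 => h.
by apply: cvg_trans h; apply: cvg_app; exact: cvg_within.
Qed.

(** * Densities transported by an integral kernel *)

Section kernels.
Context d (T : measurableType d) (R : realType).
Variable m : {sigma_finite_measure set T -> \bar R}.
Implicit Types (K : T -> T -> R) (phi psi : T -> R).

Definition bounded_kernel K (C : R) :=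
  [/\ jmeas K, (forall u, L1 m (K u)) & forall u, nrm m (K u) <= C].

Definition push K phi := marginal m (fun u y => phi u * K u y).

Lemma push_L1prod K C phi : bounded_kernel K C -> L1 m phi -> L1prod m m (fun u y => phi u * K u y).
Proof. by move=> [mK lK KC] lp; have [] := kernel_L1prod lp mK lK KC. Qed.

Lemma push_L1 K C phi : bounded_kernel K C -> L1 m phi -> L1 m (push K phi).
Proof. by move=> [mK lK KC] lp; have [] := kernel_marginal_nrm lp mK lK KC. Qed.

Lemma push_nrm K C phi : bounded_kernel K C -> L1 m phi -> nrm m (push K phi) <= C * nrm m phi.
Proof. by move=> [mK lK KC] lp; have [] := kernel_marginal_nrm lp mK lK KC. Qed.

Lemma bounded_kernel_ge0 K C : bounded_kernel K C -> 0 <= C.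
Proof. by move=> [_ _ /(_ point)]; apply: le_trans; exact: nrm_ge0. Qed.

Lemma bounded_comb K K' C C' c : bounded_kernel K C -> bounded_kernel K' C' ->
  bounded_kernel (fun u y => K u y + c * K' u y) (C + `|c| * C').
Proof.
move=> [mK lK KC] [mK' lK' KC']; split=> [|u|u].
- by apply: measurable_funD => //; apply: measurable_funM.
- by apply: L1D => //; exact: L1Z.
- apply: le_trans (nrmD (lK u) (L1Z c (lK' u))) _.
  by rewrite nrmZ// lerD// ler_wpM2l.
Qed.

Lemma push_comb K C c phi psi : bounded_kernel K C -> L1 m phi -> L1 m psi ->
  \forall y \ae m, push K (fun u => phi u + c * psi u) y = push K phi y + c * push K psi y.
Proof.
move=> bK lp lq; have := marginal_comb c (push_L1prod bK lp) (push_L1prod bK lq).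
apply: filterS => y <-; rewrite /push /marginal; apply: eq_Rintegral => u _; ring.
Qed.

Lemma push_comb_kernel K K' C C' c phi : bounded_kernel K C -> bounded_kernel K' C' -> L1 m phi ->
  \forall y \ae m, push (fun u y => K u y + c * K' u y) phi y = push K phi y + c * push K' phi y.
Proof.
move=> bK bK' lp; have := marginal_comb c (push_L1prod bK lp) (push_L1prod bK' lp).
apply: filterS => y <-; rewrite /push /marginal; apply: eq_Rintegral => u _; ring.
Qed.

Lemma push_ae K phi psi : jmeas K -> measurable_fun setT phi -> measurable_fun setT psi ->
  (\forall u \ae m, phi u = psi u) -> push K phi = push K psi.
Proof.
move=> mK mp mq pq; apply/funext => y; rewrite /push /marginal /Rintegral; congr fine.
apply: ae_eq_integral => //.
- by apply/measurable_EFinP; apply: measurable_funM => //; exact: jmeas2.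
- by apply/measurable_EFinP; apply: measurable_funM => //; exact: jmeas2.
- by apply: filterS pq => u ->.
Qed.

Definition markov_kernel K := [/\ jmeas K, forall u y, 0 <= K u y,
  (forall u, L1 m (K u)) & forall u, \int[m]_y K u y = 1].

Lemma markov_bounded K : markov_kernel K -> bounded_kernel K 1.
Proof. by move=> [mK K0 lK K1]; split=> // u; rewrite ge0_nrm// K1. Qed.

Lemma push_int K phi : markov_kernel K -> L1 m phi -> \int[m]_y push K phi y = \int[m]_u phi u.
Proof.
move=> MK lp; have bK := markov_bounded MK; case: MK => mK K0 lK K1.
rewrite Rint_marginal; last exact: push_L1prod bK lp.
apply: eq_Rintegral => u _; rewrite RintZ ?K1 ?mulr1//; exact: lK.
Qed.

Lemma push_ge0 K phi : markov_kernel K -> L1 m phi -> (\forall u \ae m, 0 <= phi u) ->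
  forall y, 0 <= push K phi y.
Proof.
move=> [mK K0 lK K1] lp p0 y; have mp := L1_meas lp.
rewrite (@push_ae K phi (fun u => `|phi u|))//.
- by apply: Rintegral_ge0 => u _; rewrite mulr_ge0.
- exact: measurableT_comp.
- by apply: filterS p0 => u p0; rewrite ger0_norm.
Qed.

(** Doeblin's argument: on functions of integral 0 the kernel r y, which does
    not depend on u, acts as 0.  So K can be replaced by K - r, which is
    nonnegative and has mass 1 - b. *)
Lemma push_contract K r b phi : markov_kernel K -> L1 m r -> \int[m]_y r y = b ->
  (forall u, \forall y \ae m, r y <= K u y) ->
  L1 m phi -> \int[m]_u phi u = 0 -> nrm m (push K phi) <= (1 - b) * nrm m phi.
Proof.
move=> MK lr rb rK lp p0; have bK := markov_bounded MK; have [mK K0 lK K1] := MK.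
have br : bounded_kernel (fun _ => r) (nrm m r).
  by split => //; apply: (measurableT_comp (L1_meas lr)).
have bKr : bounded_kernel (fun u y => K u y + (-1) * r y) (1 - b).
  have [mKr lKr _] := bounded_comb (-1) bK br; split => // u.
  rewrite ge0_nrm_ae//; last by apply: filterS (rK u) => y; rewrite mulN1r subr_ge0.
  under eq_Rintegral do rewrite mulN1r.
  by rewrite RintB ?K1 ?rb//; exact: lK.
rewrite (@nrm_ae _ _ _ m _ (push (fun u y => K u y + (-1) * r y) phi)).
- exact: push_nrm bKr lp.
- exact: push_L1 bK lp.
- exact: push_L1 bKr lp.
- apply: filterS (push_comb_kernel (-1) bK br lp) => y ->.
  by rewrite {3}/push /marginal RintegralZr// p0 mul0r mulr0 addr0.
Qed.

End kernels.

(** * Linear response for sequences of Markov kernels *)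

Section response.
Context d (T : measurableType d) (R : realType).
Variable m : {sigma_finite_measure set T -> \bar R}.

Definition density (f : T -> R) :=
  [/\ L1 m f, \forall u \ae m, 0 <= f u & \int[m]_u f u = 1].

Definition equivariant_family (L : int -> (T -> R) -> T -> R) (mu : int -> T -> R) :=
  forall k, density (mu k) /\ \forall y \ae m, mu (k + 1) y = L k (mu k) y.

Fixpoint oprod (L : int -> (T -> R) -> T -> R) k (j : nat) (phi : T -> R) : T -> R :=
  if j is j'.+1 then L (k - 1) (oprod L (k - 1) j' phi) else phi.

Lemma density_nrm f : density f -> nrm m f = 1.
Proof. by move=> [lf f0 f1]; rewrite ge0_nrm_ae. Qed.

Section one_family.
Variables (K : int -> T -> T -> R) (r : T -> R) (b : R).
Hypothesis MK : forall k, markov_kernel m (K k).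
Hypothesis lr : L1 m r.
Hypothesis b0 : 0 < b.
Hypothesis rb : \int[m]_y r y = b.
Hypothesis rK : forall k u, \forall y \ae m, r y <= K k u y.

Let L k := push m (K k).

Lemma mass_le1 : b <= 1.
Proof.
have [_ _ lK K1] := MK 0; rewrite -rb -(K1 point).
by apply: le_Rint_ae => //; exact: rK.
Qed.
Let b01 : 0 < b <= 1. Proof. by rewrite b0 mass_le1. Qed.
Let q01 : 0 <= 1 - b < 1.
Proof. by rewrite subr_ge0 mass_le1 ltrBlDr ltrDl. Qed.

Let bK k := markov_bounded (MK k).

Lemma fam_L1 k phi : L1 m phi -> L1 m (L k phi).
Proof. exact: push_L1 (bK k). Qed.

Lemma fam_le k phi : L1 m phi -> nrm m (L k phi) <= nrm m phi.
Proof. by move=> lp; rewrite -[leRHS]mul1r; exact: push_nrm (bK k) lp. Qed.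

Lemma fam_sub k phi psi : L1 m phi -> L1 m psi ->
  \forall y \ae m, L k (fun u => phi u - psi u) y = L k phi y - L k psi y.
Proof.
move=> lp lq; apply: filterS (push_comb (-1) (bK k) lp lq) => y.
by rewrite mulN1r => <-; congr (push _ _ _ _); apply/funext => u; rewrite mulN1r.
Qed.

Lemma fam_contract k phi : L1 m phi -> \int[m]_u phi u = 0 ->
  nrm m (L k phi) <= (1 - b) * nrm m phi.
Proof. exact: push_contract (MK k) lr rb (rK k). Qed.

Lemma fam_int k phi : L1 m phi -> \int[m]_y L k phi y = \int[m]_u phi u.
Proof. exact: push_int (MK k). Qed.

Lemma fam_density k phi : density phi -> density (L k phi).
Proof.
move=> [lp p0 p1]; split; first exact: fam_L1.
- by apply: aeW => y; exact: push_ge0 (MK k) lp p0 y.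
- by rewrite fam_int.
Qed.

(** This one estimate gives the uniqueness of the equivariant family, its
    Lipschitz dependence on the perturbation, and the rate of the linear
    response: a bounded solution is controlled by its forcing alone. *)
Lemma forced_bound (f h : int -> T -> R) B rr :
  (forall k, L1 m (f k)) -> (forall k, L1 m (h k)) ->
  (forall k, \int[m]_u f k u = 0) ->
  (forall k, \forall y \ae m, f (k + 1) y = L k (f k) y + h k y) ->
  (forall k, nrm m (f k) <= B) -> (forall k, nrm m (h k) <= rr) ->
  forall k, nrm m (f k) <= rr / b.
Proof.
move=> lf lh f0 fh fB hr.
apply: (@contract_bound _ b B rr (fun k => nrm m (f k))) => // k.
rewrite (nrm_ae (lf _) (L1D (fam_L1 k (lf k)) (lh k)) (fh k)).
apply: le_trans (nrmD (fam_L1 k (lf k)) (lh k)) _.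
by rewrite lerD// fam_contract.
Qed.

Lemma oprod_L1 phi n k : L1 m phi -> L1 m (oprod L k n phi).
Proof. by move=> lp; elim: n k => //= n ih k; exact: fam_L1. Qed.

Lemma oprod_int0 phi n k : L1 m phi -> \int[m]_u phi u = 0 ->
  \int[m]_u oprod L k n phi u = 0.
Proof.
move=> lp p0; elim: n k => //= n ih k; rewrite fam_int//; exact: oprod_L1.
Qed.

Lemma oprod_contract phi n k : L1 m phi -> \int[m]_u phi u = 0 ->
  nrm m (oprod L k n phi) <= (1 - b) ^+ n * nrm m phi.
Proof.
move=> lp p0; elim: n k => [|n ih] k /=; first by rewrite mul1r.
apply: le_trans (fam_contract _ (oprod_L1 _ _ lp) (oprod_int0 _ _ lp p0)) _.
by rewrite exprS -mulrA ler_wpM2l//; case/andP: q01.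
Qed.

Lemma oprod_density phi n k : density phi -> density (oprod L k n phi).
Proof. by move=> dp; elim: n k => //= n ih k; exact: fam_density. Qed.

(** The difference of two solutions is a bounded solution with zero forcing. *)
Lemma equivariant_family_unique mu mu' : equivariant_family L mu -> equivariant_family L mu' ->
  forall k, \forall y \ae m, mu' k y = mu k y.
Proof.
move=> em em' k.
have lm j : L1 m (mu j) by have [[]] := em j.
have lm' j : L1 m (mu' j) by have [[]] := em' j.
have dm j : density (mu j) by have [] := em j.
have dm' j : density (mu' j) by have [] := em' j.
apply: nrm_sub_eq0 => //.
have := @forced_bound (fun k y => mu' k y - mu k y) (fun _ _ => 0) 2 0.
move=> /(_ _ _ _ _ _ _ k); rewrite mul0r; apply.
- by move=> j; exact: L1B.
- by move=> j; exact: L10.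
- move=> j; rewrite RintB//; have [_ _ ->] := dm j; have [_ _ ->] := dm' j.
  by rewrite subrr.
- move=> j; have [_ e] := em j; have [_ e'] := em' j.
  apply: filterS3 e e' (fam_sub j (lm' j) (lm j)) => y -> -> ->.
  by rewrite addr0.
- by move=> j; rewrite (le_trans (nrmB _ _))// !density_nrm.
- by move=> j; rewrite nrm0.
Qed.

(** The densities L_{k-1} ... L_{k-n} psi converge as n grows: two consecutive
    ones differ by the image under n operators of a function of integral 0. *)
Lemma equivariant_family_exists : exists mu, equivariant_family L mu.
Proof.
have [_ K0 lK K1] := MK 0.
pose psi := K 0 point.
have dpsi : density psi.
  by split; [exact: lK|apply: aeW; exact: K0|exact: K1].
pose P k n := oprod L k n psi.
have dP k n : density (P k n) by exact: oprod_density.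
have lP k n : L1 m (P k n) by have [] := dP k n.
pose F k n u := P k n.+1 u - P k n u.
have lF k n : L1 m (F k n) by exact: L1B.
have F0 k n : \int[m]_u F k n u = 0.
  rewrite /F RintB//; have [_ _ ->] := dP k n.
  by have [_ _ ->] := dP k n.+1; rewrite subrr.
have Fb n k : nrm m (F k n) <= 2 * (1 - b) ^+ n.
  elim: n k => [|n ih] k.
    rewrite mulr1 (le_trans (nrmB (lP _ _) (lP _ _)))// !density_nrm//.
  rewrite (@nrm_ae _ _ _ m _ (L (k - 1) (F (k - 1) n))) //.
  - apply: le_trans (fam_contract (k - 1) (lF (k - 1) n) (F0 (k - 1) n)) _.
    by rewrite exprS mulrCA ler_wpM2l//; case/andP: q01.
  - by apply: fam_L1.
  - by apply: filterS (fam_sub (k - 1) (lP (k - 1) n.+1) (lP (k - 1) n)) => y ->.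
pose c n := 2 / (1 - (1 - b)) * (1 - b) ^+ n.
have hc k n p : \sum_(n <= j < p) nrm m (F k j) <= c n.
  by apply: le_trans (geo_tail n p q01 (ler0n R 2)); apply: ler_sum.
have lS k := (L1_complete (lF k) (hc k)).1.
have cS k := (L1_complete (lF k) (hc k)).2.
pose mu k u := psi u + sumfun (F k) u.
have lmu k : L1 m (mu k) by apply: L1D => //; have [] := dpsi.
have mP k n : nrm m (fun u => mu k u - P k n u) <= c n.
  apply: le_trans (cS k n); rewrite le_eqVlt; apply/orP; left; apply/eqP.
  congr nrm; apply/funext => u.
  rewrite -(big_mkord xpredT (fun j => F k j u)) telescope_sumr// /mu.
  by rewrite /P /=; ring.
have sq (x A : R) : (forall n, x <= A * c n) -> x <= 0.
  move=> xA; apply: (@geo_small _ (1 - b) (A * (2 / (1 - (1 - b)))) x q01) => n.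
  by rewrite -mulrA; exact: xA.
exists mu => k; split; last first.
  apply: nrm_sub_eq0 => //; first exact: fam_L1.
  apply: (sq _ 2) => n.
  apply: le_trans (nrm_dist (lmu _) (lP (k + 1) n.+1) (fam_L1 k (lmu k))) _.
  have -> : 2 * c n = c n + c n by ring.
  rewrite lerD//.
    apply: le_trans (mP _ _) _; rewrite /c exprS ler_wpM2l//.
      by rewrite divr_ge0// opprB addrC subrK ltW.
    by rewrite ler_piMl ?exprn_ge0//; case/andP: q01 => // _ /ltW.
  rewrite /P /= addrK -/(P k n).
  rewrite -(nrm_ae (fam_L1 k (L1B (lP k n) (lmu k)))) //.
  - apply: le_trans (fam_le k (L1B (lP k n) (lmu k))) _.
    by rewrite nrmC.
  - by apply: L1B; exact: fam_L1.
  - exact: fam_sub.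
have mu1 : \int[m]_u mu k u = 1.
  apply/eqP; rewrite -subr_eq0 -normr_le0; apply: (sq _ 1) => n; rewrite mul1r.
  apply: le_trans (mP k n); have [_ _ <-] := dP k n.
  rewrite -RintB//; apply: Rint_le_nrm; exact: L1B.
(* nonnegativity of the limit: its norm is at most 1, which is its integral *)
have nm : nrm m (mu k) <= 1.
  rewrite -subr_le0; apply: (sq _ 1) => n; rewrite mul1r.
  rewrite -(density_nrm (dP k n)) lerBlDr; apply: le_trans (lerD (mP k n) (lexx _)).
  rewrite [X in X <= _](_ : _ = nrm m (fun u => (mu k u - P k n u) + P k n u)).
    by apply: nrmD => //; exact: L1B.
  by congr nrm; apply/funext => u; rewrite subrK.
split => //.
have : \forall y \ae m, `|mu k y| - mu k y = 0.
  apply: nrm_eq0; first by apply: L1B => //; exact: L1_abs.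
  rewrite ge0_nrm; last by move=> u; rewrite subr_ge0 ler_norm.
  by rewrite RintB ?mu1 ?subr_le0//; exact: L1_abs.
by apply: filterS => y /subr0_eq <-.
Qed.

End one_family.

Section linear_response.
Variables (K : R -> int -> T -> T -> R) (DK : int -> T -> T -> R).
Variables (r : T -> R) (b C e0 : R) (om : R -> R).
Hypothesis e0_gt0 : 0 < e0.
Hypothesis MK : forall e k, `|e| <= e0 -> markov_kernel m (K e k).
Hypothesis lr : L1 m r.
Hypothesis b0 : 0 < b.
Hypothesis rb : \int[m]_y r y = b.
Hypothesis rK : forall e k u, `|e| <= e0 -> \forall y \ae m, r y <= K e k u y.
Hypothesis bD : forall k, bounded_kernel m (DK k) C.
Hypothesis hD : forall e k u, `|e| <= e0 ->
  nrm m (fun y => K e k u y - K 0 k u y - e * DK k u y) <= om e * `|e|.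
Hypothesis om_cv : om e @[e --> (0 : R)^'] --> (0 : R).

Variables (mu : R -> int -> T -> R) (e1 : R).
Hypothesis e1_gt0 : 0 < e1.
Hypothesis e10 : e1 <= e0.
Hypothesis emu : forall e, `|e| <= e1 -> equivariant_family (fun k => push m (K e k)) (mu e).

Let L k := push m (K 0 k).
Let zz : `|0 : R| <= e0. Proof. by rewrite normr0 ltW. Qed.
Let zz1 : `|0 : R| <= e1. Proof. by rewrite normr0 ltW. Qed.
Let M0 k := MK k zz.
Let r0 k u := rK k u zz.
Let q01 : 0 <= 1 - b < 1.
Proof. by rewrite subr_ge0 (mass_le1 M0 lr rb r0) ltrBlDr ltrDl. Qed.
Let C0 : 0 <= C. Proof. exact: bounded_kernel_ge0 (bD 0). Qed.

(** The kernels K e k u all have mass 1, so their difference quotients in e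
    have integral 0. *)
Lemma deriv_int0 k u : \int[m]_y DK k u y = 0.
Proof.
have [mD lD DC] := bD k.
apply/eqP; rewrite -normr_le0.
have : \forall e \near (0 : R)^', `|\int[m]_y DK k u y| <= om e.
  near=> e; have ee0 : `|e| <= e0 by near: e; exact: dnbhs0_le.
  have e_neq0 : e != 0 by near: e; exact: nbhs_dnbhs_neq.
  have [_ _ lKe K1e] := MK k ee0; have [_ _ lK0 K10] := M0 k.
  rewrite -(ler_pM2r (x := `|e|)) ?normr_gt0// -normrM mulrC -RintZ//.
  have -> : `|\int[m]_y (e * DK k u y)| = `|\int[m]_y (K e k u y - K 0 k u y - e * DK k u y)|.
    rewrite (RintB (f := fun y => K e k u y - K 0 k u y) (L1B (lKe u) (lK0 u)) (L1Z e (lD u))).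
    by rewrite (RintB (lKe u) (lK0 u)) K1e K10 subrr sub0r normrN.
  apply: le_trans (Rint_le_nrm _) (hD k u ee0).
  by apply: L1B; [exact: L1B|exact: L1Z].
move=> h; have <- : lim (om e @[e --> (0 : R)^']) = 0 by apply/cvg_lim.
apply: limr_ge => //; by apply/cvg_ex; exists 0.
Unshelve. all: by end_near. Qed.

Let bKe e k : `|e| <= e0 -> bounded_kernel m (K e k) 1.
Proof. by move=> ee; exact: markov_bounded (MK k ee). Qed.

Let bdiff e k : `|e| <= e0 ->
  bounded_kernel m (fun u y => (K e k u y + (-1) * K 0 k u y) + (- e) * DK k u y) (om e * `|e|).
Proof.
move=> ee; have b1 := bounded_comb (- e) (bounded_comb (-1) (bKe k ee) (bKe k zz)) (bD k).
have [h1 h2 _] := b1; split => // u; apply: le_trans (hD k u ee).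
rewrite le_eqVlt; apply/orP; left; apply/eqP; congr nrm; apply/funext => y.
by rewrite mulN1r mulNr.
Qed.

Let push_diff e k phi : `|e| <= e0 -> L1 m phi ->
  \forall y \ae m,
    push m (fun u y => (K e k u y + (-1) * K 0 k u y) + (- e) * DK k u y) phi y =
    push m (K e k) phi y - L k phi y - e * push m (DK k) phi y.
Proof.
move=> ee lp.
have := push_comb_kernel (- e) (bounded_comb (-1) (bKe k ee) (bKe k zz)) (bD k) lp.
have := push_comb_kernel (-1) (bKe k ee) (bKe k zz) lp.
by apply: filterS2 => y -> ->; rewrite mulN1r mulNr.
Qed.

Let lmu e k : `|e| <= e1 -> L1 m (mu e k).
Proof. by move=> /emu /(_ k) [[]]. Qed.

Let dmu e k : `|e| <= e1 -> density (mu e k).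
Proof. by move=> /emu /(_ k) []. Qed.

(** The difference mu e - mu 0 solves the recursion of the operators at e = 0,
    with the forcing (L e - L 0) (mu e), which is of order e. *)
Lemma mu_lip e k : `|e| <= e1 ->
  nrm m (fun y => mu e k y - mu 0 k y) <= (C + om e) * `|e| / b.
Proof.
move=> ee1; have ee := le_trans ee1 e10.
pose h k y := push m (fun u y => (K e k u y + (-1) * K 0 k u y) + (- e) * DK k u y) (mu e k) y
    + e * push m (DK k) (mu e k) y.
have lD j : L1 m (push m (DK j) (mu e j)) by apply: push_L1 (bD j) (lmu _ ee1).
have lB j := push_L1 (bdiff j ee) (lmu j ee1).
apply: (@forced_bound _ r b M0 lr b0 rb r0 (fun k y => mu e k y - mu 0 k y) h 2).
- by move=> j; apply: L1B; exact: lmu.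
- by move=> j; apply: L1D => //; exact: L1Z.
- move=> j; rewrite RintB; try exact: lmu.
  have [_ _ ->] := dmu j ee1; have [_ _ ->] := dmu j zz1; exact: subrr.
- move=> j; have [_ E1] := emu ee1 j; have [_ E0] := emu zz1 j.
  have s := fam_sub M0 j (lmu j ee1) (lmu j zz1).
  apply: filterS3 E1 E0 (filterI s (push_diff j ee (lmu j ee1))) => y -> -> [-> D].
  by rewrite /h D /L; ring.
- move=> j; apply: le_trans (nrmB (lmu j ee1) (lmu j zz1)) _.
  by rewrite !density_nrm//; exact: dmu.
- move=> j; apply: le_trans (nrmD (lB j) (L1Z e (lD j))) _.
  rewrite mulrDl addrC nrmZ//; apply: lerD.
    rewrite mulrC ler_wpM2r//; apply: le_trans (push_nrm (bD j) (lmu j ee1)) _.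
    by rewrite density_nrm ?mulr1//; exact: dmu.
  apply: le_trans (push_nrm (bdiff j ee) (lmu j ee1)) _.
  by rewrite density_nrm ?mulr1//; exact: dmu.
Qed.

Let g k := push m (DK k) (mu 0 k).
Let term k j := oprod L k j (g (k - j%:Z - 1)).

Let lg k : L1 m (g k). Proof. exact: push_L1 (bD k) (lmu k zz1). Qed.
Let ng k : nrm m (g k) <= C.
Proof.
apply: le_trans (push_nrm (bD k) (lmu k zz1)) _.
by rewrite density_nrm ?mulr1//; exact: dmu.
Qed.
Let ig k : \int[m]_y g k y = 0.
Proof.
rewrite Rint_marginal; last exact: push_L1prod (bD k) (lmu k zz1).
apply: Rint_eq0 => u; rewrite RintZ ?deriv_int0 ?mulr0//.
by have [_ lD _] := bD k.
Qed.

Lemma term_L1 k j : L1 m (term k j).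
Proof. exact: (oprod_L1 M0 j k (lg _)). Qed.

Lemma term_nrm k j : nrm m (term k j) <= C * (1 - b) ^+ j.
Proof.
apply: le_trans (oprod_contract M0 lr b0 rb r0 j k (lg _) (ig _)) _.
by rewrite mulrC ler_wpM2r// exprn_ge0//; case/andP: q01.
Qed.

Lemma term_int k j : \int[m]_y term k j y = 0.
Proof. by rewrite (oprod_int0 M0)//; exact: lg. Qed.

Let c n := C / (1 - (1 - b)) * (1 - b) ^+ n.

Lemma term_sum k n p : \sum_(n <= j < p) nrm m (term k j) <= c n.
Proof.
apply: le_trans (geo_tail n p q01 C0); apply: ler_sum => j _; exact: term_nrm.
Qed.

Let eta k := sumfun (term k).

Lemma eta_L1 k : L1 m (eta k).
Proof. exact: (L1_complete (term_L1 k) (term_sum k)).1. Qed.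

Lemma eta_tail k n : nrm m (fun y => eta k y - \sum_(j < n) term k j y) <= c n.
Proof. exact: (L1_complete (term_L1 k) (term_sum k)).2. Qed.

Lemma eta_nrm k : nrm m (eta k) <= c 0.
Proof.
have := eta_tail k 0; rewrite (_ : (fun y => _) = eta k)//.
by apply/funext => y; rewrite big_ord0 subr0.
Qed.

Let sq (x A : R) : (forall n, x <= A * c n) -> x <= 0.
Proof.
move=> xA; apply: (@geo_small _ (1 - b) (A * (C / (1 - (1 - b)))) x q01) => n.
by rewrite -mulrA; exact: xA.
Qed.

Let lsum k n : L1 m (fun y => \sum_(j < n) term k j y).
Proof.
by have := @L1_sum _ _ _ m _ (index_enum 'I_n) (fun j => term k j) (fun j => term_L1 k j).
Qed.

Lemma eta_int k : \int[m]_y eta k y = 0.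
Proof.
apply/eqP; rewrite -normr_le0; apply: (@sq _ 1) => n; rewrite mul1r.
apply: le_trans (eta_tail k n).
have -> : \int[m]_y eta k y = \int[m]_y (eta k y - \sum_(j < n) term k j y).
  rewrite RintB//; last exact: eta_L1.
  suff -> : \int[m]_y \sum_(j < n) term k j y = 0 by rewrite subr0.
  elim: n => [|n ih].
    by apply: Rint_eq0 => y; rewrite big_ord0.
  under eq_Rintegral do rewrite big_ord_recr/=.
  rewrite RintD; [by rewrite ih term_int addr0|exact: lsum|exact: term_L1].
by apply: Rint_le_nrm; apply: L1B => //; exact: eta_L1.
Qed.

Lemma L_sum k n : \forall y \ae m,
  L k (fun u => \sum_(j < n) term k j u) y = \sum_(j < n) term (k + 1) j.+1 y.
Proof.
have tS j : term (k + 1) j.+1 = L k (term k j).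
  rewrite /term /= addrK; congr (L k (oprod L k j (g _))).
  by rewrite -addn1 PoszD; lia.
elim: n => [|n ih].
  apply: aeW => y; rewrite big_ord0 /L /push /marginal.
  by apply: Rint_eq0 => u; rewrite big_ord0 mul0r.
have := push_comb 1 (bKe k zz) (lsum k n) (term_L1 k n).
apply: filterS2 ih => y ih; rewrite mul1r big_ord_recr/= tS -ih => <-.
by congr (L _ _ _); apply/funext => u; rewrite big_ord_recr mul1r.
Qed.

(** Each operator maps the partial sums of the series at k to partial sums,
    without the first term g k, of the series at k + 1. *)
Lemma eta_rec k : \forall y \ae m, eta (k + 1) y = L k (eta k) y + g k y.
Proof.
have le := eta_L1.
have lLe : L1 m (L k (eta k)) by apply: push_L1 (bKe k zz) _.
apply: nrm_sub_eq0 => //; first exact: L1D.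
apply: (@sq _ 2) => n.
apply: le_trans (nrm_dist (le _) (lsum (k + 1) n.+1) (L1D lLe (lg k))) _.
have -> : 2 * c n = c n + c n by ring.
rewrite lerD//.
  apply: le_trans (eta_tail _ _) _; rewrite /c exprS ler_wpM2l//.
    by rewrite divr_ge0// opprB addrC subrK ltW.
  by rewrite ler_piMl ?exprn_ge0//; case/andP: q01 => // _ /ltW.
rewrite -(nrm_ae (fam_L1 M0 k (L1B (lsum k n) (le k)))) //.
- apply: le_trans (fam_le M0 k (L1B (lsum k n) (le k))) _.
  by rewrite nrmC; exact: eta_tail.
- by apply: L1B => //; exact: L1D.
- have := fam_sub M0 k (lsum k n) (le k).
  apply: filterS2 (L_sum k n) => y E; rewrite -/(L k) => ->; rewrite E.
  rewrite big_ord_recl/= /term/= subr0 addrK; ring.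
Qed.

(** The error of the difference quotient solves the recursion of the operators
    at e = 0.  Its forcing is the remainder of the first order expansion of the
    kernels, plus their derivative applied to mu e - mu 0; both are small
    uniformly in k. *)
Lemma response_rate e k : `|e| <= e1 -> e != 0 ->
  nrm m (fun y => (mu e k y - mu 0 k y) / e - eta k y) <=
  (om e + C * ((C + om e) * `|e| / b)) / b.
Proof.
move=> ee1 e_neq0; have ee := le_trans ee1 e10.
have ie : e^-1 != 0 by rewrite invr_eq0.
pose dm j y := mu e j y - mu 0 j y.
have ldm j : L1 m (dm j) by apply: L1B; exact: lmu.
pose h j y :=
  e^-1 * push m (fun u y => (K e j u y + (-1) * K 0 j u y) + (- e) * DK j u y) (mu e j) y +
  push m (DK j) (dm j) y.
have lB j := push_L1 (bdiff j ee) (lmu j ee1).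
have lD j : L1 m (push m (DK j) (dm j)) by apply: push_L1 (bD j) _.
have lf j : L1 m (fun y => (mu e j y - mu 0 j y) / e - eta j y).
  apply: L1B (eta_L1 j); rewrite (_ : (fun x => _) = (fun x => e^-1 * dm j x)).
    exact: L1Z.
  by apply/funext => x; rewrite mulrC.
apply: (@forced_bound _ r b M0 lr b0 rb r0
  (fun k y => (mu e k y - mu 0 k y) / e - eta k y) h (`|e^-1| * 2 + c 0)) => //.
- by move=> j; apply: L1D => //; exact: L1Z.
- move=> j; rewrite RintB; [|by have := L1Z e^-1 (ldm j);
      congr L1; apply/funext => x; rewrite mulrC| exact: eta_L1].
  rewrite eta_int subr0; under eq_Rintegral do rewrite mulrC.
  rewrite (RintZ _ (ldm j)) RintB; try exact: lmu.
  by have [_ _ ->] := dmu j ee1; have [_ _ ->] := dmu j zz1; rewrite subrr mulr0.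
- move=> j; have [_ E1] := emu ee1 j; have [_ E0] := emu zz1 j.
  have s1 := push_comb (-1) (bKe j zz) (L1Z e^-1 (ldm j)) (eta_L1 j).
  have s0 := push_comb e^-1 (bKe j zz) (@L10 _ _ _ m) (ldm j).
  have s2 := push_comb (-1) (bKe j zz) (lmu j ee1) (lmu j zz1).
  have s3 := push_comb (-1) (bD j) (lmu j ee1) (lmu j zz1).
  apply: filterS3 (filterI E1 E0) (filterI (filterI s0 s1) (filterI s2 s3))
    (filterI (eta_rec j) (push_diff j ee (lmu j ee1))) => y [-> ->] [[S0 S1] [S2 S3]] [-> D].
  have -> : push m (K 0 j) (fun u => (mu e j u - mu 0 j u) / e - eta j u) y =
     e^-1 * (push m (K 0 j) (mu e j) y - push m (K 0 j) (mu 0 j) y) - L j (eta j) y.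
    transitivity (push m (K 0 j) (fun u => e^-1 * dm j u + -1 * eta j u) y).
      by congr (push _ _ _ _); apply/funext => u; rewrite mulN1r mulrC.
    rewrite S1 mulN1r; congr (_ - _).
    transitivity (push m (K 0 j) (fun u => 0 + e^-1 * dm j u) y).
      by congr (push _ _ _ _); apply/funext => u; rewrite add0r.
    rewrite S0 (_ : push m (K 0 j) (fun=> 0) y = 0); last first.
      by apply: Rint_eq0 => u; rewrite mul0r.
    rewrite add0r; congr (_ * _); rewrite -[in RHS]mulN1r -S2.
    by congr (push _ _ _ _); apply/funext => u; rewrite mulN1r.
  rewrite /h D (_ : push m (DK j) (dm j) y = push m (DK j) (mu e j) y - g j y); last first.
    rewrite -[in RHS]mulN1r -S3.
    by congr (push _ _ _ _); apply/funext => u; rewrite mulN1r.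
  by rewrite /L; field.
- move=> j; rewrite (_ : (fun y => _) = (fun y => e^-1 * dm j y - eta j y)); last first.
    by apply/funext => y; rewrite mulrC.
  apply: le_trans (nrmB (L1Z e^-1 (ldm j)) (eta_L1 j)) _.
  rewrite nrmZ// lerD ?eta_nrm// ler_wpM2l//.
  apply: le_trans (nrmB (lmu j ee1) (lmu j zz1)) _.
  by rewrite !density_nrm//; exact: dmu.
- move=> j; apply: le_trans (nrmD (L1Z e^-1 (lB j)) (lD j)) _.
  apply: lerD; last first.
    apply: le_trans (push_nrm (bD j) (ldm j)) _.
    by rewrite ler_wpM2l// mu_lip.
  rewrite nrmZ// normfV ler_pdivrMl ?normr_gt0// mulrC.
  apply: le_trans (push_nrm (bdiff j ee) (lmu j ee1)) _.
  by rewrite density_nrm ?mulr1//; exact: dmu.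
Qed.

Theorem linear_response : exists eta : int -> T -> R,
  [/\ (forall k, L1 m (eta k)),
      (exists B, forall k, nrm m (eta k) <= B),
      (exists2 om' : R -> R, om' e @[e --> (0 : R)^'] --> (0 : R) &
        forall e, `|e| <= e1 -> e != 0 -> forall k,
          nrm m (fun y => (mu e k y - mu 0 k y) / e - eta k y) <= om' e),
      (forall k j, L1 m (term k j) /\ nrm m (term k j) <= C * (1 - b) ^+ j) &
      forall k n, nrm m (fun y => eta k y - \sum_(j < n) term k j y) <=
        C / b * (1 - b) ^+ n].
Proof.
exists eta; split.
- exact: eta_L1.
- by exists (c 0) => k; exact: eta_nrm.
- exists (fun e => (om e + C * ((C + om e) * `|e| / b)) / b); last first.
    by move=> e ee e_neq0 k; exact: response_rate.
  have ce := @norm_dnbhs0 R R.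
  suff : (om e + C * ((C + om e) * `|e| / b)) / b @[e --> (0 : R)^'] -->
      (0 + C * ((C + 0) * 0 / b)) / b.
    by rewrite mulr0 !mul0r mulr0 addr0 mul0r.
  apply: cvgM; last exact: cvg_cst.
  apply: cvgD => //; apply: cvgM; first exact: cvg_cst.
  apply: cvgM; last exact: cvg_cst.
  by apply: cvgM => //; apply: cvgD => //; exact: cvg_cst.
- by move=> k j; split; [exact: term_L1|exact: term_nrm].
- by move=> k n; have := eta_tail k n; rewrite /c opprB addrC subrK.
Qed.

End linear_response.
End response.

(** * Product measures on column vectors *)

Section colvec_measurability.
Context (R : realType) (n : nat).
Local Notation V := 'cV[R]_n.

Lemma measurable_coord d (T : measurableType d) (f : T -> V) i :
  measurable_fun setT f -> measurable_fun setT (fun x => f x i 0).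
Proof. by move=> mf; apply: (measurableT_comp (measurable_coordc i) mf). Qed.

Lemma measurable_colD d (T : measurableType d) (f g : T -> V) :
  measurable_fun setT f -> measurable_fun setT g ->
  measurable_fun setT (fun x => f x + g x).
Proof.
move=> mf mg; apply: measurable_fun_coordcP => i.
under [X in measurable_fun _ X]eq_fun do rewrite /coordc /= mxE.
by apply: measurable_funD; exact: measurable_coord.
Qed.

Lemma measurable_colZ d (T : measurableType d) (a : R) (f : T -> V) :
  measurable_fun setT f -> measurable_fun setT (fun x => a *: f x).
Proof.
move=> mf; apply: measurable_fun_coordcP => i.
under [X in measurable_fun _ X]eq_fun do rewrite /coordc /= mxE.
by apply: measurable_funM => //; exact: measurable_coord.
Qed.

Lemma measurable_colM d (T : measurableType d) p (A : 'M[R]_(n, p)) (f : T -> 'cV[R]_p) :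
  measurable_fun setT f -> measurable_fun setT (fun x => A *m f x).
Proof.
move=> mf; apply: measurable_fun_coordcP => i.
under [X in measurable_fun _ X]eq_fun do rewrite /coordc /= mxE.
apply: measurable_sum => j; apply: measurable_funM => //.
by apply: (measurableT_comp (measurable_coordc j) mf).
Qed.

Definition cmap (phi : 'I_n -> R -> R) (u : V) : V := \col_i phi i (u i 0).

Lemma measurable_cmap phi : (forall i, measurable_fun setT (phi i)) ->
  measurable_fun setT (cmap phi).
Proof.
move=> mphi; apply: measurable_fun_coordcP => i.
under [X in measurable_fun _ X]eq_fun do rewrite /coordc /cmap /= mxE.
by apply: measurableT_comp => //; exact: measurable_coordc.
Qed.

Lemma measurable_cube (G : set R) : measurable G ->
  measurable [set u : V | forall i, G (u i 0)].
Proof.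
move=> mG; rewrite (_ : [set u | _] =
    \bigcap_(i in [set: 'I_n]) (coordc i @^-1` G)); last first.
  apply/seteqP; split => u /= h i; first by move=> _; exact: (h i).
  exact: (h i I).
apply: fin_bigcap_measurable => // i _; rewrite -[X in measurable X]setTI.
exact: measurable_coordc.
Qed.

End colvec_measurability.

Section powm.
Context (R : realType).
Variable mu : {sigma_finite_measure set (measurableTypeR R) -> \bar R}.

Lemma powm_cube n (G : set R) : measurable G ->
  powm mu n [set u | forall i, G (u i 0)] = (mu G ^+ n)%E.
Proof.
move=> mG; elim: n => [|n ih].
  by rewrite /= diracE mem_set// => -[].
have -> : powm mu n.+1 [set u | forall i, G (u i 0)] =
  (powm mu n \x mu)%E (@consc R n @^-1` [set u | forall i, G (u i 0)]) by [].
rewrite (_ : @consc R n @^-1` _ = [set u : 'cV[R]_n | forall i, G (u i 0)] `*` G).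
  rewrite product_measure1E//; last exact: measurable_cube.
  by rewrite ih expeS muleC.
apply/seteqP; split => -[x t] /=.
  move=> h; split => [i|]; first by have := h (lift ord0 i); rewrite mxE liftK.
  by have := h ord0; rewrite mxE unlift_none.
by move=> [hx ht] i; rewrite mxE; case: (unliftP ord0 i) => [j|] _.
Qed.

Lemma powm_sigma_finite n : sigma_finite setT (powm mu n).
Proof.
have /sigma_finiteP[G [GT Gnd Gf]] := sigma_finiteT mu.
exists (fun k => [set u : 'cV[R]_n | forall i, G k (u i 0)]).
  apply/seteqP; split => // u _.
  have /choice[k hk] i : exists k, G k (u i 0).
    by have : setT (u i 0) by []; rewrite GT => -[k _ Gk]; exists k.
  exists (\max_i k i)%N => // i.
  by have /subsetPset := Gnd _ _ (leq_bigmax i : (k i <= \max_i k i)%N); apply; exact: hk.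
move=> k; have [mG Gfin] := Gf k; split; first exact: measurable_cube.
rewrite powm_cube// -(@fineK _ (mu (G k))) -?EFin_expe ?ltry//.
by rewrite ge0_fin_numE.
Qed.


(** The measure [powm], under a name that carries its sigma-finiteness. *)
Definition powms n : set 'cV[R]_n -> \bar R := powm mu n.
Arguments powms : clear implicits.
HB.instance Definition _ n := Measure.copy (@powms n) (powm mu n).
HB.instance Definition _ n := Measure_isSigmaFinite.Build _ _ _ (@powms n)
  (powm_sigma_finite n).

Lemma ge0_integral_powmS n (f : 'cV[R]_n.+1 -> \bar R) :
  measurable_fun setT f -> (forall u, (0 <= f u)%E) ->
  (\int[powm mu n.+1]_u f u =
   \int[powm mu n]_x \int[mu]_t f (consc (x, t)))%E.
Proof.
move=> mf f0.
have := @ge0_integral_pushforward _ _ _ _ _ _ (@measurable_consc R n)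
  (powms n \x mu)%E setT f measurableT mf (fun y _ => f0 y).
rewrite preimage_setT => H.
transitivity (\int[powms n \x mu]_x (f \o @consc R n) x)%E; first by rewrite -H.
rewrite (fubini_tonelli1 (m1 := powms n))//=.
by apply: (measurableT_comp mf); exact: measurable_consc.
Qed.

Lemma consc0 n (x : 'cV[R]_n) (t : R) : consc (x, t) ord0 0 = t.
Proof. by rewrite mxE unlift_none. Qed.

Lemma conscS n (x : 'cV[R]_n) (t : R) j : consc (x, t) (lift ord0 j) 0 = x j 0.
Proof. by rewrite mxE liftK. Qed.

Lemma cmap_consc n (phi : 'I_n.+1 -> R -> R) x t :
  cmap phi (consc (x, t)) = consc (cmap (fun j => phi (lift ord0 j)) x, phi ord0 t).
Proof.
apply/matrixP => i j; rewrite !mxE; case: (unliftP ord0 i) => [k|] ->.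
  by rewrite mxE.
by [].
Qed.

(** Change of variables formulas for the coordinates tensorise.  For translations,
    rho is 1 under Lebesgue measure, and a Cameron-Martin density under the
    Gaussian measure. *)
Lemma ge0_integral_cmap n (phi rho : 'I_n -> R -> R) :
  (forall i, measurable_fun setT (phi i)) ->
  (forall i, measurable_fun setT (rho i)) ->
  (forall i t, 0 <= rho i t) ->
  (forall i (f : R -> \bar R), measurable_fun setT f -> (forall t, 0 <= f t)%E ->
     \int[mu]_t f (phi i t) = \int[mu]_t (f t * (rho i t)%:E))%E ->
  forall f : 'cV[R]_n -> \bar R, measurable_fun setT f -> (forall u, 0 <= f u)%E ->
  (\int[powm mu n]_u f (cmap phi u) =
   \int[powm mu n]_u (f u * (\prod_i rho i (u i 0)%R)%:E))%E.
Proof.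
elim: n phi rho => [|n ih] phi rho mphi mrho rho0 phirho f mf f0.
  rewrite !integral_dirac//; last 2 first.
  - by apply: emeasurable_funM => //; apply/measurable_EFinP; apply: measurable_prod => -[].
  - by apply: (measurableT_comp mf); exact: measurable_cmap.
  by rewrite !diracE !mem_set// !mul1e big_ord0 mule1; congr f; apply/matrixP => -[].
have mfc : measurable_fun setT (f \o @consc R n).
  by apply: measurableT_comp => //; exact: measurable_consc.
have mcoord i : measurable_fun setT (fun u : 'cV[R]_n.+1 => u i 0).
  exact: measurable_coordc.
rewrite !ge0_integral_powmS//; last 3 first.
- apply: emeasurable_funM => //; apply/measurable_EFinP.
  apply: measurable_prod => i _; exact: (measurableT_comp (mrho i) (mcoord i)).
- by move=> u; rewrite mule_ge0// lee_fin prodr_ge0.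
- by apply: (measurableT_comp mf); exact: measurable_cmap.
pose h x := (\int[mu]_t (f (consc (x, t)) * (rho ord0 t)%:E))%E.
have mfr : measurable_fun setT (fun p : 'cV[R]_n * measurableTypeR R =>
    f (consc p) * (rho ord0 p.2)%:E)%E.
  apply: emeasurable_funM => //; apply/measurable_EFinP.
  exact: (measurableT_comp (mrho ord0)).
have mh : measurable_fun setT h.
  have := @measurable_fun_fubini_tonelli_F _ _ _ _ _ mu
    (fun p : 'cV[R]_n * measurableTypeR R => f (consc p) * (rho ord0 p.2)%:E)%E.
  by apply => // p; rewrite mule_ge0// lee_fin.
have h0 x : (0 <= h x)%E by apply: integral_ge0 => t _; rewrite mule_ge0// lee_fin.
transitivity (\int[powm mu n]_x h (cmap (fun j => phi (lift ord0 j)) x))%E.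
  apply: eq_integral => x _; under eq_integral do rewrite cmap_consc.
  rewrite (phirho ord0 (fun t => f (consc (_, t))))//.
  exact: (measurableT_comp mfc (pair1_measurable _)).
rewrite (ih _ (fun j => rho (lift ord0 j)))//; last by move=> i; exact: phirho.
apply: eq_integral => x _; rewrite /h -ge0_integralZr//; last 3 first.
- exact: (measurableT_comp mfr (pair1_measurable x)).
- by move=> t _; rewrite mule_ge0// lee_fin.
- by rewrite lee_fin prodr_ge0.
apply: eq_integral => t _; rewrite -muleA -EFinM big_ord_recl consc0.
by under [in RHS]eq_bigr do rewrite conscS.
Qed.

(** By Tonelli almost every section of a null set is null. *)
Lemma null_cmap n (phi : R -> R) : measurable_fun setT phi ->
  (forall B, measurable B -> mu B = 0 -> mu (phi @^-1` B) = 0)%E ->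
  forall A : set 'cV[R]_n, measurable A -> powm mu n A = 0%E ->
  powm mu n (cmap (fun=> phi) @^-1` A) = 0%E.
Proof.
move=> mphi null; elim: n => [|n ih] A mA.
  rewrite (_ : cmap _ @^-1` A = A)//.
  have cE (x : 'cV[R]_0) : cmap (fun=> phi) x = x by apply/matrixP => -[].
  by apply/seteqP; split => x /=; rewrite cE.
pose S (B : set 'cV[R]_n.+1) x := mu (xsection (@consc R n @^-1` B) x).
have mcB (B : set 'cV[R]_n.+1) : measurable B -> measurable (@consc R n @^-1` B).
  by move=> mB; rewrite -[X in measurable X]setTI; exact: measurable_consc.
have mS B : measurable B -> measurable_fun setT (S B).
  by move=> mB; apply: measurable_fun_xsection; exact: mcB.
have mcm : measurable_fun setT (cmap (fun=> phi) : 'cV[R]_n -> 'cV[R]_n).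
  exact: measurable_cmap.
have mcm1 : measurable (cmap (fun=> phi) @^-1` A).
  by rewrite -[X in measurable X]setTI; exact: (measurable_cmap (fun=> mphi)).
have -> : powm mu n.+1 A = (\int[powm mu n]_x S A x)%E by [].
have -> : powm mu n.+1 (cmap (fun=> phi) @^-1` A) =
  (\int[powm mu n]_x S (cmap (fun=> phi) @^-1` A) x)%E by [].
move=> SA0; pose N := [set x | S A x != 0%E].
have mN : measurable N.
  by have := emeasurable_neq measurableT (mS A mA) 0%E; rewrite setTI.
have N0 : powm mu n N = 0%E.
  have := ae_eq_integral_abs (powm mu n) measurableT (mS A mA).
  case=> + _; under eq_integral do rewrite gee0_abs//.
  move=> /(_ SA0) [B [mB B0 sub]]; apply: (subset_measure0 mN mB) B0.
  by move=> x /= /eqP Nx; apply: sub => /= /(_ I).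
rewrite (@ae_eq_integral _ _ _ _ _ (cst 0%E)) ?integral0//.
  by have := mS _ mcm1.
exists (cmap (fun=> phi) @^-1` N); split.
- by rewrite -[X in measurable X]setTI; exact: mcm.
- exact: ih.
- move=> x /=; apply: contra_notP => /negP; rewrite negbK => /eqP SAx _.
  rewrite -(null _ _ SAx); last exact: measurable_xsection (mcB _ mA).
  congr (mu _); apply/seteqP; split => t /=; rewrite /xsection/= !inE/=.
    by rewrite cmap_consc.
  by rewrite -cmap_consc.
Qed.

End powm.
Arguments powms {R} mu n _.

(** * Translation and folding of the line *)

Section line.
Context (R : realType).
Local Notation leb := (@lebesgue_measure R).

Definition tshift (a t : R) : R := t + a.

Lemma measurable_tshift a : measurable_fun [set: R] (tshift a).
Proof. by apply: measurable_funD. Qed.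

Let measurable_tshift' a :
  @measurable_fun _ _ (measurableTypeR R) (measurableTypeR R) setT (tshift a).
Proof. exact: measurable_tshift. Qed.

Lemma lebesgue_shift a (A : set R) : measurable A ->
  leb (tshift a @^-1` A) = leb A.
Proof.
move=> mA.
pose f : {mfun (measurableTypeR R) >-> (measurableTypeR R)} :=
  HB.pack (tshift a : measurableTypeR R -> measurableTypeR R)
    (isMeasurableFun.Build _ _ _ _ _ (measurable_tshift' a)).
apply/esym; have := @lebesgue_measure_unique R (pushforward leb f).
apply => //= _ [[x y]] _ <-; rewrite /pushforward.
rewrite (_ : _ @^-1` _ = [set` `]x - a, y - a]]).
  rewrite !lebesgue_measure_itv/= !lte_fin ltrD2r.
  by case: ifP => // _; rewrite -!EFinD; congr EFin; lra.
by apply/seteqP; split => t /=; rewrite !in_itv/= /tshift => /andP[? ?]; apply/andP; split; lra.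
Qed.

Lemma ge0_integral_shift a (f : R -> \bar R) :
  measurable_fun setT f -> (forall t, 0 <= f t)%E ->
  (\int[leb]_t f (tshift a t) = \int[leb]_t f t)%E.
Proof.
move=> mf f0.
have := @ge0_integral_pushforward _ _ _ _ _ _ (measurable_tshift' a)
  leb setT f measurableT mf (fun y _ => f0 y).
rewrite preimage_setT => <-; apply: eq_measure_integral => A mA _.
exact: lebesgue_shift.
Qed.

Lemma lebesgue_neg (A : set R) : measurable A ->
  leb ((fun t : R => - t) @^-1` A) = leb A.
Proof. by move=> mA; rewrite -[RHS]lebesgue_measureN. Qed.

Lemma ge0_integral_normal_prob (f : R -> \bar R) :
  measurable_fun setT f -> (forall t, 0 <= f t)%E ->
  (\int[normal_prob (0 : R) 1]_t f t =
   \int[leb]_t (f t * (normal_pdf (0:R) 1 t)%:E))%E.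
Proof.
move=> mf f0.
have dom := @normal_prob_dominates R 0 1.
rewrite -(Radon_Nikodym_SigmaFinite.change_of_variables dom)//.
have iRN := Radon_Nikodym_SigmaFinite.f_integrable dom.
have mRN := measurable_int _ iRN.
have mpdf : measurable_fun setT (fun t : R => (normal_pdf (0:R) 1 t)%:E).
  by apply/measurable_EFinP; exact: measurable_normal_pdf.
apply: ae_eq_integral => //; try exact: emeasurable_funM.
have : ae_eq leb setT (Radon_Nikodym_SigmaFinite.f (normal_prob (0:R) 1) leb)
    (fun t : R => (normal_pdf (0:R) 1 t)%:E).
  apply: integral_ae_eq => // E _ mE.
  by rewrite -Radon_Nikodym_SigmaFinite.f_integral.
by apply: filterS => x /(_ I) -> _.
Qed.

(** The density, with respect to the standard normal law, of its translate by a. *)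
Definition cm1 (a t : R) : R := expR (a * t - a ^+ 2 / 2).

Lemma normal_shift (a : R) (f : R -> \bar R) :
  measurable_fun setT f -> (forall t, 0 <= f t)%E ->
  (\int[normal_prob (0 : R) 1]_t f (tshift a t) =
   \int[normal_prob (0 : R) 1]_t (f t * (cm1 a t)%:E))%E.
Proof.
move=> mf f0.
have mcm : measurable_fun setT (cm1 a).
  apply: (measurableT_comp (@measurable_expR R)); apply: measurable_funB => //.
rewrite !ge0_integral_normal_prob//; last 3 first.
- by apply: emeasurable_funM => //; exact/measurable_EFinP.
- by move=> t; rewrite mule_ge0// lee_fin expR_ge0.
- by apply: (measurableT_comp mf); exact: measurable_tshift.
rewrite -[RHS](@ge0_integral_shift a)//; last 2 first.
- apply: emeasurable_funM; first by apply: emeasurable_funM => //; exact/measurable_EFinP.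
  by apply/measurable_EFinP; exact: measurable_normal_pdf.
- by move=> t; rewrite !mule_ge0// lee_fin ?expR_ge0// normal_pdf_ge0.
apply: eq_integral => t _; rewrite -muleA; congr (_ * _)%E.
rewrite -EFinM; congr EFin.
rewrite normal_pdfE ?oner_neq0// /normal_fun /cm1 /tshift mulrCA; congr (_ * _).
by rewrite -expRD; congr expR; rewrite !subr0 !expr1n; field.
Qed.

End line.

Section reflect_line.
Context (R : realType) (N : nat) (M : gs_model R N).
Hypothesis TT : Tmin M < Tmax M.
Local Notation leb := (@lebesgue_measure R).
Local Notation l := (Tmax M - Tmin M).

Let l0 : 0 < l. Proof. by rewrite subr_gt0. Qed.
Let p0 : 0 < 2 * l. Proof. by rewrite mulr_gt0. Qed.

Lemma modr_bound (x : R) : 0 <= modr x (2 * l) < 2 * l.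
Proof.
have := Num.Theory.floor_itv (x / (2 * l)); rewrite /modr intrD.
by rewrite ler_pdivlMr// ltr_pdivrMr// => /andP[h1 h2]; apply/andP; split; lra.
Qed.

Lemma reflect1_in s : Tmin M <= reflect1 M s <= Tmax M.
Proof.
rewrite /reflect1; have /andP[h1 h2] := modr_bound (s - Tmin M).
set y := modr _ _ in h1 h2 *; have := normr_ge0 (y - l).
have : `|y - l| <= l by rewrite ler_norml; apply/andP; split; lra.
by move=> *; apply/andP; split; lra.
Qed.

Lemma measurable_floorR : measurable_fun [set: R] (fun t : R => (Num.floor t)%:~R : R).
Proof.
apply: nondecreasing_measurable => // x y xy.
by rewrite ler_int; exact: Num.Theory.le_floor.
Qed.

Lemma measurable_reflect1 : measurable_fun [set: R] (reflect1 M).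
Proof.
apply: measurable_funB => //; apply: measurableT_comp => //.
apply: measurable_funB => //; rewrite /modr; apply: measurable_funB => //.
  exact: measurable_funB.
apply: measurable_funM => //.
apply: (measurableT_comp measurable_floorR); apply: measurable_funM => //.
exact: measurable_funB.
Qed.

(** The folding map coincides piecewise with maps s -> s + const or s -> const - s,
    with countably many constants, and these preserve Lebesgue null sets. *)
Lemma reflect1_null (B : set R) : measurable B -> leb B = 0%E ->
  leb (reflect1 M @^-1` B) = 0%E.
Proof.
move=> mB B0.
pose z (k : nat) : int := odflt 0 (unpickle k).
(* with i = floor (x / (2 l)), the two branches of the folding map are
   translations by -2 l i and reflections at T- + l + l i *)
pose F k : set (measurableTypeR R) := (tshift (- (2 * l * (z k)%:~R)) @^-1` B) `|`
  (tshift (- (2 * Tmin M + 2 * l + 2 * l * (z k)%:~R)) @^-1` ((fun t : R => - t) @^-1` B)).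
have mN (A : set R) : measurable A -> measurable ((fun t : R => - t) @^-1` A).
  move=> mA; rewrite -[X in measurable X]setTI; exact: oppr_measurable.
have mSh a (A : set R) : measurable A -> measurable (tshift a @^-1` A).
  move=> mA; rewrite -[X in measurable X]setTI; exact: measurable_tshift.
have mR : measurable (reflect1 M @^-1` B : set (measurableTypeR R)).
  by rewrite -[X in measurable X]setTI; exact: measurable_reflect1.
have nU : leb.-negligible (\bigcup_k F k).
  apply: negligible_bigcup => k; apply: negligibleU; apply/negligibleP.
  - exact: mSh.
  - by rewrite [LHS]lebesgue_shift.
  - by apply: mSh; exact: mN.
  - by rewrite [LHS]lebesgue_shift ?[LHS]lebesgue_neg//; exact: mN.
suff sub : reflect1 M @^-1` B `<=` \bigcup_k F k.
  have [A [mA A0 sA]] := nU.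
  by apply: (subset_measure0 mR mA _ A0) => x /sub /sA.
move=> s /=; rewrite /reflect1; set x := s - Tmin M.
set i := Num.floor (x / (2 * l)).
have zi : z (pickle i) = i by rewrite /z pickleK.
have [h|h] := leP (modr x (2 * l)) l.
  rewrite ler0_norm; last by lra.
  move=> Bs; exists (pickle i) => //; left; rewrite /= zi /tshift.
  rewrite [X in B X](_ : _ = Tmin M + l - - (modr x (2 * l) - l))//; rewrite /modr -/i /x; lra.
rewrite gtr0_norm; last by lra.
move=> Bs; exists (pickle i) => //; right; rewrite /= zi /tshift.
rewrite [X in B X](_ : _ = Tmin M + l - (modr x (2 * l) - l))//; rewrite /modr -/i /x; lra.
Qed.

End reflect_line.

(** * Translates of the Gaussian law *)

Section translations.
Context (R : realType) (N : nat).
Local Notation V := 'cV[R]_N.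
Local Notation gam := (@std_gauss R N).
Local Notation leb := (@lebc R N).
Implicit Types (u w : V) (f : V -> \bar R).

Lemma cmap_shift w u : cmap (fun i => tshift (w i 0)) u = u + w.
Proof. by apply/matrixP => i j; rewrite !mxE ord1. Qed.

Lemma lebc_shift w f : measurable_fun setT f -> (forall u, 0 <= f u)%E ->
  (\int[leb]_u f (u + w)%R = \int[leb]_u f u)%E.
Proof.
move=> mf f0.
under eq_integral do rewrite -cmap_shift.
rewrite (@ge0_integral_cmap R (@lebesgue_measure R) N _ (fun _ _ => 1))//.
- by apply: eq_integral => u _; rewrite big1// mule1.
- by move=> i; exact: measurable_tshift.
- move=> i g mg g0; under [RHS]eq_integral do rewrite mule1.
  exact: ge0_integral_shift.
Qed.

(** The Cameron-Martin density: the translate by w of the standard Gaussian law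
    has the density cm w with respect to that law. *)
Definition cm w u : R := \prod_i cm1 (w i 0) (u i 0).

Lemma cm_ge0 w u : 0 <= cm w u.
Proof. by apply: prodr_ge0 => i _; exact: expR_ge0. Qed.

Lemma cmE w u : cm w u = expR (\sum_i (w i 0 * u i 0 - w i 0 ^+ 2 / 2)).
Proof. by rewrite expR_sum. Qed.

Lemma measurable_cm1 (a : R) : measurable_fun setT (cm1 a).
Proof.
by apply: (measurableT_comp (@measurable_expR R)); apply: measurable_funB.
Qed.

Lemma measurable_cm w : measurable_fun setT (cm w).
Proof.
apply: measurable_prod => i _.
exact: (measurableT_comp (measurable_cm1 (w i 0)) (measurable_coordc i)).
Qed.

Lemma gauss_shift w f : measurable_fun setT f -> (forall u, 0 <= f u)%E ->
  (\int[gam]_u f (u + w)%R = \int[gam]_u (f u * (cm w u)%:E))%E.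
Proof.
move=> mf f0.
under eq_integral do rewrite -cmap_shift.
rewrite (@ge0_integral_cmap R (normal_prob (0 : R) 1) N _ (fun i => cm1 (w i 0)))//.
- by move=> i; exact: measurable_tshift.
- by move=> i; exact: measurable_cm1.
- by move=> i t; exact: expR_ge0.
- by move=> i g mg g0; exact: normal_shift.
Qed.

Lemma gauss_setT : gam setT = 1%E.
Proof.
have E : [set: V] = [set u : V | forall i, [set: R] (u i 0)] by apply/seteqP; split.
rewrite /std_gauss E powm_cube//.
rewrite [X in (X ^+ _)%E](_ : _ = 1%E); first by rewrite -EFin_expe expr1n.
exact: (@probability_setT _ _ _ (normal_prob (0 : R) 1)).
Qed.

Lemma lebc_setT : leb setT != 0%E.
Proof.
have E : [set: V] = [set u : V | forall i, [set: R] (u i 0)] by apply/seteqP; split.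
rewrite /lebc E powm_cube// expe_eq0 negb_and; apply/orP; right.
rewrite [X in X != _](_ : _ = +oo%E)//.
by have := @lebesgue_measure_itv R `]-oo, +oo[; rewrite set_itvNyy/=.
Qed.

Lemma gauss_null_shift w (A : set V) : measurable A -> gam A = 0%E ->
  gam ((fun u => u + w) @^-1` A) = 0%E.
Proof.
move=> mA A0.
have mA' : measurable ((fun u : V => u + w) @^-1` A).
  rewrite -[X in measurable X]setTI; have : measurable_fun setT (fun u : V => u + w).
    exact: measurable_colD.
  exact.
rewrite -(setIT (_ @^-1` A)) -integral_indic//.
rewrite (gauss_shift w (f := fun u => (\1_A u)%:E))//; last first.
  exact/measurable_EFinP.
have -> : (\int[gam]_u ((\1_A u)%:E * (cm w u)%:E) =
    \int[gam]_(u in A) (cm w u)%:E)%E.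
  rewrite [RHS]integral_mkcond; apply: eq_integral => u _.
  by rewrite epatch_indic muleC.
apply: null_set_integral => //.
by apply/measurable_funTS/measurable_EFinP; exact: measurable_cm.
Qed.

(** By translation invariance and Tonelli, the set of the xi with x + S xi in B
    is Gaussian null for almost every x, hence for some x.  Translating xi by
    S^-1 x preserves Gaussian null sets, and removes x. *)
Lemma linear_gauss_null (S : 'M[R]_N) : S \in unitmx -> forall B : set V, measurable B ->
  leb B = 0%E -> gam ((fun xi => S *m xi) @^-1` B) = 0%E.
Proof.
move=> uS B mB B0.
pose f (p : V * V) : \bar R := (\1_B (p.1 + S *m p.2))%:E.
have mf : measurable_fun setT f.
  apply/measurable_EFinP; apply: measurableT_comp => //.
  by apply: measurable_colD => //; exact: measurable_colM.
have f0 p : (0 <= f p)%E by rewrite lee_fin.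
have := fubini_tonelli (m1 := powms (@lebesgue_measure R) N)
  (m2 := powms (normal_prob (0 : R) 1) N) f mf f0.
rewrite [RHS](_ : _ = 0%E); last first.
  rewrite (eq_integral (cst 0%E)) ?integral0// => xi _.
  rewrite /f/= (lebc_shift (S *m xi) (f := fun u => (\1_B u)%:E))//.
  - by rewrite integral_indic// setIT.
  - exact/measurable_EFinP.
move=> I0.
have mF := @measurable_fun_fubini_tonelli_F _ _ _ _ _ (powms (normal_prob (0 : R) 1) N) f mf f0.
have [+ _] := ae_eq_integral_abs (powms (@lebesgue_measure R) N) measurableT mF.
have -> : (\int[powms (@lebesgue_measure R) N]_x
    `|fubini_F (powms (normal_prob (0 : R) 1) N) f x| = 0)%E.
  rewrite -[RHS]I0; apply: eq_integral => x _; rewrite gee0_abs//.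
  exact: integral_ge0.
move=> /(_ erefl) ae0.
have [x x0] : exists x, fubini_F (powms (normal_prob (0 : R) 1) N) f x = 0%E.
  apply: contrapT => /forallNP nx; case: ae0 => A [mA A0 sA].
  have : A = setT.
    by apply/seteqP; split => // x _; apply: sA => /= /(_ I); exact: nx.
  by move=> AT; move: A0 lebc_setT; rewrite AT => -> /eqP.
pose A := [set xi : V | B (x + S *m xi)].
have mA : measurable A.
  rewrite -[X in measurable X]setTI; have : measurable_fun setT (fun xi : V => x + S *m xi).
    by apply: measurable_colD => //; exact: measurable_colM.
  exact.
have A0 : gam A = 0%E.
  by rewrite -x0 /fubini_F /f/= -(setIT A) -integral_indic.
rewrite -(gauss_null_shift (- (invmx S *m x)) mA A0); congr (gam _).
apply/seteqP; split => xi /=; rewrite /A/= mulmxDr mulmxN mulKVmx// addrCA subrr addr0 //.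
Qed.

End translations.

(** * Densities of image measures *)

Section radon_nikodym_density.
Context d (Y : measurableType d) (R : realType).
Variable m : {sigma_finite_measure set Y -> \bar R}.

Lemma exists_density (nu : {finite_measure set Y -> \bar R}) :
  (forall A, measurable A -> m A = 0%E -> nu A = 0%E) ->
  exists f, is_density m nu f.
Proof.
move=> dom; have /radon_nikodym_sigma_finite[f [f0 ffin fi fE]] : nu `<< m.
  by apply/null_content_dominatesP.
exists (fine \o f); split.
- by apply: measurableT_comp => //; exact: measurable_int fi.
- by move=> x; exact: fine_ge0.
- by move=> A mA; rewrite fE//; apply: eq_integral => x _ /=; rewrite fineK.
Qed.

End radon_nikodym_density.

Section image_density_section.
Context d1 d2 (X : measurableType d1) (Y : measurableType d2) (R : realType).
Variable P : {measure set X -> \bar R}.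
Variable m : {sigma_finite_measure set Y -> \bar R}.
Variable T : X -> Y.
Hypothesis mT : measurable_fun setT T.
Hypothesis nonsing : forall B, measurable B -> m B = 0%E -> P (T @^-1` B) = 0%E.

Let mpre A : measurable A -> measurable (T @^-1` A).
Proof. by move=> mA; rewrite -[X in measurable X]setTI; exact: mT. Qed.

(** The signed measure F dm is the image under T of e dP. *)
Definition image_density (e : X -> R) (F : Y -> R) := [/\ L1 P e, L1 m F &
  forall A, measurable A -> \int[m]_(y in A) F y = \int[P]_(x in T @^-1` A) e x].

Lemma RintS_L1 d (Z : measurableType d) (mu : {measure set Z -> \bar R}) A f :
  measurable A -> L1 mu f -> mu.-integrable A (EFin \o f).
Proof. by move=> mA lf; apply: integrableS lf. Qed.

Lemma RintS_comb d (Z : measurableType d) (mu : {measure set Z -> \bar R}) A c f g :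
  measurable A -> L1 mu f -> L1 mu g ->
  \int[mu]_(x in A) (f x + c * g x) =
  \int[mu]_(x in A) f x + c * \int[mu]_(x in A) g x.
Proof.
move=> mA lf lg; rewrite RintegralD//.
- by rewrite RintegralZl//; exact: RintS_L1.
- exact: RintS_L1.
- by apply: RintS_L1 => //; exact: L1Z.
Qed.

Lemma image_density_comb c e e' F F' : image_density e F -> image_density e' F' ->
  image_density (fun x => e x + c * e' x) (fun y => F y + c * F' y).
Proof.
move=> [le lF eF] [le' lF' eF']; split.
- by apply: L1D => //; exact: L1Z.
- by apply: L1D => //; exact: L1Z.
- by move=> A mA; rewrite !RintS_comb ?eF ?eF'//; exact: mpre.
Qed.

Lemma image_density_int e F : image_density e F -> \int[m]_y F y = \int[P]_x e x.
Proof. by move=> [_ _ /(_ _ measurableT)]. Qed.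

Lemma Rint_split d (Z : measurableType d) (mu : {measure set Z -> \bar R}) A f :
  measurable A -> L1 mu f ->
  \int[mu]_x f x = \int[mu]_(x in A) f x + \int[mu]_(x in ~` A) f x.
Proof.
move=> mA lf; rewrite -Rintegral_setU//.
- by rewrite setUv.
- exact: measurableC.
- by rewrite setUv.
- by apply/disj_set2P; rewrite setICr.
Qed.

(** The integrals of F over the sets where F >= 0 and where F < 0 are integrals
    of e over two disjoint sets.  Together with [image_density_comb], this
    transports L1 estimates on a family of functions e to the densities F. *)
Lemma image_density_nrm e F : image_density e F -> nrm m F <= nrm P e.
Proof.
move=> [le lF eF].
have mF := L1_meas lF.
pose A := [set y | 0 <= F y].
have mA : measurable A.
  rewrite (_ : A = F @^-1` `[0, +oo[); last first.
    by apply/seteqP; split => y; rewrite /A/= in_itv/= andbT.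
  by rewrite -[X in measurable X]setTI; apply: mF.
have lN B : measurable B -> P.-integrable (T @^-1` B) (EFin \o e).
  by move=> mB; apply: RintS_L1 => //; exact: mpre.
rewrite /nrm (Rint_split mA (L1_abs lF)) (Rint_split (mpre mA) (L1_abs le)).
apply: lerD.
  rewrite (_ : \int[m]_(y in A) `|F y| = \int[m]_(y in A) F y).
    rewrite eF//; apply: le_trans (ler_norm _) _.
    by apply: le_normr_Rintegral; [exact: mpre|exact: lN].
  by apply: eq_Rintegral => y /set_mem Ay; rewrite ger0_norm.
have mCA := measurableC mA.
rewrite (_ : \int[m]_(y in ~` A) `|F y| = - \int[m]_(y in ~` A) F y).
  rewrite eF//; apply: le_trans (ler_norm _) _; rewrite normrN.
  exact: (le_normr_Rintegral (mpre mCA) (lN _ mCA)).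
rewrite -mulN1r -RintegralZl//; last exact: RintS_L1.
apply: eq_Rintegral => y /set_mem Ay; rewrite mulN1r ltr0_norm// ltNge.
by apply/negP.
Qed.

(** The norm of F is at most that of e, which is the integral of e, hence of F:
    so `|F| and F have the same integral. *)
Lemma image_density_ge0 e F : image_density e F -> (forall x, 0 <= e x) ->
  \forall y \ae m, 0 <= F y.
Proof.
move=> eF e0; have [le lF _] := eF.
have : \forall y \ae m, `|F y| - F y = 0.
  apply: nrm_eq0; first by apply: L1B => //; exact: L1_abs.
  rewrite ge0_nrm; last by move=> u; rewrite subr_ge0 ler_norm.
  rewrite RintB//; last exact: L1_abs.
  by rewrite (image_density_int eF) -(ge0_nrm _ e0) subr_le0; exact: image_density_nrm.
by apply: filterS => y /subr0_eq <-.
Qed.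

Lemma image_density_le e e' F F' : image_density e F -> image_density e' F' ->
  (forall x, e x <= e' x) ->
  \forall y \ae m, F y <= F' y.
Proof.
move=> eF eF' ee; have := image_density_ge0 (image_density_comb (-1) eF' eF).
have H x : 0 <= e' x + -1 * e x by rewrite mulN1r subr_ge0.
by move=> /(_ H); apply: filterS => y; rewrite mulN1r subr_ge0.
Qed.

Lemma image_density_exists e : L1 P e -> (forall x, 0 <= e x) ->
  exists F, (forall y, 0 <= F y) /\ image_density e F.
Proof.
move=> le e0.
pose nu A := (\int[P]_(x in T @^-1` A) (e x)%:E)%E.
have nu0 : nu set0 = 0%E by rewrite /nu preimage_set0 integral_set0.
have nu_ge0 A : (0 <= nu A)%E by apply: integral_ge0 => x _; rewrite lee_fin.
have nu_add : semi_sigma_additive nu.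
  move=> A mA tA mUA; rewrite /nu preimage_bigcup integral_bigcup//.
  - apply: is_cvg_ereal_nneg_natsum_cond => n _ _.
    by apply: integral_ge0 => x _; rewrite lee_fin.
  - apply/classical_sets.trivIsetP => i j _ _ ij; rewrite -preimage_setI.
    move/classical_sets.trivIsetP : tA => /(_ _ _ I I ij) ->.
    by rewrite preimage_set0.
  - by move=> k; exact: mpre.
  - by apply: RintS_L1 => //; rewrite -preimage_bigcup; exact: mpre.
pose nuM : {measure set Y -> \bar R} :=
  HB.pack nu (isMeasure.Build _ _ _ nu nu0 nu_ge0 nu_add).
have nu_fin : fin_num_fun nuM.
  move=> A mA; apply: integrable_fin_num; first exact: mpre.
  by apply: RintS_L1 => //; exact: mpre.
pose nuF : {finite_measure set Y -> \bar R} :=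
  HB.pack (Measure.sort nuM) (Measure_isFinite.Build _ _ _ nuM nu_fin).
have [A mA mA0|F [mF F0 FE]] := @exists_density _ _ _ m nuF.
  apply: null_set_integral; [exact: mpre| |exact: nonsing].
  by apply/measurable_funTS/measurable_EFinP; exact: L1_meas le.
have lF : L1 m F.
  apply: L1P => //; under eq_integral do rewrite ger0_norm//.
  by rewrite FE// ltey_eq nu_fin.
exists F; split => //; split => // A mA.
by rewrite /Rintegral FE.
Qed.

Lemma image_density_lim (e : X -> R) (F : Y -> R) (a : nat -> R)
    (en : nat -> X -> R) (Fn : nat -> Y -> R) :
  L1 P e -> L1 m F -> (forall n, image_density (en n) (Fn n)) ->
  (forall n, nrm P (fun x => e x - en n x) <= a n) ->
  (forall n, nrm m (fun y => F y - Fn n y) <= a n) ->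
  a n @[n --> \oo] --> (0 : R) -> image_density e F.
Proof.
move=> le lF eF ea Fa a0; split => // A mA; apply/eqP.
rewrite -subr_eq0 -normr_le0.
have small d (Z : measurableType d) (mu : {measure set Z -> \bar R}) B f g :
    measurable B -> L1 mu f -> L1 mu g ->
    `|\int[mu]_(x in B) f x - \int[mu]_(x in B) g x| <= nrm mu (fun x => f x - g x).
  move=> mB lf lg; have lfg := L1B lf lg.
  rewrite -RintegralB//; try exact: RintS_L1.
  apply: le_trans (le_normr_Rintegral mB (RintS_L1 mB lfg)) _.
  rewrite /nrm (Rint_split mB (L1_abs lfg)) lerDl.
  by apply: Rintegral_ge0.
have h n : `|\int[m]_(y in A) F y - \int[P]_(x in T @^-1` A) e x| <= a n + a n.
  have [len lFn E] := eF n.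
  rewrite [X in `|X|](_ : _ = (\int[m]_(y in A) F y - \int[m]_(y in A) Fn n y) -
    (\int[P]_(x in T @^-1` A) e x - \int[P]_(x in T @^-1` A) en n x)).
    apply: le_trans (ler_normB _ _) _; apply: lerD.
      exact: le_trans (small _ _ _ _ _ _ mA lF lFn) (Fa n).
    exact: le_trans (small _ _ _ _ _ _ (mpre mA) le len) (ea n).
  by rewrite E//; ring.
have c2 : a n + a n @[n --> \oo] --> (0 : R).
  by rewrite -[X in _ --> X](addr0 (0 : R)); exact: cvgD.
have <- : limn (fun n => a n + a n) = 0 by apply/cvg_lim.
apply: limr_ge; first by apply/cvg_ex; exists 0.
exact: nearW.
Qed.

End image_density_section.

(** * Jointly measurable limits in L1 *)

Section joint_limit.
Context d1 d2 (Z : measurableType d1) (Y : measurableType d2) (R : realType).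
Variable m : {sigma_finite_measure set Y -> \bar R}.

(** Limits in L1 taken for each z separately are defined up to null sets that
    depend on z.  A geometric rate makes the series of the increments converge
    absolutely almost everywhere, and [sumfun] then gives a version of the limit
    that is measurable in (z, y). *)
Lemma joint_limit (F : nat -> Z -> Y -> R) (C : R) :
  (forall n, jmeas (F n)) -> (forall n z, L1 m (F n z)) ->
  (forall n z, nrm m (fun y => F n.+1 z y - F n z y) <= C * 2^-1 ^+ n) ->
  exists G, [/\ jmeas G, forall z, L1 m (G z) &
    forall n z, nrm m (fun y => G z y - F n z y) <= 2 * C * 2^-1 ^+ n].
Proof.
move=> mF lF FC.
have C0 : 0 <= C.
  by have := FC 0%N point; rewrite expr0 mulr1; apply: le_trans; exact: nrm_ge0.
pose f n (p : Z * Y) := F n.+1 p.1 p.2 - F n p.1 p.2.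
have mf n : measurable_fun setT (f n).
  by apply: measurable_funB; exact: mF.
pose G z y := F 0%N z y + sumfun f (z, y).
have sumE z y : sumfun f (z, y) = sumfun (fun n y => F n.+1 z y - F n z y) y by [].
have lf z n : L1 m (fun y => F n.+1 z y - F n z y) by exact: L1B.
have tail z n p : \sum_(n <= k < p) nrm m (fun y => F k.+1 z y - F k z y) <=
    2 * C * 2^-1 ^+ n.
  apply: (@le_trans _ _ (\sum_(n <= k < p) C * 2^-1 ^+ k)); first exact: ler_sum.
  have -> : 2 * C = C / (1 - 2^-1) by field.
  exact: (geo_tail n p (half01 R) C0).
have cS z := L1_complete (lf z) (tail z).
exists G; split.
- apply: measurable_funD; first exact: mF.
  by apply: (measurableT_comp (measurable_sumfun mf)) => /=; apply: measurable_fun_pair.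
- by move=> z; apply: L1D => //; exact: (cS z).1.
- move=> n z; apply: le_trans ((cS z).2 n); rewrite le_eqVlt; apply/orP; left.
  apply/eqP; congr nrm; apply/funext => y; rewrite /G sumE.
  rewrite -(big_mkord xpredT (fun k => F k.+1 z y - F k z y)) telescope_sumr//.
  ring.
Qed.

End joint_limit.

(** * Differentiability in L1 of the translated Gaussian densities *)

Section expR_bounds.
Context (R : realType).
Implicit Types s q z : R.

Lemma expR_taylor1 s : `|expR s - 1 - s| <= s ^+ 2 * expR `|s|.
Proof.
have h1 := expR_ge1Dx s; have h2 := expR_ge1Dx (- s).
have e0 := expR_gt0 s; have e1 : expR s * expR (- s) = 1.
  by rewrite -expRD subrr expR0.
rewrite ger0_norm; last lra.
have k1 : expR s * (1 - s) <= 1.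
  by rewrite -[leRHS]e1 ler_wpM2l ?(ltW e0)//; lra.
have [s0|/ltW s0] := leP 0 s.
  rewrite ger0_norm//; have : s * (expR s - 1) <= s * (s * expR s).
    by rewrite ler_wpM2l//; lra.
  by rewrite expr2; lra.
rewrite ler0_norm//; apply: (@le_trans _ _ (s ^+ 2 * 1)); last first.
  by rewrite ler_wpM2l ?sqr_ge0// -expR0 ler_expR oppr_ge0.
have k2 : expR s <= 1 by rewrite -expR0 ler_expR.
have : - s * (1 - expR s) <= - s * (- s) by rewrite ler_wpM2l ?oppr_ge0//; lra.
by rewrite expr2; nra.
Qed.

Lemma expR_sub_bound s q : 0 <= q -> `|expR (s - q) - expR s| <= q * expR s.
Proof.
move=> q0; have h := expR_ge1Dx (- q); have e0 := expR_gt0 s.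
rewrite expRD; have : expR (- q) <= 1 by rewrite -expR0 ler_expR; lra.
by move=> h1; rewrite ler0_norm; nra.
Qed.

Lemma sqr_le_expR z : 0 <= z -> z ^+ 2 <= 4 * expR z.
Proof.
move=> z0; have h := expR_ge1Dx (z / 2).
have -> : expR z = expR (z / 2) ^+ 2 by rewrite -expRM_natl; congr expR; field.
nra.
Qed.

End expR_bounds.

Section colvec_norm.
Context (R : realType) (N : nat).
Implicit Types a v : 'cV[R]_N.

Lemma coord_le_norm a i : `|a i 0| <= `|a|.
Proof.
rewrite /Num.Def.normr/= mx_normrE.
exact: (le_bigmax _ (fun ij : 'I_N * 'I_1 => `|a ij.1 ij.2|) (i, 0)).
Qed.

Lemma norm_le_coord a x : 0 <= x -> (forall i, `|a i 0| <= x) -> `|a| <= x.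
Proof.
move=> x0 h; rewrite /Num.Def.normr/= mx_normrE.
by apply: bigmax_le => // -[i j] _ /=; rewrite ord1.
Qed.

Lemma norm_mulmx_le (A : 'M[R]_N) : exists2 B, 0 <= B & forall v, `|A *m v| <= B * `|v|.
Proof.
exists (\sum_i \sum_j `|A i j|).
  by apply: sumr_ge0 => i _; apply: sumr_ge0.
move=> v; apply: norm_le_coord.
  by rewrite mulr_ge0//; apply: sumr_ge0 => i _; apply: sumr_ge0.
move=> i; rewrite mxE; apply: le_trans (ler_norm_sum _ _ _) _.
apply: (@le_trans _ _ ((\sum_j `|A i j|) * `|v|)).
  rewrite mulr_suml; apply: ler_sum => j _; rewrite normrM ler_wpM2l//.
  exact: coord_le_norm.
apply: ler_wpM2r => //; rewrite [leRHS](bigD1 i)//= lerDl.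
by apply: sumr_ge0 => k _; apply: sumr_ge0.
Qed.

End colvec_norm.

Section gaussian_family.
Context (R : realType) (N : nat).
Local Notation V := 'cV[R]_N.
Local Notation gam := (@std_gauss R N).
Implicit Types (u w a z v : V).

Definition ell a u : R := \sum_i a i 0 * u i 0.

(** The derivative of w -> cm w at w, in the direction a. *)
Definition dcm w a u : R := ell a (u - w) * cm w u.

Lemma cm_add w a u : cm (w + a) u = cm w u * cm a (u - w).
Proof.
rewrite !cmE -expRD; congr expR; rewrite -big_split/=; apply: eq_bigr => i _.
by rewrite !mxE; field.
Qed.

Lemma cm0 u : cm 0 u = 1.
Proof. by rewrite cmE big1 ?expR0// => i _; rewrite mxE expr0n/=; ring. Qed.

Lemma measurable_ell a : measurable_fun setT (ell a).
Proof.
apply: measurable_sum => i; apply: measurable_funM => //.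
exact: measurable_coordc.
Qed.

Lemma ell_comb (c : R) a b u : ell (c *: a + b) u = c * ell a u + ell b u.
Proof.
rewrite /ell mulr_sumr -big_split/=; apply: eq_bigr => i _.
by rewrite !mxE; ring.
Qed.

Lemma int_cm w : (\int[gam]_u (cm w u)%:E = 1)%E.
Proof.
transitivity (\int[gam]_u (cst 1%E (u + w)%R : \bar R))%E.
  rewrite (gauss_shift w (f := cst 1%E))//.
  by apply: eq_integral => u _; rewrite mul1e.
by rewrite integral_cst// mul1e; exact: gauss_setT.
Qed.

Lemma cm_L1 w : L1 gam (cm w).
Proof.
apply: L1P; first exact: measurable_cm.
under eq_integral do rewrite ger0_norm ?cm_ge0//.
by rewrite int_cm ltry.
Qed.

Lemma Rint_cm w : \int[gam]_u cm w u = 1.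
Proof. by rewrite /Rintegral int_cm. Qed.

Lemma nrm_cm w : nrm gam (cm w) = 1.
Proof. by rewrite ge0_nrm ?Rint_cm// => u; exact: cm_ge0. Qed.

(** The map g -> g (. - w) cm w is an isometry of L1.  Through [cm_add] it reduces
    estimates at w to estimates at 0, and makes them uniform in w. *)
Lemma cm_shift_L1 w g : L1 gam g ->
  L1 gam (fun u => g (u - w) * cm w u) /\
  nrm gam (fun u => g (u - w) * cm w u) = nrm gam g.
Proof.
move=> lg; have mg := L1_meas lg.
have mgs : measurable_fun setT (fun u => g (u - w)).
  by apply: (measurableT_comp mg); exact: measurable_colD.
have E : (\int[gam]_u `|g (u - w) * cm w u|%:E = \int[gam]_u `|g u|%:E)%E.
  transitivity (\int[gam]_u (`|g ((u + w) - w)|%:E))%E; last first.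
    by apply: eq_integral => u _; rewrite addrK.
  rewrite (gauss_shift w (f := fun u => `|g (u - w)|%:E))//.
    by apply: eq_integral => u _; rewrite -EFinM normrM (ger0_norm (cm_ge0 w u)).
  by apply/measurable_EFinP; exact: measurableT_comp.
have l : L1 gam (fun u => g (u - w) * cm w u).
  apply: L1P; first by apply: measurable_funM => //; exact: measurable_cm.
  by rewrite E -nrmE ?ltry.
by split => //; apply: EFin_inj; rewrite !nrmE.
Qed.

Definition absum u : R := \sum_i `|u i 0|.

Lemma absum_ge0 u : 0 <= absum u. Proof. exact: sumr_ge0. Qed.

Lemma measurable_absum : measurable_fun setT absum.
Proof.
apply: measurable_sum => i; apply: measurableT_comp => //.
exact: measurable_coordc.
Qed.

(** An integrable bound for exp (2 sum_i |u_i|): in the term where s gives the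
    signs of the coordinates of u, the Cameron-Martin density and the constant
    exp (2 N) combine to this very value. *)
Definition gmajorant u : R :=
  \sum_(s : {ffun 'I_N -> bool}) expR (2 * N%:R) * cm (\col_i (2 * (-1) ^+ s i)) u.

Lemma gmajorant_L1 : L1 gam gmajorant.
Proof. by apply: L1_sum => s; apply: L1Z; exact: cm_L1. Qed.

Lemma expR_absum_le u : expR (2 * absum u) <= gmajorant u.
Proof.
(* the signs of the coordinates of u, as exponents of -1 *)
pose s := [ffun i => (u i 0 < 0)%R].
rewrite /gmajorant (bigD1 s)//=; set rest := (X in _ <= _ + X).
have r0 : 0 <= rest.
  by apply: sumr_ge0 => t _; rewrite mulr_ge0 ?expR_ge0 ?cm_ge0.
suff -> : expR (2 * absum u) =
    expR (2 * N%:R) * cm (\col_i (2 * (-1) ^+ s i)) u by rewrite lerDl.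
rewrite cmE -expRD; congr expR.
have -> : N%:R = \sum_(i < N) 1 :> R by rewrite sumr_const card_ord.
rewrite /absum !mulr_sumr -big_split/=; apply: eq_bigr => i _.
rewrite !mxE ffunE exprMn sqrr_sign; case: ltP => h; rewrite /= ?expr1 ?expr0.
  by rewrite ltr0_norm//; field.
by rewrite ger0_norm//; field.
Qed.

Lemma ell_le a u : `|ell a u| <= `|a| * absum u.
Proof.
apply: le_trans (ler_norm_sum _ _ _) _; rewrite /absum mulr_sumr.
by apply: ler_sum => i _; rewrite normrM ler_wpM2r// coord_le_norm.
Qed.

Lemma absum_le_gmajorant u : absum u <= gmajorant u.
Proof.
apply: le_trans (expR_absum_le u); have := absum_ge0 u.
by have := expR_ge1Dx (2 * absum u); lra.
Qed.

Lemma ell_L1 a : L1 gam (ell a).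
Proof.
apply: (le_L1 (measurable_ell a) (L1Z `|a| gmajorant_L1)) => u.
by apply: le_trans (ell_le a u) _; rewrite ler_wpM2l// absum_le_gmajorant.
Qed.

Lemma nrm_ell_le a : nrm gam (ell a) <= nrm gam gmajorant * `|a|.
Proof.
have h0 u : 0 <= gmajorant u by apply: le_trans (absum_ge0 u) (absum_le_gmajorant u).
rewrite (ge0_nrm _ h0) mulrC -(RintZ _ gmajorant_L1).
apply: le_nrm; [exact: ell_L1|exact: L1Z gmajorant_L1|] => u.
by apply: le_trans (ell_le a u) _; rewrite ler_wpM2l// absum_le_gmajorant.
Qed.

(** The exponent of cm a u is the linear form ell a u minus a term of order
    |a| ^ 2.  Expanding the exponential to first order leaves remainders which,
    for |a| <= 1, are at most |a| ^ 2 exp (2 sum_i |u_i|) up to a constant. *)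
Lemma cm_taylor0 a u : `|a| <= 1 ->
  `|cm a u - 1 - ell a u| <= `|a| ^+ 2 * ((N%:R + 4) * gmajorant u).
Proof.
move=> a1; set t := `|a| in a1 *; have t0 : 0 <= t by exact: normr_ge0.
pose q := \sum_i a i 0 ^+ 2 / 2.
have q0 : 0 <= q by apply: sumr_ge0 => i _; rewrite divr_ge0// sqr_ge0.
have qN : q <= N%:R * t ^+ 2.
  have -> : N%:R = \sum_(i < N) 1 :> R by rewrite sumr_const card_ord.
  rewrite /q mulr_suml; apply: ler_sum => i _; rewrite mul1r.
  have := coord_le_norm a i; rewrite -/t => h.
  have : a i 0 ^+ 2 <= t ^+ 2.
    by rewrite -(real_normK (num_real (a i 0))) lerXn2r ?nnegrE.
  have := sqr_ge0 t; lra.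
have -> : cm a u = expR (ell a u - q).
  by rewrite cmE; congr expR; rewrite /ell /q -sumrB.
have Z0 := absum_ge0 u; have hZ := expR_absum_le u; have sZ := ell_le a u.
move: (ell a u) sZ => s; rewrite -/t => sZ.
set Z := absum u in Z0 hZ sZ *.
have sZ1 : `|s| <= Z by apply: le_trans sZ _; rewrite ler_piMl.
have es : expR s <= expR Z by rewrite ler_expR (le_trans (ler_norm s)).
have esn : expR `|s| <= expR Z by rewrite ler_expR.
have e1 : 1 <= expR Z by rewrite -expR0 ler_expR.
have e2 : expR (2 * Z) = expR Z * expR Z by rewrite -expRD; congr expR; ring.
have h1 := expR_taylor1 s; have h2 := expR_sub_bound s q0.
have h3 := sqr_le_expR Z0.
apply: (@le_trans _ _ (`|expR (s - q) - expR s| + `|expR s - 1 - s|)).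
  apply: le_trans (ler_normD _ _); rewrite le_eqVlt; apply/orP; left; apply/eqP.
  by congr (`|_|); ring.
apply: le_trans (lerD h2 h1) _.
have s2 : s ^+ 2 <= t ^+ 2 * Z ^+ 2.
  by rewrite -exprMn -(real_normK (num_real s)) lerXn2r ?nnegrE// mulr_ge0.
have N0 : 0 <= N%:R :> R by [].
have t2 := sqr_ge0 t.
have A : q * expR s <= N%:R * t ^+ 2 * expR (2 * Z).
  apply: ler_pM => //.
  by apply: le_trans es _; rewrite e2; nra.
have B : s ^+ 2 * expR `|s| <= t ^+ 2 * (4 * expR (2 * Z)).
  apply: (@le_trans _ _ ((t ^+ 2 * Z ^+ 2) * expR Z)).
    by apply: ler_pM => //; exact: sqr_ge0.
  by rewrite e2 -mulrA ler_wpM2l// mulrA ler_wpM2r// expR_ge0.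
apply: le_trans (lerD A B) _.
have -> : N%:R * t ^+ 2 * expR (2 * Z) + t ^+ 2 * (4 * expR (2 * Z)) =
  t ^+ 2 * ((N%:R + 4) * expR (2 * Z)) by ring.
by rewrite ler_wpM2l// ler_wpM2l// addr_ge0.
Qed.

Lemma dcm_L1 w a : L1 gam (dcm w a).
Proof. exact: (cm_shift_L1 w (ell_L1 a)).1. Qed.

Lemma dcm_nrm w a : nrm gam (dcm w a) <= nrm gam gmajorant * `|a|.
Proof. by rewrite (cm_shift_L1 w (ell_L1 a)).2 nrm_ell_le. Qed.

(** For |a| <= 1 this is the expansion at 0, translated by w.  For |a| > 1 the
    three terms are bounded separately, since |a| <= |a| ^ 2. *)
Lemma cm_taylor : exists2 C, 0 <= C & forall w a,
  nrm gam (fun u => cm (w + a) u - cm w u - dcm w a u) <= C * `|a| ^+ 2.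
Proof.
have h0 u : 0 <= gmajorant u by apply: le_trans (absum_ge0 u) (absum_le_gmajorant u).
have C0 : 0 <= (N%:R + 4) * nrm gam gmajorant by rewrite mulr_ge0 ?addr_ge0 ?nrm_ge0.
exists (2 + nrm gam gmajorant + (N%:R + 4) * nrm gam gmajorant).
  by rewrite !addr_ge0 ?nrm_ge0.
move=> w a.
have l1 : L1 gam (fun u => cm (w + a) u - cm w u) by apply: L1B; exact: cm_L1.
have [a1|a1] := lerP `|a| 1; last first.
  apply: le_trans (nrmB l1 (dcm_L1 w a)) _.
  apply: le_trans (lerD (nrmB (cm_L1 _) (cm_L1 _)) (dcm_nrm w a)) _.
  rewrite !nrm_cm; have H := nrm_ge0 gam gmajorant.
  have t1 : `|a| <= `|a| ^+ 2 by rewrite expr2 ler_peMl// ltW.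
  have t2 : nrm gam gmajorant * `|a| <= nrm gam gmajorant * `|a| ^+ 2 by rewrite ler_wpM2l.
  have t3 : 0 <= (N%:R + 4) * nrm gam gmajorant * `|a| ^+ 2 by rewrite mulr_ge0 ?sqr_ge0.
  lra.
pose g u := cm a u - 1 - ell a u.
have lg : L1 gam g.
  apply: L1B (ell_L1 a); apply: L1B (cm_L1 a) _.
  by have := cm_L1 0; congr L1; apply/funext => u; rewrite cm0.
rewrite (_ : (fun u => _) = (fun u => g (u - w) * cm w u)); last first.
  by apply/funext => u; rewrite cm_add /g /dcm; ring.
rewrite (cm_shift_L1 w lg).2.
apply: (@le_trans _ _ (`|a| ^+ 2 * ((N%:R + 4) * nrm gam gmajorant))); last first.
  rewrite mulrC ler_wpM2r ?sqr_ge0// lerDr addr_ge0 ?nrm_ge0//.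
rewrite (ge0_nrm _ h0) -(RintZ _ gmajorant_L1) -(RintZ _ (L1Z _ gmajorant_L1)).
apply: le_nrm lg _ _; first by do 2 apply: L1Z; exact: gmajorant_L1.
by move=> u; exact: cm_taylor0.
Qed.

Lemma cm_lip : exists2 C, 0 <= C & forall w a,
  nrm gam (fun u => cm (w + a) u - cm w u) <= C * `|a|.
Proof.
have [C C0 HC] := cm_taylor.
have H0 := nrm_ge0 gam gmajorant.
exists (2 + C + nrm gam gmajorant); first by rewrite !addr_ge0.
move=> w a; have a0 := normr_ge0 a.
have l1 : L1 gam (fun u => cm (w + a) u - cm w u) by apply: L1B; exact: cm_L1.
have [a1|a1] := lerP `|a| 1; last first.
  apply: le_trans (nrmB (cm_L1 _) (cm_L1 _)) _.
  rewrite !nrm_cm; nra.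
rewrite (_ : (fun u => _) = (fun u => (cm (w + a) u - cm w u - dcm w a u) + dcm w a u)).
  apply: le_trans (nrmD (L1B l1 (dcm_L1 w a)) (dcm_L1 w a)) _.
  apply: le_trans (lerD (HC w a) (dcm_nrm w a)) _.
  have t1 : C * `|a| ^+ 2 <= C * `|a| by rewrite ler_wpM2l// expr2 ler_piMl.
  lra.
by apply/funext => u; rewrite subrK.
Qed.

(** A positive lower bound common to all cm w with |w| <= r, from which the Doeblin
    minorant of the transition kernels is made. *)
Definition gminorant (r : R) u : R := expR (- (r * absum u + N%:R * r ^+ 2)).

Lemma gminorant_le_cm r w u : 0 <= r -> `|w| <= r -> gminorant r u <= cm w u.
Proof.
move=> r0 wr; rewrite /gminorant cmE ler_expR.
have -> : N%:R = \sum_(i < N) 1 :> R by rewrite sumr_const card_ord.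
rewrite /absum mulr_sumr mulr_suml -big_split -sumrN/=.
apply: ler_sum => i _; have := le_trans (coord_le_norm w i) wr => h.
have h1 : `|w i 0 * u i 0| <= r * `|u i 0| by rewrite normrM ler_wpM2r.
have h2 : w i 0 ^+ 2 <= r ^+ 2.
  by rewrite -(real_normK (num_real (w i 0))) lerXn2r ?nnegrE.
have := ler_norm (- (w i 0 * u i 0)); rewrite normrN => h3.
have := sqr_ge0 (w i 0); lra.
Qed.

Lemma gminorant_L1 r : 0 <= r -> L1 gam (gminorant r).
Proof.
move=> r0; apply: (le_L1 _ (cm_L1 0)).
  apply: measurableT_comp => //; apply: measurable_funN; apply: measurable_funD => //.
  by apply: measurable_funM => //; exact: measurable_absum.
move=> u; rewrite ger0_norm ?expR_ge0//; apply: gminorant_le_cm => //.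
by rewrite normr0.
Qed.

Lemma gminorant_mass r : 0 <= r -> 0 < \int[gam]_u gminorant r u.
Proof.
move=> r0; rewrite lt_neqAle; apply/andP; split; last first.
  by apply: Rintegral_ge0 => u _; exact: expR_ge0.
apply/negP => /eqP I0.
have := nrm_eq0 (gminorant_L1 r0); rewrite ge0_nrm -?I0//; last by move=> u; exact: expR_ge0.
move=> /(_ (lexx _)) [A [mA A0 sA]].
have : A = setT.
  apply/seteqP; split => // u _; apply: sA => /= /eqP.
  by rewrite gt_eqF// expR_gt0.
by move=> AT; move: A0; rewrite AT gauss_setT => /eqP; rewrite onee_eq0.
Qed.

End gaussian_family.

(** * The transition density and its derivative *)

Lemma measurable_countable_cases d d' (X : measurableType d) (Y : measurableType d')
    (I : countType) (idx : X -> I) (h : I -> X -> Y) :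
  (forall i, measurable (idx @^-1` [set i])) ->
  (forall i, measurable_fun setT (h i)) ->
  measurable_fun setT (fun x => h (idx x) x).
Proof.
move=> midx mh _ B mB; rewrite setTI.
rewrite (_ : _ @^-1` B = \bigcup_k
  (if unpickle k is Some i then (idx @^-1` [set i]) `&` (h i @^-1` B) else set0)).
  apply: bigcupT_measurable => k; case: (unpickle k) => [i|] //.
  by apply: measurableI => //; rewrite -[X in measurable X]setTI; exact: mh.
apply/seteqP; split => x /=.
  by move=> hx; exists (pickle (idx x)) => //; rewrite pickleK.
by move=> [k _]; case: (unpickle k) => [i|] // [/= ->].
Qed.

Section grid.
Context (R : realType) (N : nat).
Local Notation V := 'cV[R]_N.

(** Together with [grid_point], this sends z to the lower corner of its dyadic cell
    of side 2 ^ -n.  There are countably many corners, so a function evaluated at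
    the corner of z is measurable in z, whatever the function is. *)
Definition grid_index (n : nat) (z : V) : 'cV[int]_N := \col_i Num.floor (2 ^+ n * z i 0).
Definition grid_point (n : nat) (c : 'cV[int]_N) : V := \col_i ((c i 0)%:~R * 2^-1 ^+ n).

Lemma measurable_grid_cell n c : measurable (grid_index n @^-1` [set c]).
Proof.
rewrite (_ : _ @^-1` _ = \bigcap_(i in [set: 'I_N])
  ((fun z : V => (Num.floor (2 ^+ n * z i 0))%:~R : R) @^-1` [set (c i 0)%:~R])); last first.
  apply/seteqP; split => z /=.
    by move=> <- i _ /=; rewrite mxE.
  move=> h; apply/matrixP => i j; rewrite ord1 mxE.
  by have /= /(mulrIz (oner_neq0 _)) := h i I.
apply: fin_bigcap_measurable => // i _; rewrite -[X in measurable X]setTI.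
have : measurable_fun setT (fun z : V => (Num.floor (2 ^+ n * z i 0))%:~R : R).
  apply: (measurableT_comp (@measurable_floorR R)); apply: measurable_funM => //.
  exact: measurable_coordc.
by apply.
Qed.

Lemma grid_dist n z : `|grid_point n (grid_index n z) - z| <= 2^-1 ^+ n.
Proof.
apply: norm_le_coord; first exact: exprn_ge0.
move=> i; rewrite !mxE.
have := Num.Theory.floor_itv (2 ^+ n * z i 0); rewrite intrD => /andP[h1 h2].
have p0 : 0 < 2^-1 ^+ n :> R by rewrite exprn_gt0.
have pp : 2 ^+ n * 2^-1 ^+ n = 1 :> R by rewrite -exprMn divff ?expr1n.
move: (Num.floor _)%:~R h1 h2 => f h1 h2.
have -> : z i 0 = (2 ^+ n * z i 0) * 2^-1 ^+ n by rewrite mulrAC pp mul1r.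
rewrite -mulrBl normrM (ger0_norm (ltW p0)) ler_piMl ?(ltW p0)//.
by rewrite ler_norml; apply/andP; split; lra.
Qed.

End grid.
Arguments grid_point {R N} n c.
Arguments grid_index {R N} n z.

Section smooth_kernel.
Context (R : realType) (N : nat).
Local Notation V := 'cV[R]_N.
Local Notation gam := (@std_gauss R N).
Variable m : {sigma_finite_measure set V -> \bar R}.
Variables (T : V -> V) (A : 'M[R]_N).
Hypothesis mT : measurable_fun setT T.
Hypothesis nonsing : forall B, measurable B -> m B = 0%E -> gam (T @^-1` B) = 0%E.

Let e (z : V) := cm (A *m z).
Let de (z v : V) := dcm (A *m z) (A *m v).
Local Notation pd := (image_density gam m T).

Let e_lip : exists2 C, 0 <= C & forall z v,
  nrm gam (fun u => e (z + v) u - e z u) <= C * `|v|.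
Proof.
have [C C0 HC] := @cm_lip R N; have [B B0 HB] := norm_mulmx_le A.
exists (C * B); first exact: mulr_ge0.
move=> z v; rewrite /e mulmxDr; apply: le_trans (HC _ _) _.
by rewrite -mulrA ler_wpM2l.
Qed.

Let e_taylor : exists2 C, 0 <= C & forall z v,
  nrm gam (fun u => e (z + v) u - e z u - de z v u) <= C * `|v| ^+ 2.
Proof.
have [C C0 HC] := @cm_taylor R N; have [B B0 HB] := norm_mulmx_le A.
exists (C * B ^+ 2); first by rewrite mulr_ge0 ?sqr_ge0.
move=> z v; rewrite /e /de mulmxDr; apply: le_trans (HC _ _) _.
by rewrite -mulrA ler_wpM2l// -exprMn lerXn2r ?nnegrE ?mulr_ge0.
Qed.

Let de_nrm : exists2 C, 0 <= C & forall z v, nrm gam (de z v) <= C * `|v|.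
Proof.
have [B B0 HB] := norm_mulmx_le A.
exists (nrm gam (@gmajorant R N) * B); first by rewrite mulr_ge0 ?nrm_ge0.
move=> z v; apply: le_trans (dcm_nrm _ _) _.
by rewrite -mulrA ler_wpM2l ?nrm_ge0.
Qed.

Let eL1 z : L1 gam (e z). Proof. exact: cm_L1. Qed.
Let deL1 z v : L1 gam (de z v). Proof. exact: dcm_L1. Qed.

Let de_comb (c : R) z v w u : de z (c *: v + w) u = c * de z v u + de z w u.
Proof. by rewrite /de mulmxDr -scalemxAr /dcm ell_comb; ring. Qed.

Let pd_nrm f F : pd f F -> nrm m F <= nrm gam f.
Proof. by move=> h; apply: (image_density_nrm mT h). Qed.

Let pd_sub f g F G : pd f F -> pd g G -> pd (fun u => f u - g u) (fun y => F y - G y).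
Proof.
move=> pf pg; have := image_density_comb mT (-1) pf pg.
by congr image_density; apply/funext => u; rewrite mulN1r.
Qed.

Let pd_scale c f F : pd f F -> pd (fun u => c * f u) (fun y => c * F y).
Proof.
move=> pf; have := image_density_comb mT (c - 1) pf pf.
by congr image_density; apply/funext => u; ring.
Qed.

Let half_ge0 n : 0 <= 2^-1 ^+ n :> R. Proof. exact: exprn_ge0. Qed.

Let half_cvg (C : R) : C * 2^-1 ^+ n @[n --> \oo] --> (0 : R).
Proof. exact: (geometric_cvg0 C (half01 R)). Qed.

(** The Radon-Nikodym theorem gives a density k z for each z, without any control
    of its dependence on z.  Evaluating k at dyadic points gives jointly
    measurable kernels, and these converge in L1 at a geometric rate since e is
    Lipschitz with values in L1. *)
Lemma kernel_exists : exists kk : V -> V -> R,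
  [/\ jmeas kk, forall z y, 0 <= kk z y & forall z, pd (e z) (kk z)].
Proof.
have /choice[k hk] z : exists F : V -> R, (forall y, 0 <= F y) /\ pd (e z) F.
  by apply: image_density_exists => // u; exact: cm_ge0.
have k0 z y : 0 <= k z y by have [+ _] := hk z; apply.
have kp z : pd (e z) (k z) by have [] := hk z.
have lk z : L1 m (k z) by have [] := kp z.
have [C C0 HC] := e_lip.
pose F n (z : V) y := k (grid_point n (grid_index n z)) y.
have mF n : jmeas (F n).
  apply: (@measurable_countable_cases _ _ _ _ _
    (fun p : V * V => grid_index n p.1) (fun c p => k (grid_point n c) p.2)) => [c|c].
    rewrite -[X in measurable X]setTI.
    have mf : measurable_fun setT (fst : V * V -> V) by exact: measurable_fst.
    exact: (mf measurableT _ (measurable_grid_cell n c)).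
  by apply: (measurableT_comp (L1_meas (lk _))).
have Fk n z : nrm m (fun y => F n z y - k z y) <= C * 2^-1 ^+ n.
  apply: le_trans (pd_nrm (pd_sub (kp _) (kp _))) _.
  have := HC z (grid_point n (grid_index n z) - z); rewrite addrC subrK => /le_trans; apply.
  by rewrite ler_wpM2l// grid_dist.
have [|n z|G [mG lG GF]] := @joint_limit _ _ V V R m F (2 * C) mF.
- by move=> n z; exact: lk.
- apply: le_trans (nrm_dist (lk _) (lk z) (lk _)) _.
  rewrite [X in _ + X <= _]nrmC.
  apply: le_trans (lerD (Fk n.+1 z) (Fk n z)) _.
  rewrite exprS; have := mulr_ge0 C0 (half_ge0 n); lra.
exists (fun z y => `|G z y|); split.
- exact: measurableT_comp.
- by [].
- move=> z; apply: (@image_density_lim _ _ _ _ _ gam m T mT (e z) _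
    (fun n => 5 * C * 2^-1 ^+ n) (fun=> e z) (fun=> k z)) => //.
  + exact: L1_abs.
  + move=> n; rewrite (_ : (fun _ => _) = fun=> 0); last first.
      by apply/funext => u; rewrite subrr.
    by rewrite nrm0 !mulr_ge0.
  + move=> n; apply: (@le_trans _ _ (nrm m (fun y => G z y - k z y))).
      apply: le_nrm; first by apply: L1B => //; exact: L1_abs.
        by apply: L1_abs; exact: L1B.
      by move=> y; rewrite -{1}(ger0_norm (k0 z y)) ler_dist_dist.
    apply: le_trans (nrm_dist (lG z) (lk (grid_point n (grid_index n z))) (lk z)) _.
    have := GF n z; have := Fk n z; rewrite /F => h1 h2; lra.
Qed.

Section derivative.
Variable kk : V -> V -> R.
Hypothesis mkk : jmeas kk.
Hypothesis pkk : forall z, pd (e z) (kk z).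

Let lkk z : L1 m (kk z). Proof. by have [] := pkk z. Qed.

(** The difference quotients with steps 2 ^ -n are jointly measurable, and the
    Taylor estimate makes them converge in L1 at a geometric rate. *)
Let partial_exists (i : 'I_N) : exists Di : V -> V -> R,
  jmeas Di /\ forall z, pd (de z (delta_mx i 0)) (Di z).
Proof.
have [C C0 HC] := e_taylor.
pose dl : V := delta_mx i 0.
have dl1 : `|dl| <= 1.
  apply: norm_le_coord => // j; by rewrite mxE; case: (_ && _); rewrite /= ?normr1 ?normr0.
pose q n z y := 2 ^+ n * (kk (z + 2^-1 ^+ n *: dl) y - kk z y).
pose en n z u := 2 ^+ n * (e (z + 2^-1 ^+ n *: dl) u - e z u).
have mq n : jmeas (q n).
  apply: measurable_funM => //; apply: measurable_funB => //.
  apply: (measurableT_comp mkk (g := fun p : V * V => (p.1 + 2^-1 ^+ n *: dl, p.2))).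
  by apply: measurable_fun_pair => //; exact: measurable_colD.
have pq n z : pd (en n z) (q n z).
  by apply: pd_scale; apply: pd_sub.
have lq n z : L1 m (q n z) by have [] := pq n z.
have len n z : L1 gam (en n z) by have [] := pq n z.
have ed n z : nrm gam (fun u => en n z u - de z dl u) <= C * 2^-1 ^+ n.
  have pp : 2 ^+ n * 2^-1 ^+ n = 1 :> R by rewrite -exprMn divff ?expr1n.
  have lX : L1 gam (fun u => e (z + 2^-1 ^+ n *: dl) u - e z u - de z (2^-1 ^+ n *: dl) u).
    by apply: L1B => //; exact: L1B.
  rewrite (_ : (fun u => _) = (fun u => 2 ^+ n *
     (e (z + 2^-1 ^+ n *: dl) u - e z u - de z (2^-1 ^+ n *: dl) u))); last first.
    apply/funext => u; rewrite -(addr0 (2^-1 ^+ n *: dl)) de_comb.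
    rewrite (_ : de z 0 u = 0) ?addr0; last first.
      by rewrite /de /dcm mulmx0 /ell big1 ?mul0r// => j _; rewrite mxE mul0r.
    by rewrite mulrBr mulrA pp mul1r.
  rewrite nrmZ// ger0_norm ?exprn_ge0//.
  apply: le_trans (ler_wpM2l _ (HC _ _)) _; first exact: exprn_ge0.
  rewrite normrZ (ger0_norm (half_ge0 n)) exprMn.
  have -> : 2 ^+ n * (C * (2^-1 ^+ n ^+ 2 * `|dl| ^+ 2)) =
    C * ((2 ^+ n * 2^-1 ^+ n) * 2^-1 ^+ n * `|dl| ^+ 2) by ring.
  rewrite pp mul1r ler_wpM2l// ler_piMr//.
  by rewrite -(expr1n R 2) lerXn2r// nnegrE.
have [|n z|Di [mDi lDi Dq]] := @joint_limit _ _ V V R m q (2 * C) mq.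
- by [].
- apply: le_trans (pd_nrm (pd_sub (pq n.+1 z) (pq n z))) _.
  apply: le_trans (nrm_dist (len _ _) (deL1 z dl) (len _ _)) _.
  rewrite [X in _ + X <= _]nrmC.
  apply: le_trans (lerD (ed n.+1 z) (ed n z)) _.
  rewrite exprS; have := mulr_ge0 C0 (half_ge0 n); lra.
exists Di; split => // z.
apply: (@image_density_lim _ _ _ _ _ gam m T mT _ _ (fun n => 4 * C * 2^-1 ^+ n)
   (en ^~ z) (q ^~ z)) => //.
- move=> n; rewrite nrmC; apply: le_trans (ed n z) _.
  have := mulr_ge0 C0 (half_ge0 n); lra.
- move=> n; apply: le_trans (Dq n z) _.
  have := mulr_ge0 C0 (half_ge0 n); lra.
Qed.

(** D is assembled from the partial derivatives, so that it is measurable in the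
    three variables, and linear in v at every point y rather than almost
    everywhere. *)
Lemma derivative_exists : exists (D : V -> V -> V -> R) (C : R),
  [/\ measurable_fun [set: V * V * V] (fun p => D p.1.1 p.1.2 p.2) /\ 0 <= C,
      forall z (a : R) v w y, D z (a *: v + w) y = a * D z v y + D z w y,
      forall z v, L1 m (D z v) /\ nrm m (D z v) <= C * `|v| &
      forall z v, nrm m (fun y => kk (z + v) y - kk z y - D z v y) <= C * `|v| ^+ 2].
Proof.
have /choice[Di hDi] := partial_exists.
have mDi i : jmeas (Di i) by have [] := hDi i.
have pDi i z : pd (de z (delta_mx i 0)) (Di i z) by have [_] := hDi i; apply.
pose D z (v : V) y := \sum_i v i 0 * Di i z y.
have pD z v : pd (de z v) (D z v).
  have -> : de z v = (fun u => \sum_i v i 0 * de z (delta_mx i 0) u).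
    apply/funext => u; rewrite {1}(matrix_sum_delta v).
    have -> : \sum_i \sum_j v i j *: delta_mx i j = \sum_i (v i 0 *: delta_mx i 0 : V).
      by apply: eq_bigr => i _; rewrite big_ord1.
    elim: (index_enum 'I_N) => [|i s ih].
      rewrite !big_nil /de /dcm mulmx0 /ell big1 ?mul0r// => j _.
      by rewrite mxE mul0r.
    by rewrite !big_cons de_comb ih.
  rewrite /D; elim: (index_enum 'I_N) => [|i s ih].
    have := pd_sub (pkk z) (pkk z).
    by congr image_density; apply/funext => u; rewrite big_nil subrr.
  have := image_density_comb mT (v i 0) ih (pDi i z).
  by congr image_density; apply/funext => u; rewrite big_cons addrC.
have [C1 C10 HC1] := e_taylor; have [C2 C20 HC2] := de_nrm.
exists D; exists (C1 + C2); split.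
- split; last by rewrite addr_ge0.
  apply: measurable_sum => i; apply: measurable_funM.
    apply: (@measurable_coord _ N _ _ (fun p : V * V * V => p.1.2)).
    by apply: (measurableT_comp (@measurable_snd _ _ V V)).
  apply: (measurableT_comp (mDi i) (g := fun p : V * V * V => (p.1.1, p.2))).
  apply: measurable_fun_pair => //.
  by apply: (measurableT_comp (@measurable_fst _ _ V V)).
- move=> z a v w y; rewrite /D mulr_sumr -big_split/=; apply: eq_bigr => i _.
  by rewrite !mxE; ring.
- move=> z v; split; first by have [] := pD z v.
  apply: le_trans (pd_nrm (pD z v)) _; apply: le_trans (HC2 z v) _.
  by rewrite ler_wpM2r//; lra.
- move=> z v; apply: le_trans (pd_nrm (pd_sub (pd_sub (pkk _) (pkk _)) (pD _ _))) _.
  by apply: le_trans (HC1 z v) _; rewrite ler_wpM2r ?sqr_ge0//; lra.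
Qed.

(** The image density of [gminorant]. *)
Lemma minorant_exists (rad : R) : 0 <= rad -> exists (r : V -> R),
  [/\ L1 m r, 0 < \int[m]_y r y &
      forall z, `|z| <= rad -> \forall y \ae m, r y <= kk z y].
Proof.
move=> rad0; have [B B0 HB] := norm_mulmx_le A.
have Br : 0 <= B * rad by exact: mulr_ge0.
have [r [r0 pr]] := image_density_exists mT nonsing (gminorant_L1 N Br) (fun u => expR_ge0 _).
exists r; split; first by have [] := pr.
  by rewrite (image_density_int pr); exact: gminorant_mass.
move=> z zr; apply: (image_density_le mT pr (pkk z)) => u; apply: gminorant_le_cm => //.
by apply: le_trans (HB z) _; rewrite ler_wpM2l.
Qed.

End derivative.
End smooth_kernel.

(** * The reflected Gaussian noise *)

Section box_measure.
Context (R : realType) (N : nat) (M : gs_model R N).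
Local Notation V := 'cV[R]_N.

Lemma box_cube : box M = [set u : V | forall i, `[Tmin M, Tmax M]%classic (u i 0)].
Proof. by apply/seteqP; split => u h i; have := h i; rewrite /= in_itv. Qed.

Lemma lebc_box : (@lebc R N (box M) < +oo)%E.
Proof.
rewrite box_cube /lebc powm_cube; last exact: measurable_itv.
suff [x E] : exists x : R, (@lebesgue_measure R) `[Tmin M, Tmax M]%classic = x%:E.
  by rewrite [X in (X ^+ _)%E](_ : _ = x%:E)// -EFin_expe ltry.
rewrite lebesgue_measure_itv/=; case: ifP => _; last by exists 0.
by exists (Tmax M - Tmin M); rewrite -EFinD.
Qed.

(** The measure [mbox], under a name that carries its finiteness. *)
Definition mboxs : set V -> \bar R := mbox M.
HB.instance Definition _ := Measure.copy mboxs (mbox M).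

Lemma mboxE (A : set V) :
  mboxs A = ((`|Tmax M - Tmin M| ^- N)%:E * @lebc R N (A `&` box M))%E.
Proof. by []. Qed.

Lemma mbox_fin : fin_num_fun mboxs.
Proof.
move=> A mA; rewrite mboxE; apply: fin_numM => //.
rewrite ge0_fin_numE//; apply: le_lt_trans lebc_box.
apply: le_measure; rewrite ?inE; [|exact: measurable_box|exact: subIsetr].
by apply: measurableI => //; exact: measurable_box.
Qed.
HB.instance Definition _ := Measure_isFinite.Build _ _ _ mboxs mbox_fin.

Lemma mbox_outside : mboxs (~` box M) = 0%E.
Proof. by rewrite mboxE setICl measure0 mule0. Qed.

Hypothesis TT : Tmin M < Tmax M.

Lemma mbox_null A : mboxs A = 0%E -> @lebc R N (A `&` box M) = 0%E.
Proof.
rewrite mboxE => /eqP; rewrite mule_eq0 => /orP[|/eqP//].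
rewrite eqe invr_eq0 expf_eq0 normr_eq0 subr_eq0 => /andP[_ /eqP h].
by move: TT; rewrite h ltxx.
Qed.

Lemma reflect_cmap : Defs.reflect M = cmap (fun=> reflect1 M).
Proof. by []. Qed.

Lemma measurable_reflect : measurable_fun [set: V] (Defs.reflect M).
Proof. by rewrite reflect_cmap; apply: measurable_cmap => _; exact: measurable_reflect1. Qed.

Lemma reflect_box u : box M (Defs.reflect M u).
Proof. by move=> i; rewrite mxE; exact: reflect1_in. Qed.

Lemma reflect_null (A : set V) : measurable A -> mboxs A = 0%E ->
  @lebc R N (Defs.reflect M @^-1` A) = 0%E.
Proof.
move=> mA /mbox_null A0.
rewrite (_ : Defs.reflect M @^-1` A = Defs.reflect M @^-1` (A `&` box M)); last first.
  by apply/seteqP; split => u /= => [Au|[]//]; split => //; exact: reflect_box.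
rewrite reflect_cmap; apply: null_cmap => //.
- exact: measurable_reflect1.
- by move=> B mB B0; exact: reflect1_null.
- by apply: measurableI => //; exact: measurable_box.
Qed.

End box_measure.

Section noise.
Context (R : realType) (N : nat) (M : gs_model R N).
Local Notation V := 'cV[R]_N.
Local Notation gam := (@std_gauss R N).
Hypothesis HM : gs_conditions M.
Variable lambda : R.
Hypothesis lambda0 : 0 < lambda.
Hypothesis Hnoise : loewner_le lambda%:M (noise M *m (noise M)^T).

Definition step_noise : 'M[R]_N := Num.sqrt (dt M) *: noise M.

(** A row vector w with w Sigma = 0 satisfies lambda |w| ^ 2 <= 0. *)
Lemma noise_matrix_unit : noise M \in unitmx.
Proof.
rewrite -row_free_unit -kermx_eq0; apply/eqP/row_matrixP => i.
rewrite row0; set w := row i _.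
have w0 : w *m noise M = 0 by rewrite /w -row_mul mulmx_ker row0.
clearbody w.
have := Hnoise w^T; rewrite trmxK mulmxA w0 !mul0mx mul_mx_scalar -scalemxAl.
rewrite [X in X <= _]mxE [X in _ <= X]mxE pmulr_rle0//.
rewrite mxE => h; apply/rowP => j; rewrite [RHS]mxE; apply/eqP.
rewrite -sqrf_eq0 -[_ == _]andbT.
have pos k : 0 <= w 0 k * w^T k 0 by rewrite mxE -expr2 sqr_ge0.
have : \sum_k w 0 k * w^T k 0 == 0.
  by rewrite eq_le h sumr_ge0.
rewrite psumr_eq0// => /allP/(_ j (mem_index_enum _)) /=.
by rewrite mxE -expr2 => ->.
Qed.

Lemma step_noise_unit : step_noise \in unitmx.
Proof.
rewrite /step_noise unitmxZ ?noise_matrix_unit// unitfE sqrtr_eq0 -ltNge.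
exact: dt_gt0 HM.
Qed.

Lemma step_noiseE : (fun xi : V => Num.sqrt (dt M) *: (noise M *m xi)) = mulmx step_noise.
Proof. by apply/funext => xi; rewrite /step_noise -scalemxAl. Qed.

Lemma measurable_step_noise : measurable_fun [set: V] (mulmx step_noise : V -> V).
Proof. exact: measurable_colM. Qed.

Lemma noise_density_exists : exists q, is_noise_density M q.
Proof.
rewrite /is_noise_density step_noiseE.
have := @image_density_exists _ _ V V R gam (powms (@lebesgue_measure R) N) (mulmx step_noise)
  measurable_step_noise (fun B mB B0 => linear_gauss_null step_noise_unit mB B0)
  (cm 0) (cm_L1 0) (cm_ge0 0).
move=> [q [q0 [_ lq qE]]]; exists q; split => //; first exact: L1_meas lq.
move=> A mA; have mpA : measurable (mulmx step_noise @^-1` A).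
  by rewrite -[X in measurable X]setTI; exact: measurable_step_noise.
have := qE A mA.
rewrite /pushforward => h.
have <- : (\int[gam]_(x in mulmx step_noise @^-1` A) cm 0 x)%:E = gam (mulmx step_noise @^-1` A).
  rewrite (@eq_Rintegral _ _ _ gam _ (fun=> 1)); last by move=> u _; rewrite cm0.
  rewrite Rintegral_cst// mul1r fineK// ge0_fin_numE//.
  apply: le_lt_trans (ltry 1); rewrite -(gauss_setT R N).
  by apply: le_measure; rewrite ?inE.
rewrite -h /Rintegral fineK//.
by apply: integrable_fin_num => //; apply: integrableS lq.
Qed.

Definition fold_noise : V -> V := Defs.reflect M \o mulmx step_noise.

Lemma measurable_fold_noise : measurable_fun setT fold_noise.
Proof. by apply: measurableT_comp; [exact: measurable_reflect|exact: measurable_step_noise]. Qed.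

Lemma fold_noise_null (B : set V) : measurable B -> mboxs M B = 0%E ->
  gam (fold_noise @^-1` B) = 0%E.
Proof.
move=> mB B0; apply: (linear_gauss_null step_noise_unit (B := Defs.reflect M @^-1` B)).
  by rewrite -[X in measurable X]setTI; exact: measurable_reflect.
by apply: reflect_null => //; exact: Tmin_lt_Tmax HM.
Qed.

(** Moving the mean from 0 to z amounts to translating the standard Gaussian
    vector by S^-1 z, where S is the matrix of the noise.  The Cameron-Martin
    density records this translation, and z disappears from the map. *)
Lemma transition_law q z (A : set V) : is_noise_density M q -> measurable A ->
  (pushforward (fun A => \int[@lebc R N]_(x in A) (q (x - z))%:E) (Defs.reflect M) A =
   \int[gam]_(u in fold_noise @^-1` A) (cm (invmx step_noise *m z) u)%:E)%E.
Proof.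
rewrite /is_noise_density step_noiseE => -[mq q0 qE] mA.
have mr : measurable (Defs.reflect M @^-1` A).
  by rewrite -[X in measurable X]setTI; exact: measurable_reflect.
have msub : measurable_fun setT (fun x : V => x - z) by exact: measurable_colD.
have madd : measurable_fun setT (fun x : V => x + z) by exact: measurable_colD.
pose B := (fun x : V => x + z) @^-1` (Defs.reflect M @^-1` A).
have mB : measurable B by rewrite -[X in measurable X]setTI; exact: madd.
transitivity (\int[@lebc R N]_(x in B) (q x)%:E)%E.
  rewrite /pushforward integral_mkcond [RHS]integral_mkcond.
  rewrite -(lebc_shift z)//.
  - apply: eq_integral => x _; rewrite !patchE addrK.
    by rewrite /B; congr (if _ then _ else _); apply/idP/idP => /set_mem/= ?; apply/mem_set.
  - apply/(measurable_restrictT _ mr); apply: measurable_funTS.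
    by apply/measurable_EFinP; exact: measurableT_comp.
  - by move=> x; rewrite patchE; case: ifP => _ //; rewrite lee_fin.
rewrite qE// /pushforward.
have mS : measurable (mulmx step_noise @^-1` B).
  by rewrite -[X in measurable X]setTI; exact: measurable_step_noise.
have mF : measurable (fold_noise @^-1` A).
  by rewrite -[X in measurable X]setTI; exact: measurable_fold_noise.
rewrite -(setIT (mulmx step_noise @^-1` B)) -integral_indic// [RHS]integral_mkcond.
transitivity (\int[gam]_u (\1_(fold_noise @^-1` A) (u + invmx step_noise *m z)%R)%:E)%E.
  apply: eq_integral => u _; rewrite !indicE; congr (_%:R%:E).
  have E : step_noise *m (u + invmx step_noise *m z) = step_noise *m u + z.
    by rewrite mulmxDr mulKVmx// step_noise_unit.
  congr nat_of_bool; apply/idP/idP => /set_mem h; apply/mem_set.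
    change (A (Defs.reflect M (step_noise *m (u + invmx step_noise *m z)))).
    by rewrite E; exact: h.
  change (A (Defs.reflect M (step_noise *m u + z))); rewrite -E; exact: h.
rewrite (gauss_shift (invmx step_noise *m z) (f := fun u => (\1_(fold_noise @^-1` A) u)%:E))//.
  by apply: eq_integral => u _; rewrite epatch_indic muleC.
exact/measurable_EFinP.
Qed.

(** Transition densities are image densities, under a map that does not depend on
    z, of functions that are smooth in z. *)
Lemma transition_densityP q kk : is_noise_density M q ->
  is_transition_density M q kk <->
  [/\ jmeas kk, forall z y, 0 <= kk z y &
      forall z, image_density gam (mboxs M) fold_noise (cm (invmx step_noise *m z)) (kk z)].
Proof.
move=> hq; have mF (A : set V) : measurable A -> measurable (fold_noise @^-1` A).
  by move=> mA; rewrite -[X in measurable X]setTI; exact: measurable_fold_noise.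
split=> [[mkk hk]|[mkk k0 hk]].
  have lk z : L1 (mboxs M) (kk z).
    have [mkz k0 kE] := hk z; apply: L1P => //.
    under eq_integral do rewrite ger0_norm//.
    by rewrite kE// transition_law// int_cm ltry.
  split => //; first by move=> z y; have [_ + _] := hk z; apply.
  move=> z; split => //; first exact: cm_L1.
  move=> A mA; have [_ _ kE] := hk z.
  by rewrite /Rintegral kE// transition_law.
split => // z; have [lc lk kE] := hk z; split => //.
  exact: L1_meas lk.
move=> A mA; rewrite transition_law//.
have i1 : (\int[mboxs M]_(y in A) (kk z y)%:E)%E \is a fin_num.
  by apply: integrable_fin_num => //; exact: RintS_L1.
have i2 : (\int[gam]_(u in fold_noise @^-1` A) (cm (invmx step_noise *m z) u)%:E)%E \is a fin_num.
  by apply: integrable_fin_num; [exact: mF|apply: RintS_L1 => //; exact: mF].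
by rewrite -(fineK i2) -(fineK i1); congr EFin; exact: (kE A mA).
Qed.

End noise.

(** * Measurability and bounds of the drift *)

Lemma locally_lipschitz_continuous (R : realType) (W : normedModType R) (f : W -> R) :
  [locally [lipschitz f x | x in [set: W]]] -> continuous f.
Proof.
move=> H x; have /(_ (conj I I)) [K0 [K0r HK]] := H (x, x).
have [K [Kpos KK]] : exists K, 0 < K /\ K0 < K.
  by exists (Num.max K0 0 + 1); split; have := le_max K0 K0 0; have := le_max 0 K0 0;
    rewrite !lexx ?orbT /=; lra.
have := HK _ KK; rewrite /dominated_by /within /= => -[[U V] /= [Ux Vx] sUV].
apply/cvgrPdist_lt => e e0; near=> y.
have /= := sUV (x, y).
have xU : U x by exact: nbhs_singleton.
have yV : V y by near: y; exact: Vx.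
move=> /(_ (conj xU yV) (conj I I)) /le_lt_trans; apply.
rewrite -ltr_pdivlMl//; near: y.
move/cvgrPdist_lt : (@cvg_id _ (nbhs x)); apply.
by rewrite mulr_gt0// invr_gt0.
Unshelve. all: by end_near. Qed.

Section colvec_continuity.
Context (R : realType) (N : nat).
Local Notation V := 'cV[R]_N.

(** The sigma-algebra of column vectors is generated by the coordinates, not by
    the open sets.  A continuous function is the limit of its values at dyadic
    points. *)
Lemma continuous_measurable_colvec (f : V -> R) : continuous f -> measurable_fun setT f.
Proof.
move=> cf; apply: (@measurable_fun_cvg _ _ _ _ (fun n x => f (grid_point n (grid_index n x)))).
  move=> n; apply: (@measurable_countable_cases _ _ _ _ _ (grid_index n)
    (fun c _ => f (grid_point n c))) => c.
    exact: measurable_grid_cell.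
  exact: measurable_cst.
move=> x _; apply: (cvg_comp _ f); last exact: cf.
apply/cvgrPdist_le => e e0; near=> n.
rewrite distrC; apply: le_trans (grid_dist n x) _.
near: n; have h := geometric_cvg0 1 (half01 R).
move/cvgrPdist_le : h => /(_ e e0); apply: filterS => n.
by rewrite mul1r sub0r normrN ger0_norm// exprn_ge0.
Unshelve. all: by end_near. Qed.

Lemma continuous_bounded_box (f : V -> R) (a b : R) : continuous f ->
  exists B, forall u : V, (forall i, a <= u i 0 <= b) -> `|f u| <= B.
Proof.
(* on row vectors, a product of compact segments is compact *)
move=> cf; pose g (v : 'rV[R]_N) := f v^T.
have ctr : continuous (trmx : 'rV[R]_N -> V).
  move=> v U /nbhs_ballP[e e0 sU]; apply/nbhs_ballP; exists e => // w [_ vw].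
  by apply: sU; split => // i j; rewrite !mxE; exact: vw.
have cg : continuous g by move=> v; apply: continuous_comp; [exact: ctr|exact: cf].
have cpt : compact [set v : 'rV[R]_N | forall i, `[a, b]%classic (v 0 i)].
  by apply: (@rV_compact _ _ (fun=> `[a, b]%classic)) => i; exact: segment_compact.
have := continuous_compact (continuous_subspaceT cg) cpt.
move=> /compact_bounded [K [Kr HK]]; exists (K + 1) => u hu.
apply: (HK (K + 1)); first by rewrite ltrDl.
exists u^T; last by rewrite /g trmxK.
by move=> i /=; rewrite in_itv/= mxE.
Unshelve. all: by end_near. Qed.

End colvec_continuity.

Section model_drift.
Context (R : realType) (N : nat) (M : gs_model R N).
Local Notation V := 'cV[R]_N.
Hypothesis HM : gs_conditions M.

(** The drift for the greenhouse parameter 0. *)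
Definition drift0 (t : R) (u : V) : V := \col_i
  (diffusion M u i
   + solar M i t / heatcap M (node M i) * (1 - albedo M i (u i 0))
   - sigma M / heatcap M (node M i) * emission (u i 0)).

(** The coefficient of the greenhouse parameter in one Euler step, on which the
    step depends in an affine way. *)
Definition gain (u : V) : V := \col_i
  (dt M * (sigma M / heatcap M (node M i) * emission (u i 0)
           * Defs.tanh (c3 M * u i 0 ^+ 6))).

Lemma eulerE g k u :
  euler M g k u = u + dt M *: drift0 (Defs.time M k) u + g (Defs.time M k) *: gain u.
Proof. by apply/matrixP => i j; rewrite ord1 /euler !mxE; ring. Qed.

Lemma drift_dotE gd t u : dt M *: drift_dot M gd t u = gd t *: gain u.
Proof. by apply/matrixP => i j; rewrite ord1 !mxE; ring. Qed.

Lemma measurable_coord_id i : measurable_fun [set: V] (fun u : V => u i 0).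
Proof. exact: measurable_coordc. Qed.

Lemma measurable_cell_temp j : measurable_fun [set: V] (fun u : V => cell_temp u j).
Proof.
rewrite /cell_temp; case: (insub j : option 'I_N) => [i|]; last exact: measurable_cst.
exact: measurable_coord_id.
Qed.

Lemma continuous_cond j : (0 < j < N)%N -> continuous (cond M j).
Proof. by move=> jN; apply: locally_lipschitz_continuous; exact: (cond_lip HM). Qed.

Lemma measurable_flux j : measurable_fun [set: V] (flux M j).
Proof.
rewrite /flux; case jN: (0 < j < N)%N; last exact: measurable_cst.
apply: measurable_funM.
  apply: measurable_funM => //; apply: continuous_measurable_colvec.
  exact: continuous_cond.
apply: measurable_funM => //; apply: measurable_funB; exact: measurable_cell_temp.
Qed.

Lemma measurable_emission : measurable_fun [set: R] (@emission R).
Proof.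
apply: measurable_funM => //; apply: measurable_funX; exact: normr_measurable.
Qed.

Lemma measurable_tanh : measurable_fun [set: R] (@Defs.tanh R).
Proof.
have c1 : continuous (@Defs.tanh R).
  move=> x; apply: cvgM; first apply: cvgB.
  - exact: continuous_expR.
  - by apply: (cvg_comp (-%R) expR); [exact: (@cvgN _ R^o) cvg_id|exact: continuous_expR].
  apply: cvgV; first by rewrite gt_eqF// addr_gt0// expR_gt0.
  apply: cvgD; first exact: continuous_expR.
  by apply: (cvg_comp (-%R) expR); [exact: (@cvgN _ R^o) cvg_id|exact: continuous_expR].
exact: continuous_measurable_fun.
Qed.

Lemma measurable_albedo i : measurable_fun [set: R] (albedo M i).
Proof.
apply: continuous_measurable_fun; apply: locally_lipschitz_continuous.
exact: (albedo_lip HM).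
Qed.

Lemma measurable_drift0 t : measurable_fun [set: V] (drift0 t).
Proof.
apply: measurable_fun_coordcP => i.
under [X in measurable_fun _ X]eq_fun do rewrite /coordc /= mxE.
apply: measurable_funB; first apply: measurable_funD.
- apply: measurable_funM => //; apply: measurable_funM => //.
  by apply: measurable_funB; exact: measurable_flux.
- apply: measurable_funM => //; apply: measurable_funB => //.
  exact: (measurableT_comp (measurable_albedo i) (measurable_coord_id i)).
- apply: measurable_funM => //.
  exact: (measurableT_comp measurable_emission (measurable_coord_id i)).
Qed.

Lemma measurable_gain : measurable_fun [set: V] gain.
Proof.
apply: measurable_fun_coordcP => i.
under [X in measurable_fun _ X]eq_fun do rewrite /coordc /= mxE.
apply: measurable_funM => //; apply: measurable_funM; first apply: measurable_funM => //.
  exact: (measurableT_comp measurable_emission (measurable_coord_id i)).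
apply: (measurableT_comp measurable_tanh); apply: measurable_funM => //.
by apply: measurable_funX; exact: measurable_coord_id.
Qed.

Lemma measurable_euler g k : measurable_fun [set: V] (euler M g k).
Proof.
rewrite (funext (eulerE g k)).
apply: measurable_colD; last by apply: measurable_colZ; exact: measurable_gain.
apply: measurable_colD => //; apply: measurable_colZ; exact: measurable_drift0.
Qed.

Definition bdd (f : R -> V -> R) := exists B, forall t u, box M u -> `|f t u| <= B.

Lemma bdd_cst c : bdd (fun _ _ => c).
Proof. by exists `|c|. Qed.

Lemma bddM f g : bdd f -> bdd g -> bdd (fun t u => f t u * g t u).
Proof.
move=> [A HA] [B HB]; exists (A * B) => t u bu; rewrite normrM.
by apply: ler_pM => //; [exact: HA|exact: HB].
Qed.

Lemma bddD f g : bdd f -> bdd g -> bdd (fun t u => f t u + g t u).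
Proof.
move=> [A HA] [B HB]; exists (A + B) => t u bu.
by apply: le_trans (ler_normD _ _) _; apply: lerD; [exact: HA|exact: HB].
Qed.

Lemma bddB f g : bdd f -> bdd g -> bdd (fun t u => f t u - g t u).
Proof.
move=> [A HA] [B HB]; exists (A + B) => t u bu.
by apply: le_trans (ler_normB _ _) _; apply: lerD; [exact: HA|exact: HB].
Qed.

Lemma bdd_coord i : bdd (fun _ u => u i 0).
Proof.
exists (`|Tmin M| + `|Tmax M|) => t u /(_ i) /andP[h1 h2].
rewrite ler_norml; have := ler_norm (Tmax M); have := ler_norm (- Tmin M).
have := normr_ge0 (Tmax M); have := normr_ge0 (Tmin M); rewrite normrN => *.
by apply/andP; split; lra.
Qed.

Lemma bdd_cell j : bdd (fun _ u => cell_temp u j).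
Proof.
by rewrite /cell_temp; case: (insub j : option 'I_N) => [i|]; [exact: bdd_coord|exact: bdd_cst].
Qed.

Lemma bdd_flux j : bdd (fun _ u => flux M j u).
Proof.
rewrite /flux; case jN: (0 < j < N)%N; last exact: bdd_cst.
apply: bddM; last by apply: bddM (bdd_cst _); apply: bddB; exact: bdd_cell.
apply: bddM (bdd_cst _) _.
have [B HB] := continuous_bounded_box (Tmin M) (Tmax M) (continuous_cond jN).
by exists B => _ u bu; exact: HB.
Qed.

Lemma bdd_emission i : bdd (fun _ u => emission (u i 0)).
Proof.
have bn : bdd (fun _ u => `|u i 0|).
  by have [B HB] := bdd_coord i; exists B => t u bu; rewrite normr_id; exact: HB.
by rewrite /emission; apply: bddM (bdd_coord i) _; do 2 apply: bddM => //.
Qed.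

Lemma tanh_le1 x : `|Defs.tanh x| <= 1 :> R.
Proof.
have a := expR_gt0 x; have b := expR_gt0 (- x).
rewrite /Defs.tanh normrM normfV (gtr0_norm (addr_gt0 a b)) ler_pdivrMr ?addr_gt0// mul1r.
by rewrite ler_norml; apply/andP; split; lra.
Qed.

Lemma bdd_colvec (F : R -> V -> V) : (forall i, bdd (fun t u => F t u i 0)) ->
  exists2 B, 0 <= B & forall t u, box M u -> `|F t u| <= B.
Proof.
move=> /choice[B HB]; exists (\sum_i `|B i|); first exact: sumr_ge0.
move=> t u bu; apply: norm_le_coord; first exact: sumr_ge0.
move=> i; apply: le_trans (HB i t u bu) _; apply: le_trans (ler_norm _) _.
by rewrite (bigD1 i)//= lerDl; exact: sumr_ge0.
Qed.

Lemma drift0_bounded : exists2 B, 0 <= B & forall t u, box M u -> `|drift0 t u| <= B.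
Proof.
apply: bdd_colvec => i.
suff [B HB] : bdd (fun t u => diffusion M u i
   + solar M i t / heatcap M (node M i) * (1 - albedo M i (u i 0))
   - sigma M / heatcap M (node M i) * emission (u i 0)).
  by exists B => t u bu; rewrite mxE; exact: HB.
apply: bddB; first apply: bddD.
- apply: bddM (bdd_cst _) _; apply: bddM; last exact: bdd_cst.
  by apply: bddB; exact: bdd_flux.
- apply: bddM; first apply: bddM (bdd_cst _).
    have [B HB] := solar_bounded HM i; exists B => t u _.
    by rewrite ger0_norm//; exact: (solar_ge0 HM).
  apply: bddB (bdd_cst _) _; exists 1 => t u _.
  by have /andP[h1 h2] := albedo_01 HM i (u i 0); rewrite ger0_norm.
- by apply: bddM (bdd_cst _) (bdd_emission i).
Qed.

Lemma gain_bounded : exists2 B, 0 <= B & forall u, box M u -> `|gain u| <= B.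
Proof.
have [i|B B0 HB] := @bdd_colvec (fun _ => gain); last by exists B => // u; exact: HB 0 u.
suff [B HB] : bdd (fun t u => dt M * (sigma M / heatcap M (node M i) * emission (u i 0)
           * Defs.tanh (c3 M * u i 0 ^+ 6))).
  by exists B => t u bu; rewrite mxE; exact: HB.
apply: bddM (bdd_cst _) _; apply: bddM; first exact: bddM (bdd_cst _) (bdd_emission i).
by exists 1 => t u _; exact: tanh_le1.
Qed.

Lemma euler_bounded G : exists2 B, 0 <= B & forall g k u,
  (forall t, `|g t| <= G) -> box M u -> `|euler M g k u| <= B.
Proof.
have [A A0 HA] := drift0_bounded; have [B B0 HB] := gain_bounded.
have [C C0 HC] := @bdd_colvec (fun _ u => u) bdd_coord.
have d0 := ltW (dt_gt0 HM).
exists (C + dt M * A + `|G| * B); first by rewrite !addr_ge0// mulr_ge0.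
move=> g k u gG bu; rewrite eulerE.
apply: le_trans (ler_normD _ _) _; apply: lerD.
  apply: le_trans (ler_normD _ _) _; apply: lerD; first exact: (HC 0).
  by rewrite normrZ ger0_norm// ler_wpM2l// HA.
rewrite normrZ; apply: ler_pM => //; last exact: HB.
by apply: le_trans (gG _) (ler_norm _).
Qed.

End model_drift.

(** * Extended-real norms, the box, and uniqueness of the derivative *)

Lemma cvge0_near_lt (R : realType) (I : Type) (F : set_system I) {FF : Filter F}
    (f : I -> \bar R) :
  f x @[x --> F] --> 0%E -> (forall x, (0 <= f x)%E) ->
  forall e, 0 < e -> \forall x \near F, (f x < e%:E)%E.
Proof.
move=> /fine_cvgP[ffin /cvgr0Pnorm_lt f0] fge e e0.
apply: filterS2 ffin (f0 e e0) => x ffin.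
by rewrite /= ger0_norm ?fine_ge0// -lte_fin fineK.
Qed.

Lemma cvge0_squeeze (R : realType) (I : Type) (F : set_system I) {FF : Filter F}
    (f : I -> \bar R) (h : I -> R) :
  (forall x, (0 <= f x)%E) -> (\forall x \near F, (f x <= (h x)%:E)%E) ->
  h x @[x --> F] --> (0 : R) -> f x @[x --> F] --> 0%E.
Proof.
move=> f0 fh h0; apply: (@squeeze_cvge _ _ _ _ (fun=> 0%E) _ (fun x => (h x)%:E)).
- by apply: filterS fh => x ->; rewrite f0.
- exact: cvg_cst.
- by apply/fine_cvgP; split=> //; exact: nearW.
Qed.

Section bridges.
Context (R : realType) (N : nat) (M : gs_model R N).
Local Notation V := 'cV[R]_N.
Local Notation mb := (mboxs M).

Lemma L1normE (f : V -> R) : L1 mb f -> L1norm M f = (nrm mb f)%:E.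
Proof. by move=> lf; rewrite /L1norm; exact: (@Lnorm_nrm _ _ _ mb). Qed.

Lemma L1norm_ge0 (f : V -> R) : (0 <= L1norm M f)%E.
Proof. exact: Lnorm_ge0. Qed.

Lemma LfunE (f : V -> R) : f \in Lfun (mbox M) 1 <-> L1 mb f.
Proof. exact: (@Lfun_L1 _ _ _ mb). Qed.

Lemma ae_mboxsE (f g : V -> R) :
  (f = g %[ae mbox M]) <-> (\forall x \ae mb, f x = g x).
Proof.
by split; apply: filterS => x; [apply|].
Qed.

(** The measure is carried by the box, so an integrand may be changed outside. *)
Lemma box_Rint (f h : V -> R) : measurable_fun setT h ->
  (forall u, box M u -> f u = h u) ->
  \int[mbox M]_(u in box M) f u = \int[mb]_u h u.
Proof.
move=> mh fh.
have -> : \int[mbox M]_(u in box M) f u = \int[mb]_(u in box M) h u.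
  by apply: eq_Rintegral => u /set_mem; exact: fh.
rewrite /Rintegral; congr fine; rewrite integral_mkcond.
apply: ae_eq_integral => //.
- apply/(measurable_restrictT _ (measurable_box M)); apply: measurable_funTS.
  exact/measurable_EFinP.
- exact/measurable_EFinP.
exists (~` box M); split.
- by apply: measurableC; exact: measurable_box.
- exact: mbox_outside.
- move=> u /=; apply: contra_not => bu _.
  by rewrite patchE mem_set//; apply: contrapT.
Qed.

Lemma prob_densityE f : prob_density M f <-> density mb f.
Proof.
split=> -[lf f0 f1].
- have l := (LfunE f).1 lf; split => //.
  by rewrite -f1; apply/esym/box_Rint => //; exact: L1_meas l.
- split=> //; first exact/LfunE.
  by rewrite -f1; apply: box_Rint => //; exact: L1_meas lf.
Qed.

(** At s v with s small, the two linear maps differ by at most a small multiple of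
    s |v|; dividing by s shows that they agree at v.  The conclusion holds
    almost everywhere because [is_frechet1] determines the values of D only up to
    null sets that depend on z and v. *)
Lemma frechet_unique (kk : V -> V -> R) (D D0 : V -> V -> V -> R) (C : R) :
  (forall z, L1 mb (kk z)) -> is_frechet1 M kk D ->
  (forall z v, L1 mb (D0 z v)) -> 0 <= C ->
  (forall z (a : R) v w y, D0 z (a *: v + w) y = a * D0 z v y + D0 z w y) ->
  (forall z v, nrm mb (fun y => kk (z + v) y - kk z y - D0 z v y) <= C * `|v| ^+ 2) ->
  forall z v, L1 mb (D z v) /\ \forall y \ae mb, D z v y = D0 z v y.
Proof.
move=> lkk [_ lD linD _ cvD] lD0 C0 linD0 rate z v.
have l1 w : L1 mb (D z w) by exact/LfunE.
split=> //.
have lin a u w : \forall y \ae mb, D z (a *: u + w) y = a * D z u y + D z w y.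
  by have := linD z a u w; apply: filterS => y; apply.
have D00 y : D0 z 0 y = 0.
  have := linD0 z (-1) v v y; rewrite scaleN1r addNr => ->; ring.
have Dz0 : \forall y \ae mb, D z 0 y = 0.
  apply: filterS (lin (-1) v v) => y; rewrite scaleN1r addNr => ->; ring.
have [->|v0] := eqVneq v 0.
  by apply: filterS Dz0 => y ->; rewrite D00.
have nv0 : 0 < `|v| by rewrite normr_gt0.
apply: nrm_sub_eq0 => //; apply/ler_addgt0Pl => e e0; rewrite addr0.
have e2 : 0 < e / (2 * `|v|) by rewrite divr_gt0// mulr_gt0.
have e4 : 0 < e / (2 * (C + 1) * `|v| ^+ 2).
  by rewrite divr_gt0// !mulr_gt0// ?exprn_gt0// ltr_wpDl.
have : \forall w \near (0 : V)^',
    ((`|w|^-1)%:E * L1norm M (fun y => kk (z + w)%R y - kk z y - D z w y)%R <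
       (e / (2 * `|v|))%:E)%E.
  by apply: (cvge0_near_lt (cvD z) _ e2) => w; rewrite mule_ge0 ?L1norm_ge0// lee_fin.
move=> /nbhs_ballP[dl dl0 hdl].
(* s v stays where the remainder of D is at most e / (2 |v|) relative to its
   norm, and the quadratic remainder of D0 is at most s e / 2 *)
pose s := Num.min (dl / (2 * `|v|)) (e / (2 * (C + 1) * `|v| ^+ 2)).
have s0 : 0 < s by rewrite lt_min e4 divr_gt0// mulr_gt0.
have sv : `|s *: v| = s * `|v| by rewrite normrZ gtr0_norm.
have sv0 : s *: v != 0 by rewrite scaler_eq0 negb_or gt_eqF.
have lk w : L1 mb (fun y => kk (z + w) y - kk z y) by exact: L1B.
have A : nrm mb (fun y => kk (z + s *: v) y - kk z y - D z (s *: v) y) <=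
    s * `|v| * (e / (2 * `|v|)).
  have /hdl : ball (0 : V) dl (s *: v).
    rewrite -ball_normE /ball_/= sub0r normrN sv.
    apply: (@le_lt_trans _ _ (dl / (2 * `|v|) * `|v|)).
      by rewrite ler_wpM2r// ge_min lexx.
    have -> : dl / (2 * `|v|) * `|v| = dl / 2 by field; rewrite gt_eqF.
    by rewrite ltr_pdivrMr// ltr_pMr// ltr1n.
  move=> /(_ sv0); rewrite L1normE; last exact: L1B.
  rewrite -EFinM lte_fin ltr_pdivrMl ?sv ?mulr_gt0//; exact: ltW.
have B : nrm mb (fun y => kk (z + s *: v) y - kk z y - D0 z (s *: v) y) <=
    C * (s * `|v|) ^+ 2 by rewrite -sv; exact: rate.
have E : nrm mb (fun y => D z (s *: v) y - D0 z (s *: v) y) =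
    s * nrm mb (fun y => D z v y - D0 z v y).
  transitivity (`|s| * nrm mb (fun y => D z v y - D0 z v y)); last by rewrite gtr0_norm.
  rewrite -nrmZ; last exact: L1B.
  apply: nrm_ae; [exact: L1B|by apply: L1Z; exact: L1B|].
  apply: filterS2 Dz0 (lin s v 0) => y h0; rewrite addr0 => ->.
  have := linD0 z s v 0 y; rewrite addr0 D00 h0 => ->; ring.
have : s * nrm mb (fun y => D z v y - D0 z v y) <=
    s * `|v| * (e / (2 * `|v|)) + C * (s * `|v|) ^+ 2.
  rewrite -E; apply: le_trans (lerD A B).
  apply: le_trans (nrmB (L1B (lk _) (l1 _)) (L1B (lk (s *: v)) (lD0 z (s *: v)))) => //.
  rewrite le_eqVlt; apply/orP; left; apply/eqP.
  rewrite nrmC; congr nrm; apply/funext => y; ring.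
have -> : s * `|v| * (e / (2 * `|v|)) + C * (s * `|v|) ^+ 2 =
    s * (e / 2 + C * s * `|v| ^+ 2) by field; rewrite gt_eqF.
rewrite ler_pM2l// => /le_trans; apply.
have : (C + 1) * s * `|v| ^+ 2 <= e / 2.
  apply: (@le_trans _ _ ((C + 1) * (e / (2 * (C + 1) * `|v| ^+ 2)) * `|v| ^+ 2)).
    rewrite ler_wpM2r ?sqr_ge0// ler_wpM2l ?addr_ge0//.
    by rewrite ge_min lexx orbT.
  rewrite le_eqVlt; apply/orP; left; apply/eqP; field.
  by rewrite gt_eqF//= gt_eqF// ltr_wpDl.
have : 0 <= s * `|v| ^+ 2 by rewrite mulr_ge0 ?sqr_ge0// ltW.
by rewrite -mulrA mulrDl mul1r -[X in _ -> _ -> _ + X <= _]mulrA; lra.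
Qed.

End bridges.

(** * The Euler map cut off outside the box *)

Section masked_dynamics.
Context (R : realType) (N : nat) (M : gs_model R N).
Local Notation V := 'cV[R]_N.
Local Notation mb := (mboxs M).
Hypothesis HM : gs_conditions M.

(** The drift is bounded on the box only, while the kernels are indexed by all of
    R^N.  Outside the box, which is a null set, the map is set to 0, so that
    bounds hold everywhere. *)
Definition masked_euler (g : R -> R) (k : int) (u : V) : V := (\1_(box M) u : R) *: euler M g k u.
Definition masked_gain (u : V) : V := (\1_(box M) u : R) *: gain M u.

Lemma masked_eulerE g k u : box M u -> masked_euler g k u = euler M g k u.
Proof. by move=> bu; rewrite /masked_euler indicE mem_set// scale1r. Qed.

Lemma masked_gainE u : box M u -> masked_gain u = gain M u.
Proof. by move=> bu; rewrite /masked_gain indicE mem_set// scale1r. Qed.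

Lemma measurable_mask (f : V -> V) : measurable_fun setT f ->
  measurable_fun setT (fun u => (\1_(box M) u : R) *: f u).
Proof.
move=> mf; apply: measurable_fun_coordcP => i.
under [X in measurable_fun _ X]eq_fun do rewrite /coordc /= mxE.
apply: measurable_funM; first by apply: measurable_indic; exact: measurable_box.
exact: measurable_coord.
Qed.

Lemma measurable_masked_euler g k : measurable_fun setT (masked_euler g k).
Proof. by apply: measurable_mask; exact: measurable_euler. Qed.

Lemma measurable_masked_gain : measurable_fun setT masked_gain.
Proof. by apply: measurable_mask; exact: measurable_gain. Qed.

Lemma masked_norm (f : V -> V) B u : 0 <= B -> (box M u -> `|f u| <= B) ->
  `|(\1_(box M) u : R) *: f u| <= B.
Proof.
move=> B0 fB; rewrite indicE; have [/set_mem bu|_] := boolP (u \in box M).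
  by rewrite scale1r fB.
by rewrite scale0r normr0.
Qed.

Lemma masked_euler_sub g g' k u :
  masked_euler g k u = masked_euler g' k u +
    (g (Defs.time M k) - g' (Defs.time M k)) *: masked_gain u.
Proof.
rewrite /masked_euler /masked_gain !eulerE; apply/matrixP => i j; rewrite !mxE; ring.
Qed.

Lemma transferE kk g k (phi : V -> R) : jmeas kk -> measurable_fun setT phi ->
  transfer M kk g k phi = push mb (fun u y => kk (masked_euler g k u) y) phi.
Proof.
move=> mkk mphi; apply/funext => y; apply: box_Rint => [|u bu]; last by rewrite masked_eulerE.
apply: measurable_funM => //.
exact: (measurableT_comp (jmeas2 y mkk) (measurable_masked_euler g k)).
Qed.

Lemma transfer_dotE D g gd k (phi : V -> R) :
  measurable_fun [set: V * V * V] (fun p => D p.1.1 p.1.2 p.2) ->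
  measurable_fun setT phi ->
  transfer_dot M D g gd k phi =
  push mb (fun u y => D (masked_euler g k u) (gd (Defs.time M k) *: masked_gain u) y) phi.
Proof.
move=> mD mphi; apply/funext => y; apply: box_Rint => [|u bu]; last first.
  by rewrite masked_eulerE// masked_gainE// drift_dotE.
apply: measurable_funM => //.
apply: (measurableT_comp mD
  (g := fun u => (masked_euler g k u, gd (Defs.time M k) *: masked_gain u, y))).
apply: measurable_fun_pair; last exact: measurable_cst.
apply: measurable_fun_pair; first exact: measurable_masked_euler.
by apply: measurable_colZ; exact: measurable_masked_gain.
Qed.

Lemma equivariantE kk g mu : jmeas kk ->
  equivariant M (transfer M kk g) mu <->
  equivariant_family mb (fun k => push mb (fun u y => kk (masked_euler g k u) y)) mu.
Proof.
move=> mkk; split=> h k.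
- have [/prob_densityE dk ak] := h k; have [lk _ _] := dk; split => //.
  by move/ae_mboxsE : ak; rewrite transferE//; exact: L1_meas lk.
- have [dk ak] := h k; have [lk _ _] := dk; split; first exact/prob_densityE.
  by apply/ae_mboxsE; rewrite transferE//; exact: L1_meas lk.
Qed.

End masked_dynamics.

(** * The perturbation of the greenhouse parameter *)

Section parameters.
Context (R : realType).
Variables (m mdot : R -> R) (meps rm : R -> R -> R) (mstar : R).
Hypothesis Hmeps : forall e t, meps e t = m t + e * mdot t + rm e t.
Hypothesis Hm0 : forall t, meps 0 t = m t.
Hypothesis Hmdot : (ereal_sup (range (fun t => `|mdot t|%:E)) < +oo)%E.
Hypothesis Hrm : ereal_sup (range (fun t => (`|rm e t| / `|e|)%:E))
           @[e --> (0 : R)^'] --> 0%E.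
Hypothesis Hmstar : mstar < 1.
Hypothesis Hbound : \forall e \near (0 : R),
     0 <= e -> forall t, 0 <= meps e t <= mstar.

Lemma fine_sup_ubound (f : R -> R) t : (forall t, 0 <= f t) ->
  (ereal_sup (range (fun t => (f t)%:E)) < +oo)%E ->
  f t <= fine (ereal_sup (range (fun t => (f t)%:E))).
Proof.
move=> f0 foo.
have h s : ((f s)%:E <= ereal_sup (range (fun t => (f t)%:E)))%E.
  by apply: ereal_sup_ubound; exists s.
rewrite -lee_fin fineK// ge0_fin_numE//.
by apply: le_trans (h 0); rewrite lee_fin.
Qed.

Lemma mdot_bounded : exists2 B, 0 <= B & forall t, `|mdot t| <= B.
Proof.
exists (fine (ereal_sup (range (fun t => `|mdot t|%:E)))).
  by apply: le_trans (@fine_sup_ubound (fun t => `|mdot t|) 0 _ Hmdot).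
by move=> t; exact: (@fine_sup_ubound (fun t => `|mdot t|)).
Qed.

(** rho e is the supremum over t of |rm e t| / |e|; it is set to 0 at e = 0, where
    rm vanishes because meps 0 = m. *)
Lemma rm_bounded : exists (e0 : R) (rho : R -> R), [/\ 0 < e0,
  rho e @[e --> (0 : R)^'] --> (0 : R),
  forall e, `|e| <= e0 -> 0 <= rho e <= 1 &
  forall e t, `|e| <= e0 -> `|rm e t| <= rho e * `|e|].
Proof.
pose S e := ereal_sup (range (fun t => (`|rm e t| / `|e|)%:E)).
have S0 e : (0 <= S e)%E.
  apply: (@le_trans _ _ (`|rm e 0| / `|e|)%:E); first by rewrite lee_fin divr_ge0.
  by apply: ereal_sup_ubound; exists 0.
have : \forall e \near (0 : R)^', (S e < 1%:E)%E by exact: (cvge0_near_lt Hrm S0 ltr01).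
move=> /nbhs_ballP[d d0 hd].
have /fine_cvgP[_ rho0] := Hrm.
exists (d / 2), (fun e => if e == 0 then 0 else fine (S e)); split.
- by rewrite divr_gt0.
- apply: cvg_trans rho0; apply: near_eq_cvg.
  have : \forall e \near (0 : R)^', e != 0 by exact: nbhs_dnbhs_neq.
  by apply: filterS => e e0; rewrite (negbTE e0).
- move=> e ed; case: ifP => [_|/negbT e0]; first by rewrite lexx ler01.
  have /hd : ball (0 : R) d e.
    rewrite -ball_normE /ball_/= sub0r normrN (le_lt_trans ed)//.
    by rewrite ltr_pdivrMr// ltr_pMr// ltr1n.
  move=> /(_ e0) h1; rewrite fine_ge0//= -lee_fin fineK ?ltW//.
  by rewrite ge0_fin_numE// (lt_trans h1)// ltry.
- move=> e t ed; case: ifP => [/eqP ->|/negbT e0].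
    by have := Hmeps 0 t; rewrite Hm0 mul0r normr0 mulr0; move=> h;
      rewrite (_ : rm 0 t = 0) ?normr0//; lra.
  have /hd : ball (0 : R) d e.
    rewrite -ball_normE /ball_/= sub0r normrN (le_lt_trans ed)//.
    by rewrite ltr_pdivrMr// ltr_pMr// ltr1n.
  move=> /(_ e0) h1; rewrite -ler_pdivrMr ?normr_gt0//.
  apply: (@fine_sup_ubound (fun t => `|rm e t| / `|e|)).
    by move=> s; rewrite divr_ge0.
  by apply: lt_trans h1 (ltry _).
Qed.

Lemma m_bounded t : `|m t| <= 1.
Proof.
have := nbhs_singleton Hbound => /(_ (lexx _) t); rewrite Hm0 => /andP[h1 h2].
rewrite ger0_norm//; exact: le_trans h2 (ltW Hmstar).
Qed.

End parameters.

(** * The perturbed family of kernels *)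

Section assembly.
Context (R : realType) (N : nat) (M : gs_model R N).
Local Notation V := 'cV[R]_N.
Local Notation mb := (mboxs M).
Variables (m mdot : R -> R) (meps rm : R -> R -> R).
Hypothesis HM : gs_conditions M.
Hypothesis Hmeps : forall e t, meps e t = m t + e * mdot t + rm e t.
Hypothesis Hm0 : forall t, meps 0 t = m t.
Variables (e0 Md : R) (rho : R -> R).
Hypothesis e0_gt0 : 0 < e0.
Hypothesis m1 : forall t, `|m t| <= 1.
Hypothesis Md0 : 0 <= Md.
Hypothesis mdotM : forall t, `|mdot t| <= Md.
Hypothesis rho_cv : rho e @[e --> (0 : R)^'] --> (0 : R).
Hypothesis rho01 : forall e, `|e| <= e0 -> 0 <= rho e <= 1.
Hypothesis rmrho : forall e t, `|e| <= e0 -> `|rm e t| <= rho e * `|e|.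

Variables (S : 'M[R]_N) (T : V -> V).
Hypothesis mT : measurable_fun setT T.
Hypothesis nonsing : forall B, measurable B -> mb B = 0%E ->
  @std_gauss R N (T @^-1` B) = 0%E.
Variable kk : V -> V -> R.
Hypothesis mkk : jmeas kk.
Hypothesis kk0 : forall z y, 0 <= kk z y.
Hypothesis pkk : forall z, image_density (@std_gauss R N) mb T (cm (S *m z)) (kk z).

Definition perturbed_kernel (e : R) (k : int) (u y : V) := kk (masked_euler M (meps e) k u) y.

Lemma meps_bounded e t : `|e| <= e0 -> `|meps e t| <= 1 + e0 * Md + e0.
Proof.
move=> ee; rewrite Hmeps; apply: le_trans (ler_normD _ _) _; apply: lerD.
  apply: le_trans (ler_normD _ _) _; apply: lerD => //.
  by rewrite normrM; apply: ler_pM.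
apply: le_trans (rmrho t ee) _; rewrite -[leRHS]mul1r.
by have /andP[h1 h2] := rho01 ee; apply: ler_pM.
Qed.

Lemma perturbed_jmeas e k : jmeas (perturbed_kernel e k).
Proof.
apply: (measurableT_comp mkk (g := fun p : V * V => (masked_euler M (meps e) k p.1, p.2))).
apply: measurable_fun_pair => //.
by apply: (measurableT_comp (measurable_masked_euler HM (meps e) k)).
Qed.

Lemma perturbed_markov e k : markov_kernel mb (perturbed_kernel e k).
Proof.
split; first exact: perturbed_jmeas.
- by move=> u y; exact: kk0.
- by move=> u; have [] := pkk (masked_euler M (meps e) k u).
- by move=> u; rewrite (image_density_int (pkk _)) Rint_cm.
Qed.

(** The Euler maps send the box into one ball, for all k and all |e| <= e0. *)
Lemma perturbed_minorant : exists r : V -> R, [/\ L1 mb r, 0 < \int[mb]_y r y &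
  forall e k u, `|e| <= e0 -> \forall y \ae mb, r y <= perturbed_kernel e k u y].
Proof.
have [B B0 HB] := euler_bounded HM (1 + e0 * Md + e0).
have [r [lr r0 rk]] := minorant_exists mT nonsing pkk B0.
exists r; split => // e k u ee; apply: rk; apply: masked_norm => // bu.
by apply: HB => // t; exact: meps_bounded.
Qed.

Section derivative_kernel.
Variables (D D0 : V -> V -> V -> R) (C : R).
Hypothesis mD : measurable_fun [set: V * V * V] (fun p => D p.1.1 p.1.2 p.2).
Hypothesis C0 : 0 <= C.
Hypothesis linD0 : forall z (a : R) v w y, D0 z (a *: v + w) y = a * D0 z v y + D0 z w y.
Hypothesis D0C : forall z v, L1 mb (D0 z v) /\ nrm mb (D0 z v) <= C * `|v|.
Hypothesis rate : forall z v,
  nrm mb (fun y => kk (z + v) y - kk z y - D0 z v y) <= C * `|v| ^+ 2.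
Hypothesis DD0 : forall z v, L1 mb (D z v) /\ \forall y \ae mb, D z v y = D0 z v y.

(** The derivative at e = 0 of [perturbed_kernel]. *)
Definition response_kernel (k : int) (u y : V) : R :=
  D (masked_euler M (meps 0) k u) (mdot (Defs.time M k) *: masked_gain M u) y.

Lemma response_kernel_jmeas k : jmeas (response_kernel k).
Proof.
apply: (measurableT_comp mD
  (g := fun p : V * V => 
    (masked_euler M (meps 0) k p.1, mdot (Defs.time M k) *: masked_gain M p.1, p.2))).
apply: measurable_fun_pair; last exact: measurable_snd.
apply: measurable_fun_pair.
  exact: (measurableT_comp (measurable_masked_euler HM (meps 0) k) measurable_fst).
apply: measurable_colZ; exact: (measurableT_comp (measurable_masked_gain M) measurable_fst).
Qed.

(** The Euler map moves by e times a bounded vector, plus rm times another one.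
    The first part gives the derivative, the second is negligible with respect to
    e, and the Taylor remainder is quadratic in the whole displacement. *)
Lemma response_kernel_rate : exists (C1 : R) (om : R -> R),
  [/\ forall k, bounded_kernel mb (response_kernel k) C1,
      om e @[e --> (0 : R)^'] --> (0 : R) &
      forall e k u, `|e| <= e0 ->
        nrm mb (fun y => perturbed_kernel e k u y - perturbed_kernel 0 k u y -
          e * response_kernel k u y) <=
        om e * `|e|].
Proof.
have [B B0 HB] := gain_bounded M.
have mgB u : `|masked_gain M u| <= B by apply: masked_norm => // bu; exact: HB.
exists (C * (Md * B)); exists (fun e => C * ((Md + 1) * B) ^+ 2 * `|e| + C * B * rho e); split.
- move=> k; split; first exact: response_kernel_jmeas.
    by move=> u; exact: (DD0 _ _).1.
  move=> u; rewrite /response_kernel; set z := masked_euler _ _ _ _; set v := _ *: _.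
  have [lD aD] := DD0 z v; have [lD0 D0n] := D0C z v.
  rewrite (nrm_ae lD lD0 aD); apply: le_trans D0n _.
  by rewrite ler_wpM2l// normrZ; apply: ler_pM.
- have ce := @norm_dnbhs0 R R.
  suff : C * ((Md + 1) * B) ^+ 2 * `|e| + C * B * rho e @[e --> (0 : R)^'] -->
      C * ((Md + 1) * B) ^+ 2 * 0 + C * B * 0.
    by rewrite !mulr0 addr0.
  by apply: cvgD; apply: cvgM => //; exact: cvg_cst.
move=> e k u ee; rewrite /perturbed_kernel /response_kernel.
set z := masked_euler M (meps 0) k u; set t := Defs.time M k.
set v0 := mdot t *: masked_gain M u.
have zE : masked_euler M (meps e) k u = z + (e *: v0 + rm e t *: masked_gain M u).
  rewrite (masked_euler_sub M (meps e) (meps 0)) -/z -/t /v0 scalerA -scalerDl.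
  by rewrite Hmeps Hm0; congr (_ + _ *: _); ring.
rewrite zE; set dz := e *: v0 + _.
have lk w : L1 mb (kk w) by have [] := pkk w.
have lD w : L1 mb (D z w) := (DD0 z w).1.
have lD0 w : L1 mb (D0 z w) := (D0C z w).1.
have lkk : L1 mb (fun y => kk (z + dz) y - kk z y) by exact: L1B.
have /andP[r0 r1] := rho01 ee.
have ndz : `|dz| <= (Md + 1) * B * `|e|.
  apply: le_trans (ler_normD _ _) _; rewrite /v0 (normrZ e) (normrZ (mdot t)) (normrZ (rm e t)).
  have h1 : `|mdot t| * `|masked_gain M u| <= Md * B by exact: ler_pM.
  have h2 : `|rm e t| * `|masked_gain M u| <= `|e| * B.
    apply: ler_pM => //; apply: le_trans (rmrho t ee) _.
    by rewrite -[leRHS]mul1r ler_wpM2r.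
  have h3 : `|e| * (`|mdot t| * `|masked_gain M u|) <= `|e| * (Md * B) by rewrite ler_wpM2l.
  apply: le_trans (lerD h3 h2) _.
  by rewrite le_eqVlt; apply/orP; left; apply/eqP; ring.
rewrite (@nrm_ae _ _ _ mb _ (fun y => (kk (z + dz) y - kk z y - D0 z dz y) +
    D0 z (rm e t *: masked_gain M u) y)).
- apply: le_trans (nrmD (L1B lkk (lD0 dz)) (lD0 _)) _.
  rewrite mulrDl; apply: lerD.
    apply: le_trans (rate z dz) _.
    rewrite -mulrA -mulrA ler_wpM2l//.
    have -> : ((Md + 1) * B) ^+ 2 * (`|e| * `|e|) = ((Md + 1) * B * `|e|) ^+ 2 by ring.
    by rewrite lerXn2r// nnegrE// !mulr_ge0// addr_ge0.
  apply: le_trans (D0C z _).2 _; rewrite -mulrA -mulrA ler_wpM2l// normrZ mulrC.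
  by apply: ler_pM => //; exact: rmrho.
- by apply: L1B => //; exact: L1Z.
- by apply: L1D => //; exact: L1B.
- apply: filterS (DD0 z v0).2 => y ->.
  rewrite /dz linD0; ring.
Qed.

End derivative_kernel.
End assembly.

(** * Convergence of the response in the uniform L1 norm *)

Section conclusions.
Context (R : realType) (N : nat) (M : gs_model R N).
Local Notation V := 'cV[R]_N.
Local Notation mb := (mboxs M).

Lemma linf_norm_le (f : int -> V -> R) B :
  (forall k, L1 mb (f k)) -> (forall k, nrm mb (f k) <= B) ->
  (linf_norm M f <= B%:E)%E.
Proof.
move=> lf fB; apply: ge_ereal_sup => _ [k _ <-].
by rewrite L1normE// lee_fin.
Qed.

Lemma linf_norm_ge0 (f : int -> V -> R) : (0 <= linf_norm M f)%E.
Proof.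
apply: (le_trans (L1norm_ge0 M (f 0))).
by apply: ereal_sup_ubound; exists 0.
Qed.

Lemma sup_tail_cvg0 (f : int -> nat -> V -> R) C q : 0 <= q < 1 -> 0 <= C ->
  (forall k j, L1 mb (f k j) /\ nrm mb (f k j) <= C * q ^+ j) ->
  ereal_sup (range (fun k => \sum_(n <= j <oo) L1norm M (f k j)))%E
    @[n --> \oo] --> 0%E.
Proof.
move=> q01 C0 fC; apply: (@cvge0_squeeze _ _ _ _ _ (fun n => C / (1 - q) * q ^+ n)).
- move=> n /=; pose z : int := 0.
  apply: (@le_trans _ _ (\sum_(n <= j <oo) L1norm M (f z j))%E).
    by apply: nneseries_ge0 => j _ _; exact: L1norm_ge0.
  by apply: ereal_sup_ubound; exists 0.
- apply: nearW => n; apply: ge_ereal_sup => _ [k _ <-].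
  apply: lime_le; first by apply: is_cvg_nneseries => j _ _; exact: L1norm_ge0.
  apply: nearW => p.
  rewrite (eq_bigr (fun j => (nrm mb (f k j))%:E)); last first.
    by move=> j _; rewrite L1normE//; exact: (fC k j).1.
  rewrite sumEFin lee_fin; apply: le_trans (geo_tail n p q01 C0).
  by apply: ler_sum => j _; exact: (fC k j).2.
- exact: geometric_cvg0.
Qed.


End conclusions.

(** * The Frechet derivative and products of transfer operators *)

Section derivative_operator.
Context (R : realType) (N : nat) (M : gs_model R N).
Local Notation V := 'cV[R]_N.
Local Notation mb := (mboxs M).

Lemma quadratic_is_frechet1 (kk : V -> V -> R) (D : V -> V -> V -> R) (C : R) :
  (forall z, L1 mb (kk z)) ->
  measurable_fun [set: V * V * V] (fun p => D p.1.1 p.1.2 p.2) ->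
  (forall z (a : R) v w y, D z (a *: v + w) y = a * D z v y + D z w y) ->
  (forall z v, L1 mb (D z v) /\ nrm mb (D z v) <= C * `|v|) ->
  (forall z v, nrm mb (fun y => kk (z + v) y - kk z y - D z v y) <= C * `|v| ^+ 2) ->
  is_frechet1 M kk D.
Proof.
move=> lkk mD linD DC rate; split => //.
- by move=> z v; apply/LfunE; exact: (DC z v).1.
- by move=> z a v w; apply: aeW => y _ /=; rewrite linD.
- by move=> z; exists C => v; rewrite L1normE ?lee_fin; [exact: (DC z v).2|exact: (DC z v).1].
move=> z; apply: (@cvge0_squeeze _ _ _ _ _ (fun v : V => C * `|v|)).
- by move=> v; rewrite mule_ge0 ?L1norm_ge0// lee_fin.
- have : \forall v \near (0 : V)^', v != 0 by exact: nbhs_dnbhs_neq.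
  apply: filterS => v v0; rewrite L1normE; last first.
    by apply: L1B; [exact: L1B|exact: (DC z v).1].
  rewrite -EFinM lee_fin mulrC ler_pdivrMr ?normr_gt0//.
  by rewrite -mulrA -expr2.
have : C * `|v| @[v --> (0 : V)^'] --> C * (0 : R).
  apply: cvgM; first exact: cvg_cst.
  exact: norm_dnbhs0.
by rewrite mulr0.
Qed.

Lemma transfer_prodE (kk : V -> V -> R) g k j (phi : V -> R) :
  gs_conditions M -> jmeas kk ->
  (forall k, markov_kernel mb (fun u y => kk (masked_euler M g k u) y)) -> L1 mb phi ->
  transfer_prod (transfer M kk g) k j phi =
  oprod (fun k => push mb (fun u y => kk (masked_euler M g k u) y)) k j phi.
Proof.
move=> HM mkk MK lp; elim: j k => //= j ih k.
by rewrite ih transferE//; apply: L1_meas (oprod_L1 MK j _ lp).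
Qed.

End derivative_operator.

(** * Linear response of the reflected chain *)

Theorem theorem23 (R : realType) (N : nat) (M : gs_model R N)
  (m mdot : R -> R) (meps rm : R -> R -> R) (lambda mstar : R)
  (HM : gs_conditions M)
  (Hlambda : 0 < lambda)
  (Hnoise : loewner_le lambda%:M (noise M *m (noise M)^T))
  (Hmeps : forall e t, meps e t = m t + e * mdot t + rm e t)
  (Hm0 : forall t, meps 0 t = m t)
  (Hmdot : (ereal_sup (range (fun t => `|mdot t|%:E)) < +oo)%E)
  (Hrm : ereal_sup (range (fun t => (`|rm e t| / `|e|)%:E))
           @[e --> (0 : R)^'] --> 0%E)
  (Hmstar : mstar < 1)
  (Hbound : \forall e \near (0 : R),
     0 <= e -> forall t, 0 <= meps e t <= mstar) :
  (exists q, is_noise_density M q) /\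
  forall q, is_noise_density M q ->
  (exists kk, is_transition_density M q kk) /\
  forall kk, is_transition_density M q kk ->
  let L (e : R) := transfer M kk (meps e) in
  [/\ exists D, is_frechet1 M kk D,
      \forall e \near (0 : R), exists mu, equivariant M (L e) mu /\
        forall mu', equivariant M (L e) mu' ->
        forall k, mu' k = mu k %[ae mbox M] &
      forall (D : 'cV[R]_N -> 'cV[R]_N -> 'cV[R]_N -> R)
             (mu : R -> int -> 'cV[R]_N -> R),
      is_frechet1 M kk D ->
      (\forall e \near (0 : R), equivariant M (L e) (mu e)) ->
      let g (k : int) := transfer_dot M D (meps 0) mdot k (mu 0 k) in
      let term (k : int) (j : nat) :=
        transfer_prod (L 0) k j (g (k - j%:Z - 1)) in
      exists eta : int -> 'cV[R]_N -> R,
        [/\ (forall k, eta k \in Lfun (mbox M) 1) /\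
              (linf_norm M eta < +oo)%E,
            linf_norm M (fun k y => (mu e k y - mu 0 k y) / e - eta k y)
              @[e --> (0 : R)^'] --> 0%E,
            forall k,
              L1norm M (fun y => eta k y -
                (g (k - 1) y + \sum_(1 <= j < n) term k j y))
                @[n --> \oo] --> 0%E,
            forall k j, term k j \in Lfun (mbox M) 1 &
            ereal_sup (range (fun k => \sum_(n <= j <oo) L1norm M (term k j)))%E
              @[n --> \oo] --> 0%E]].
Proof.
split; first exact: (noise_density_exists HM Hlambda Hnoise).
move=> q hq.
have mT := measurable_fold_noise M.
have nonsing := @fold_noise_null _ _ _ HM _ Hlambda Hnoise.
split.
  have [kk [mkk kk0 pkk]] := kernel_exists (invmx (step_noise M)) mT nonsing.
  by exists kk; apply/(transition_densityP HM Hlambda Hnoise kk hq).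
move=> kk /(transition_densityP HM Hlambda Hnoise kk hq)[mkk kk0 pkk] L.
have lkk z : L1 (mboxs M) (kk z) by have [] := pkk z.
have [D0 [C [[mD0 C0] linD0 D0C rate]]] := derivative_exists mT mkk pkk.
have [e0 [rho [e0_gt0 rho_cv rho01 rmrho]]] := rm_bounded Hmeps Hm0 Hrm.
have [Md Md0 mdotM] := mdot_bounded Hmdot.
have m1 := m_bounded Hm0 Hmstar Hbound.
pose K := perturbed_kernel M meps kk.
have MK e k : markov_kernel (mboxs M) (K e k) by exact: (perturbed_markov meps HM mkk kk0 pkk).
have [r [lr r0 rK]] := perturbed_minorant HM Hmeps m1 mdotM rho01 rmrho mT nonsing pkk.
have eqvL e mu : equivariant M (L e) mu <->
    equivariant_family (mboxs M) (fun k => push (mboxs M) (K e k)) mu.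
  exact: equivariantE.
split.
- by exists D0; apply: (@quadratic_is_frechet1 _ _ _ _ _ C).
- have : \forall e \near (0 : R), `|e| <= e0 by exact: nbhs0_le.
  apply: filterS => e ee.
  have rKe k u := rK e k u ee.
  have [mu emu] := equivariant_family_exists (MK e) lr r0 erefl rKe.
  exists mu; split; first exact/eqvL.
  move=> mu' /eqvL emu' k; apply/ae_mboxsE.
  exact: (equivariant_family_unique (MK e) lr r0 erefl rKe emu emu').
move=> D mu frD hmu g term.
have DD0 := frechet_unique lkk frD (fun z v => (D0C z v).1) C0 linD0 rate.
have mD : measurable_fun [set: 'cV[R]_N * 'cV[R]_N * 'cV[R]_N]
    (fun p => D p.1.1 p.1.2 p.2) by case: frD.
have [C1 [om [bD om_cv hD]]] :=
  response_kernel_rate HM Hmeps Hm0 Md0 mdotM rho_cv rho01 rmrho pkk mD C0 linD0 D0C rate DD0.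
have [d d0 hd] : exists2 d, 0 < d & forall e, `|e| < d -> equivariant M (L e) (mu e).
  move: hmu => /nbhs_ballP[d d0 hd]; exists d => // e ed; apply: hd.
  by rewrite -ball_normE /ball_/= sub0r normrN.
(* half of d, as linear_response uses a closed ball *)
pose e1 := Num.min e0 (d / 2).
have e1_gt0 : 0 < e1 by rewrite lt_min e0_gt0 divr_gt0.
have e10 : e1 <= e0 by rewrite ge_min lexx.
have emu e : `|e| <= e1 -> equivariant_family (mboxs M) (fun k => push (mboxs M) (K e k)) (mu e).
  move=> ee; apply/eqvL/hd; apply: le_lt_trans ee _.
  apply: (@le_lt_trans _ _ (d / 2)); first by rewrite ge_min lexx orbT.
  by rewrite ltr_pdivrMr// ltr_pMr// ltr1n.
have b01 : \int[(mboxs M)]_y r y <= 1.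
  apply: (@mass_le1 _ _ _ (mboxs M) (K 0) r _ (MK 0) lr erefl) => k u.
  by apply: rK; rewrite normr0 ltW.
have zz : `|0 : R| <= e1 by rewrite normr0 ltW.
have lmu0 k : L1 (mboxs M) (mu 0 k) by have [[]] := emu 0 zz k.
have gE k : g k = push (mboxs M) (response_kernel M mdot meps D k) (mu 0 k).
  by rewrite /g transfer_dotE//; exact: L1_meas (lmu0 k).
have lg k : L1 (mboxs M) (g k) by rewrite gE; exact: push_L1 (bD k) (lmu0 k).
have termE k j : term k j = oprod (fun k => push (mboxs M) (K 0 k)) k j
    (push (mboxs M) (response_kernel M mdot meps D (k - j%:Z - 1)) (mu 0 (k - j%:Z - 1))).
  rewrite /term /L transfer_prodE//; first by rewrite gE.
  exact: (MK 0).
have [eta [leta [B etaB] [om' om'_cv Hom'] Hterm Htail]] :=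
  linear_response e0_gt0 (fun e k _ => MK e k) lr r0 erefl rK bD hD om_cv
    e1_gt0 e10 emu.
have {}Hterm k j : L1 (mboxs M) (term k j) /\
    nrm (mboxs M) (term k j) <= C1 * (1 - \int[(mboxs M)]_y r y) ^+ j.
  by rewrite termE; exact: Hterm.
have {}Htail k n : nrm (mboxs M) (fun y => eta k y - \sum_(j < n) term k j y) <=
    C1 / (\int[(mboxs M)]_y r y) * (1 - \int[(mboxs M)]_y r y) ^+ n.
  under eq_fun do under eq_bigr do rewrite termE.
  exact: Htail.
have q01 : 0 <= 1 - \int[(mboxs M)]_y r y < 1 by rewrite subr_ge0 b01 ltrBlDr ltrDl.
have C10 : 0 <= C1 := bounded_kernel_ge0 (bD 0).
exists eta; split.
- split; first by move=> k; exact/LfunE.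
  by apply: le_lt_trans (linf_norm_le leta etaB) (ltry _).
- apply: (cvge0_squeeze _ _ om'_cv); first by move=> e; exact: linf_norm_ge0.
  have h1 : \forall e \near (0 : R)^', `|e| <= e1 by exact: dnbhs0_le.
  have h2 : \forall e \near (0 : R)^', e != 0 by exact: nbhs_dnbhs_neq.
  apply: filterS2 h1 h2 => e ee en0; apply: linf_norm_le => k; last exact: Hom'.
  have lmue : L1 (mboxs M) (mu e k) by have [[]] := emu e ee k.
  apply: L1B => //; under eq_fun do rewrite mulrC.
  by apply: L1Z; exact: L1B.
- move=> k; apply: (cvge0_squeeze _ _
    (geometric_cvg0 (C1 / (\int[(mboxs M)]_y r y)) q01)); first by move=> n; exact: L1norm_ge0.
  have : \forall n \near \oo, (0 < n)%N by exact: nbhs_infty_gt.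
  apply: filterS => -[//|n] _.
  have -> : (fun y => eta k y - (g (k - 1) y + \sum_(1 <= j < n.+1) term k j y)) =
      (fun y => eta k y - \sum_(j < n.+1) term k j y).
    apply/funext => y; rewrite -(big_mkord xpredT (fun j => term k j y)).
    by rewrite [in RHS]big_ltn// {2}/term /= subr0.
  rewrite L1normE ?lee_fin; first exact: Htail.
  by apply: L1B => //; apply: L1_sum => j; exact: (Hterm k j).1.
- by move=> k j; apply/LfunE; exact: (Hterm k j).1.
- exact: sup_tail_cvg0 q01 C10 Hterm.
Qed.
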